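(* Let $p\in[1,\infty)$ and $\varphi\in W^{1,p}((0,1);\mathbb{R}^2)$. The following are equivalent: (1) there is a sequence $\{\varphi_k\}\subset\mathcal{F}_p$ with $\varphi_k\to\varphi$ strongly in $W^{1,p}((0,1);\mathbb{R}^2)$; (2) there is a sequence $\{\varphi_k\}\subset\mathcal{F}_p$ with $\varphi_k\rightharpoonup\varphi$ weakly in $W^{1,p}((0,1);\mathbb{R}^2)$; (3) there is an equicontinuous sequence $\{\tilde\varphi_k\}\subset\mathcal{F}_p$ converging uniformly to $\varphi$ on $(0,1)$. Moreover, in (1) the approximating sequence may be chosen to consist of piecewise affine maps. In particular, for $p\in(1,\infty)$ the following are equivalent: (a) $\varphi$ is non-interpenetrative; (b) there is a bounded sequence of homeomorphisms in $W^{1,p}((0,1);\mathbb{R}^2)$ converging weakly to $\varphi$ in $W^{1,p}$; (c) there is a bounded sequence of homeomorphisms in $W^{1,p}((0,1);\mathbb{R}^2)$ converging strongly to $\varphi$ in $W^{1,p}$, and this sequence can be chosen piecewise affine.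
   Context: $\mathcal{F}_p:=\{\varphi\in W^{1,p}((0,1);\mathbb{R}^2):\varphi$ is continuous and one-to-one$\}$. ''Homeomorphism'' means homeomorphism onto its image. A map $y\in W^{1,p}((0,1);\mathbb{R}^2)$ is non-interpenetrative if there exists a sequence $\{y_k\}$ of homeomorphisms, bounded in $W^{1,p}((0,1);\mathbb{R}^2)$, with $\|y_k-y\|_{C^0((0,1);\mathbb{R}^2)}\to0$. Elements of $W^{1,p}((0,1);\mathbb{R}^2)$ are identified with their continuous representatives. *)

(* Defs.v *)
From HB Require Import structures.
From mathcomp Require Import all_boot all_order all_algebra.
From mathcomp Require Import all_classical all_reals all_analysis.
Set Implicit Arguments. Unset Strict Implicit. Unset Printing Implicit Defensive.
Import Order.TTheory GRing.Theory Num.Theory.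
Import numFieldNormedType.Exports.
Local Open Scope classical_set_scope.
Local Open Scope ring_scope.

Section Sobolev1D.
Variable R : realType.

Definition I01 : set R := `]0%R, 1%R[.

(* maps (0,1) -> R^2 are represented as functions R -> R * R; only values on
   (0,1) matter in every definition below *)
Definition map2 := R -> R * R.

Definition comp1 (f : map2) : R -> R := fun x => (f x).1.
Definition comp2 (f : map2) : R -> R := fun x => (f x).2.

Definition dist2 (u v : R * R) : R :=
  Num.sqrt ((u.1 - v.1) ^+ 2 + (u.2 - v.2) ^+ 2).

Definition lpint (p : R) (f : R -> R) : \bar R :=
  (\int[lebesgue_measure]_(x in I01) ((`|f x| `^ p)%:E))%E.

Definition isLp (p : R) (f : R -> R) : Prop :=
  measurable_fun I01 f /\ (lpint p f < +oo)%E.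

Definition test_fun (psi : R -> R) : Prop :=
  (forall x, derivable psi x 1) /\ continuous (derive1 psi) /\
  exists a b : R, [/\ 0 < a, a < b, b < 1 &
    forall x, (x < a \/ b < x) -> psi x = 0].

Definition weak_deriv (f g : R -> R) : Prop :=
  forall psi, test_fun psi ->
    Rintegral lebesgue_measure I01 (fun x => f x * derive1 psi x) =
    - Rintegral lebesgue_measure I01 (fun x => g x * psi x).

Definition W1p_pair (p : R) (f g : R -> R) : Prop :=
  [/\ isLp p f, isLp p g & weak_deriv f g].

(* phi in W^{1,p}((0,1);R^2) with (componentwise) weak derivative dphi;
   elements are identified with their continuous representatives *)
Definition W1p_with (p : R) (phi dphi : map2) : Prop :=
  [/\ {within I01, continuous phi},
      W1p_pair p (comp1 phi) (comp1 dphi) &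
      W1p_pair p (comp2 phi) (comp2 dphi)].

Definition inW1p (p : R) (phi : map2) : Prop := exists dphi, W1p_with p phi dphi.

Definition W1p_norm (p : R) (phi dphi : map2) : R :=
  (fine (lpint p (comp1 phi) + lpint p (comp2 phi)
        + lpint p (comp1 dphi) + lpint p (comp2 dphi))%E) `^ p^-1.

Definition subm (f g : map2) : map2 := fun x => ((f x).1 - (g x).1, (f x).2 - (g x).2).
Definition addm (f g : map2) : map2 := fun x => ((f x).1 + (g x).1, (f x).2 + (g x).2).
Definition scalem (a : R) (f : map2) : map2 := fun x => (a * (f x).1, a * (f x).2).

Definition in_Fp (p : R) (phi : map2) : Prop :=
  [/\ inW1p p phi, {within I01, continuous phi} & {in I01 &, injective phi}].

Definition homeo_onto_image (phi : map2) : Prop :=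
  [/\ {within I01, continuous phi}, {in I01 &, injective phi} &
    forall x, I01 x -> forall e : R, 0 < e -> exists2 d : R, 0 < d &
      forall y, I01 y -> dist2 (phi y) (phi x) < d -> `|y - x| < e].

Definition W1p_strong (p : R) (phik : nat -> map2) (phi : map2) : Prop :=
  exists (dk : nat -> map2) (d : map2),
    [/\ forall k, W1p_with p (phik k) (dk k), W1p_with p phi d &
        (fun k => W1p_norm p (subm (phik k) phi) (subm (dk k) d)) @ \oo --> (0:R)].

Definition W1p_dual (p : R) (L : map2 -> R) : Prop :=
  (forall (a : R) f g, inW1p p f -> inW1p p g ->
     L (addm (scalem a f) g) = a * L f + L g) /\
  exists C : R, forall f df, W1p_with p f df -> `|L f| <= C * W1p_norm p f df.

Definition W1p_weak (p : R) (phik : nat -> map2) (phi : map2) : Prop :=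
  [/\ forall k, inW1p p (phik k), inW1p p phi &
    forall L, W1p_dual p L -> (fun k => L (phik k)) @ \oo --> L phi].

Definition W1p_bounded (p : R) (phik : nat -> map2) : Prop :=
  exists C : R, forall k, exists dk, W1p_with p (phik k) dk /\ W1p_norm p (phik k) dk <= C.

Definition unif_conv (phik : nat -> map2) (phi : map2) : Prop :=
  forall e : R, 0 < e -> exists N : nat, forall k, (N <= k)%N ->
    forall x, I01 x -> dist2 (phik k x) (phi x) < e.

Definition equicont (phik : nat -> map2) : Prop :=
  forall x, I01 x -> forall e : R, 0 < e -> exists2 d : R, 0 < d &
    forall k y, I01 y -> `|y - x| < d -> dist2 (phik k y) (phik k x) < e.

Definition piecewise_affine (phi : map2) : Prop :=
  exists (n : nat) (t : nat -> R),
    [/\ t 0%N = 0, t n = 1, (forall i, (i < n)%N -> t i < t i.+1) &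
      forall i, (i < n)%N -> exists A B : R * R,
        forall x, I01 x -> t i <= x -> x <= t i.+1 -> phi x = (A.1 + x * B.1, A.2 + x * B.2)].

Definition non_interpenetrative (p : R) (y : map2) : Prop :=
  exists yk : nat -> map2,
    [/\ forall k, inW1p p (yk k) /\ homeo_onto_image (yk k),
        W1p_bounded p yk &
        forall e : R, 0 < e -> exists N : nat, forall k, (N <= k)%N ->
          exists2 M : R, M < e & forall x, I01 x -> dist2 (yk k x) (y x) <= M].

End Sobolev1D.

(* Main.v *)
(** Strong convergence implies weak convergence trivially, and weak convergence implies
    uniform convergence by a gliding hump: otherwise there are disjoint intervals
    ]a_j, b_j] on which some f_(k_j) increases by e/2, and the bounded functional
    u |-> sum_j (u(b_j) - u(a_j)) does not tend to 0 along the sequence.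

    The main point is that a uniform limit phi of injective curves is a strong limit of
    injective polygons. Take a square grid of mesh delta in general position, so that phi
    and all phi_k meet it finitely often (Banach's indicatrix). The arcs cut out of an
    injective phi_k by one cell are disjoint, hence so are their chords, up to replacing
    the square by a strictly convex curve (Poincare-Miranda): this gives a simple polygon.
    Squeezing the plane along the grid moves the crossing points of phi_k next to those of
    phi. Hence the polygon has nearly the slopes of the interpolation of phi at its own
    crossing times, except on time intervals of small total length or near the ends. When
    delta tends to 0, these slopes converge almost everywhere to phi', because phi
    oscillates little on each piece, and Jensen's inequality controls their norms, so that
    they converge in L^p by Scheffe's argument. *)

Require Import Defs.
From HB Require Import structures.
From mathcomp Require Import all_boot all_order all_algebra.
From mathcomp Require Import all_classical all_reals all_analysis.
From mathcomp Require Import measurable_realfun ring lra zify.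
Set Implicit Arguments. Unset Strict Implicit. Unset Printing Implicit Defensive.
Import Order.TTheory GRing.Theory Num.Theory.
Import numFieldNormedType.Exports.
Local Open Scope classical_set_scope.
Local Open Scope ring_scope.

(** * Poincare-Miranda in the plane *)

(** Uniform convergence says nothing about how often [phi_k] meets a grid line near one crossing of
    [phi], so the number of arcs is known only once the approximant is fixed. Hence the squeeze has
    a radius chosen beforehand and a factor chosen last, and the break times of the polygon, which
    cluster at crossing times of [phi], are pulled apart by increments with a small sum. The short
    pieces created in this way do not carry the slope of [phi]; their total lengths are summable
    along the sequence, so that almost every time leaves them for good. The other pieces may well be
    long: a small oscillation suffices, since on a long piece where [phi] hardly moves both slopes
    are small. Chords of the square itself would not do, because two chords with ends on one side
    may overlap; this is where strict convexity enters. At [p = 1] the space embeds in the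
    continuous functions without compactness, so that weak convergence calls for an argument of its
    own, and the Scheffe argument works for [p = 1] as well. *)

Lemma addb_telescope (n : nat) (a : nat -> bool) :
  \big[addb/false]_(0 <= i < n) (a i (+) a i.+1) = a 0%N (+) a n.
Proof.
elim: n => [|n IH]; first by rewrite big_geq // addbb.
by rewrite big_nat_recr //= IH -addbA (addbA (a n)) addbb.
Qed.

Section Labels.
Variable n : nat.
Variable L : nat -> nat -> 'I_3.

(** The doors of Sperner's argument. *)
Let AB (u v : 'I_3) : bool :=
  ((u == 0 :> nat) && (v == 1 :> nat)) || ((u == 1 :> nat) && (v == 0 :> nat)).

Definition cell_has i j k : bool :=
  [|| L i j == k :> nat, L i.+1 j == k :> nat, L i j.+1 == k :> nat | L i.+1 j.+1 == k :> nat].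

(** A cell that misses a label has an even number of [AB] edges. Summed modulo 2 over all cells, the
    interior edges cancel, so the boundary of the large square would have an even number too. The
    bottom (only 0), the top (no 0) and the right side (no 1) have none; along the left side,
    labelled by 0 and 1 alone, the label passes from 0 to 1 and changes an odd number of times. *)
Lemma sperner_square :
  (forall i, (i <= n)%N -> L i 0%N = 0%N :> nat) ->
  (forall i, (i <= n)%N -> L i n != 0%N :> nat) ->
  (forall j, (j <= n)%N -> L 0%N j != 2 :> nat) ->
  (forall j, (j <= n)%N -> L n j != 1%N :> nat) ->
  exists i j, [/\ (i < n)%N, (j < n)%N, cell_has i j 0, cell_has i j 1 & cell_has i j 2].
Proof.
move=> Hb Ht Hl Hr.
pose h i j := AB (L i j) (L i.+1 j).
pose v i j := AB (L i j) (L i j.+1).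
case: (pselect (exists i j, [/\ (i < n)%N, (j < n)%N, cell_has i j 0, cell_has i j 1 & cell_has i j 2])) => // Hn.
exfalso.
have Hc i j : (i < n)%N -> (j < n)%N ->
    (h i j (+) h i j.+1) (+) (v i j (+) v i.+1 j) = false.
  move=> Hi Hj.
  have : ~~ [&& cell_has i j 0, cell_has i j 1 & cell_has i j 2].
    by apply/negP => /and3P[h0 h1 h2]; apply: Hn; exists i, j.
  rewrite /h /v /AB /cell_has.
  by case: (L i j) => -[|[|[|]]] //= _; case: (L i.+1 j) => -[|[|[|]]] //= _;
     case: (L i j.+1) => -[|[|[|]]] //= _; case: (L i.+1 j.+1) => -[|[|[|]]] //= _.
have : \big[addb/false]_(0 <= i < n) \big[addb/false]_(0 <= j < n)
    ((h i j (+) h i j.+1) (+) (v i j (+) v i.+1 j)) = false.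
  rewrite big_nat_cond big1 // => i /andP[/andP[_ Hi] _].
  by rewrite big_nat_cond big1 // => j /andP[/andP[_ Hj] _]; exact: Hc.
under eq_bigr do rewrite big_split.
rewrite big_split /=.
rewrite [X in X (+) _]big_nat_cond [X in X (+) _]big1 ?addFb; last first.
  move=> i /andP[/andP[_ Hi] _]; rewrite (addb_telescope n (h i)) /h /AB.
  rewrite (Hb i (ltnW Hi)) (Hb i.+1 Hi) /=.
  have := Ht i (ltnW Hi); have := Ht i.+1 Hi.
  by case: (L i n) => -[|[|[|]]] //=; case: (L i.+1 n) => -[|[|[|]]].
rewrite exchange_big /=.
under eq_bigr do rewrite (addb_telescope n (fun i => v i _)).
rewrite big_split /= [X in _ (+) X]big_nat_cond [X in _ (+) X]big1 ?addbF; last first.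
  move=> j /andP[/andP[_ Hj] _]; rewrite /v /AB.
  have := Hr j (ltnW Hj); have := Hr j.+1 Hj.
  by case: (L n j) => -[|[|[|]]] //=; case: (L n j.+1) => -[|[|[|]]].
pose a j := L 0%N j == 0%N :> nat.
rewrite (eq_big_nat _ _ (F2 := fun j => a j (+) a j.+1)); last first.
  move=> j /andP[_ Hj]; rewrite /v /AB /a.
  have := Hl j (ltnW Hj); have := Hl j.+1 Hj.
  by case: (L 0%N j) => -[|[|[|]]] //=; case: (L 0%N j.+1) => -[|[|[|]]].
rewrite addb_telescope /a (Hb 0%N) // (negbTE (Ht 0%N _)) //.
Qed.
End Labels.

Section PM.
Variable R : realType.
Implicit Types (f g : R -> R -> R).

(** Sperner's lemma on finer and finer grids, with labels given by the sign of [g] and then of [f].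
    A completely labelled cell has a vertex with [g < 0], one with [g >= 0 > f], and one where both
    are nonnegative; at a cluster point of such cells continuity forces both functions to vanish. *)
Lemma poincare_miranda f g (p q : R) : p < q ->
  continuous (fun z : R * R => f z.1 z.2) ->
  continuous (fun z : R * R => g z.1 z.2) ->
  (forall t, p <= t <= q -> f p t < 0) -> (forall t, p <= t <= q -> 0 < f q t) ->
  (forall s, p <= s <= q -> g s p < 0) -> (forall s, p <= s <= q -> 0 < g s q) ->
  exists s t, [/\ p <= s <= q, p <= t <= q, f s t = 0 & g s t = 0].
Proof.
move=> pq cf cg fl fr gb gt.
pose x (n i : nat) : R := p + (q - p) * i%:R / n.+1%:R.
pose lab n i j : 'I_3 := if g (x n i) (x n j) < 0 then @Ordinal 3 0 isT else
   if f (x n i) (x n j) < 0 then @Ordinal 3 1 isT else @Ordinal 3 2 isT.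
have xb n i : (i <= n.+1)%N -> p <= x n i <= q.
  move=> Hi; have Hi' : (i%:R / n.+1%:R : R) <= 1 by rewrite ler_pdivrMr ?mul1r ?ler_nat // ltr0n.
  have Hi0 : 0 <= (i%:R / n.+1%:R : R) by rewrite divr_ge0.
  rewrite /x -mulrA; set u := _ / _ in Hi' Hi0 *.
  have h1 : 0 <= (q - p) * u by rewrite mulr_ge0 // subr_ge0 ltW.
  have h2 : 0 <= (q - p) * (1 - u) by rewrite mulr_ge0 // subr_ge0 // ltW.
  by apply/andP; split; lra.
have x0 n : x n 0%N = p by rewrite /x mulr0 mul0r addr0.
have x1 n : x n n.+1 = q by rewrite /x mulfK ?pnatr_eq0 // addrC subrK.
have Hsq n : exists z : R * R, [/\ p <= z.1 <= q, p <= z.2 <= q &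
   exists2 za : R * R, `|za.1 - z.1| <= (q-p)/n.+1%:R /\ `|za.2 - z.2| <= (q-p)/n.+1%:R & exists2 zb : R * R, `|zb.1 - z.1| <= (q-p)/n.+1%:R /\ `|zb.2 - z.2| <= (q-p)/n.+1%:R & exists2 zc : R * R, `|zc.1 - z.1| <= (q-p)/n.+1%:R /\ `|zc.2 - z.2| <= (q-p)/n.+1%:R & [/\ g za.1 za.2 <0, 0 <= g zb.1 zb.2 /\ f zb.1 zb.2 < 0 & 0 <= g zc.1 zc.2 /\ 0 <= f zc.1 zc.2]].
  have [||||i [j [Hi Hj c0 c1 c2]]] := @sperner_square n.+1 (lab n).
  - by move=> i Hi; rewrite /lab x0 gb ?xb.
  - by move=> i Hi; rewrite /lab x1 ltNge (ltW (gt _ _)) ?xb //=; case: ifP.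
  - by move=> j Hj; rewrite /lab x0 fl ?xb //; case: ifP.
  - by move=> j Hj; rewrite /lab x1 [f _ _ < 0]ltNge (ltW (fr _ _)) ?xb //=; case: ifP.
  exists (x n i, x n j); split; [exact: xb (ltnW Hi)|exact: xb (ltnW Hj)|].
  have d0 : 0 <= (q-p)/n.+1%:R by rewrite divr_ge0 // subr_ge0 ltW.
  have dd k : `|x n k - x n k| <= (q-p)/n.+1%:R by rewrite subrr normr0.
  have dS k : `|x n k.+1 - x n k| <= (q-p)/n.+1%:R.
    have -> : x n k.+1 - x n k = (q-p)/n.+1%:R by rewrite /x (_ : k.+1%:R = k%:R + 1 :> R) ?natrD -?natr1 //; ring.
    by rewrite ger0_norm.
  have get k : cell_has (lab n) i j k -> exists2 zz : R*R,
      `|zz.1 - x n i| <= (q-p)/n.+1%:R /\ `|zz.2 - x n j| <= (q-p)/n.+1%:R &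
      exists i' j', zz = (x n i', x n j') /\ lab n i' j' = k :> nat.
    have H i' j' : `|x n i' - x n i| <= (q-p)/n.+1%:R -> `|x n j' - x n j| <= (q-p)/n.+1%:R ->
        lab n i' j' = k :> nat -> exists2 zz : R*R, `|zz.1 - x n i| <= (q-p)/n.+1%:R /\ `|zz.2 - x n j| <= (q-p)/n.+1%:R &
      exists i' j', zz = (x n i', x n j') /\ lab n i' j' = k :> nat.
      by move=> h1 h2 h3; exists (x n i', x n j'); [split|exists i', j'].
    by case/or4P => /eqP E; apply: H E.
  have [za da [i0 [j0 [ea la]]]] := get _ c0.
  have [zb db [i1 [j1 [eb lb]]]] := get _ c1.
  have [zc dc [i2 [j2 [ec lc]]]] := get _ c2.
  exists za => //; exists zb => //; exists zc => //; subst; rewrite /=.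
  move: la lb lc; rewrite /lab.
  case: (ltP (g (x n i0) (x n j0)) 0) => [ga _|_]; last by case: ifP.
  case: (ltP (g (x n i1) (x n j1)) 0) => [//|gb']; case: (ltP (f (x n i1) (x n j1)) 0) => [fb _|//].
  case: (ltP (g (x n i2) (x n j2)) 0) => [//|gc']; case: (ltP (f (x n i2) (x n j2)) 0) => [//|fc _].
  by [].
have [z Hz] := choice Hsq.
have cK : compact ((`[p, q]%classic : set R) `*` (`[p,q]%classic : set R)).
  by apply: compact_setX; exact: segment_compact.
have Hzin : (z @ \oo) ((`[p, q]%classic : set R) `*` (`[p,q]%classic : set R)).
  by exists 0%N => // n _ /=; have [? ? _] := Hz n; split; rewrite /= in_itv.
have [[s t] [[/= s1 t1] cl]] := cK (z @ \oo) _ Hzin.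
move: s1 t1; rewrite !in_itv /= => s1 t1.
(* The vertices [zz n] cluster wherever the cells do, so a property shared by all of them cannot
   fail on a whole neighbourhood of the cluster point. *)
have near_pt (P : R * R -> Prop) (zz : nat -> R * R) :
   (forall n, `|(zz n).1 - (z n).1| <= (q-p)/n.+1%:R /\ `|(zz n).2 - (z n).2| <= (q-p)/n.+1%:R) ->
   (forall n, P (zz n)) -> nbhs (s, t) (~` P) -> False.
  move=> dzz Pzz /nbhs_ballP[e /= e0 He].
  have e20 : 0 < e / 2 by lra.
  have qp0 : 0 < q - p by lra.
  have [N _ HN] : \forall n \near \oo, (q-p)/n.+1%:R < e/2.
    exists (Num.truncn ((q-p)/(e/2))) => // n /= Hn.
    rewrite ltr_pdivrMr ?ltr0n // mulrC -ltr_pdivrMr //.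
    apply: lt_le_trans (truncnS_gt _) _; rewrite ler_nat //.
  have A1 : (z @ \oo) (z @` [set n | (N <= n)%N]).
    by exists N => // n /= Hn; exists n.
  have A2 : nbhs (s, t) (ball (s,t) (e/2)) by exact: nbhsx_ballx.
  have [w [[n /= Hn <-] [/= b1 b2]]] := cl _ _ A1 A2.
  apply: (He (zz n)) (Pzz n).
  have [d1 d2] := dzz n; have := HN n Hn; move: b1 b2; rewrite /ball /= => b1 b2 dn.
  have tri (a b c d : R) : `|a - b| < e/2 -> `|c - b| <= d -> d < e/2 -> `|a - c| < e.
    move=> h1 h2 h3; rewrite (_ : a - c = (a - b) - (c - b)); last by ring.
    by apply: (le_lt_trans (ler_normB _ _)); lra.
  by split; [exact: tri b1 d1 dn|exact: tri b2 d2 dn].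
have appr (P : R * R -> Prop) :
   (forall n, exists2 zz : R * R, `|zz.1 - (z n).1| <= (q-p)/n.+1%:R /\ `|zz.2 - (z n).2| <= (q-p)/n.+1%:R & P zz) ->
   nbhs (s, t) (~` P) -> False.
  move=> H; have /choice [zz Hzz] : forall n, exists zz : R * R, (`|zz.1 - (z n).1| <= (q-p)/n.+1%:R /\ `|zz.2 - (z n).2| <= (q-p)/n.+1%:R) /\ P zz.
    by move=> n; have [w] := H n; exists w.
  by apply: (near_pt P zz) => n; have [] := Hzz n.
have openlt (h : R * R -> R) a : continuous h -> h (s, t) < a -> nbhs (s, t) [set w | h w < a].
  by move=> ch hh; exact: (ch (s, t) [set u | u < a] (lt_nbhsl hh)).
have opengt (h : R * R -> R) a : continuous h -> a < h (s, t) -> nbhs (s, t) [set w | a < h w].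
  by move=> ch hh; exact: (ch (s, t) [set u | a < u] (lt_nbhsr hh)).
have gz : g s t = 0.
  apply/eqP; rewrite eq_le; apply/andP; split; rewrite leNgt; apply/negP => H.
  - apply: (appr (fun w => g w.1 w.2 < 0)).
      by move=> n; have [_ _ [za da [zb _ [zc _ []]]]] := Hz n; exists za.
    by apply: filterS (opengt _ _ cg H) => w /= ? ?; lra.
  - apply: (appr (fun w => 0 <= g w.1 w.2)).
      by move=> n; have [_ _ [za da [zb db [zc _ [_ []]]]]] := Hz n; exists zb.
    by apply: filterS (openlt _ _ cg H) => w /= ? ?; lra.
have fz : f s t = 0.
  apply/eqP; rewrite eq_le; apply/andP; split; rewrite leNgt; apply/negP => H.
  - apply: (appr (fun w => f w.1 w.2 < 0)).
      by move=> n; have [_ _ [za da [zb db [zc _ [_ []]]]]] := Hz n; exists zb.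
    by apply: filterS (opengt _ _ cf H) => w /= ? ?; lra.
  - apply: (appr (fun w => 0 <= f w.1 w.2)).
      by move=> n; have [_ _ [za da [zb db [zc dc [_ _ []]]]]] := Hz n; exists zc.
    by apply: filterS (openlt _ _ cf H) => w /= ? ?; lra.
by exists s, t.
Qed.
End PM.

(** * Chords of disjoint arcs *)

Section Continuity.
Variables (R : realType) (T : topologicalType).
Implicit Types f g : T -> R.
Lemma contD f g : continuous f -> continuous g -> continuous (fun x => f x + g x).
Proof. by move=> cf cg x; apply: cvgD; [exact: cf|exact: cg]. Qed.
Lemma contN f : continuous f -> continuous (fun x => - f x).
Proof. by move=> cf x; apply: cvgN; exact: cf. Qed.
Lemma contB f g : continuous f -> continuous g -> continuous (fun x => f x - g x).
Proof. by move=> cf cg x; apply: cvgB; [exact: cf|exact: cg]. Qed.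
Lemma contM f g : continuous f -> continuous g -> continuous (fun x => f x * g x).
Proof. by move=> cf cg x; apply: cvgM; [exact: cf|exact: cg]. Qed.
Lemma contC (c : R) : continuous (fun _ : T => c).
Proof. by move=> x; exact: cvg_cst. Qed.
Lemma cont_comp (f : T -> R) (h : R -> R) : continuous f -> continuous h -> continuous (fun x => h (f x)).
Proof. by move=> cf ch x; apply: (@continuous_comp _ _ _ f h); [exact: cf|exact: ch]. Qed.
Lemma cont_max f g : continuous f -> continuous g -> continuous (fun x => Num.max (f x) (g x)).
Proof. by move=> cf cg x; apply: continuous_max; [exact: cf|exact: cg]. Qed.
Lemma cont_min f g : continuous f -> continuous g -> continuous (fun x => Num.min (f x) (g x)).
Proof. by move=> cf cg x; apply: continuous_min; [exact: cf|exact: cg]. Qed.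
Lemma cont_id : continuous (fun x : R => x).
Proof. by move=> x; exact: cvg_id. Qed.
Lemma cont_fst : continuous (fun z : R * R => z.1).
Proof. by move=> x; exact: cvg_fst. Qed.
Lemma cont_snd : continuous (fun z : R * R => z.2).
Proof. by move=> x; exact: cvg_snd. Qed.
End Continuity.

Ltac cont := lazymatch goal with
 | |- continuous (fun _ => ?c) => apply: (@contC _ _ c)
 | |- continuous (fun z => @?f z + @?g z) => apply: (@contD _ _ f g); cont
 | |- continuous (fun z => - @?f z) => apply: (@contN _ _ f); cont
 | |- continuous (fun z => @?f z * @?g z) => apply: (@contM _ _ f g); cont
 | |- continuous (fun z => Num.max (@?f z) (@?g z)) => apply: (@cont_max _ _ f g); cont
 | |- continuous (fun z => Num.min (@?f z) (@?g z)) => apply: (@cont_min _ _ f g); cont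
 | |- continuous (fun z => z) => apply: cont_id
 | |- _ => try assumption
 end.

Section Gauge.
Variable R : realType.
Implicit Types (u v z a b c d e : R * R) (t s k : R).

Definition lerp t u v : R * R := ((1 - t) * u.1 + t * v.1, (1 - t) * u.2 + t * v.2).
(** The squared maximum norm plus a multiple of the squared Euclidean norm. It is homogeneous of
    degree 2, and for [k > 0] its unit ball is strictly convex and fills the square as [k] tends to
    0. *)
Definition gauge k z : R := Num.max (z.1 ^+ 2) (z.2 ^+ 2) + k * (z.1 ^+ 2 + z.2 ^+ 2).

Lemma gauge_le k z x : (gauge k z <= x) = (z.1 ^+ 2 + k * (z.1 ^+ 2 + z.2 ^+ 2) <= x) && (z.2 ^+ 2 + k * (z.1 ^+ 2 + z.2 ^+ 2) <= x).
Proof. by rewrite /gauge -lerBrDr ge_max !lerBrDr. Qed.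
Lemma gauge_lt k z x : (gauge k z < x) = (z.1 ^+ 2 + k * (z.1 ^+ 2 + z.2 ^+ 2) < x) && (z.2 ^+ 2 + k * (z.1 ^+ 2 + z.2 ^+ 2) < x).
Proof. by rewrite /gauge -ltrBrDr gt_max !ltrBrDr. Qed.

Lemma lerp0 u v : lerp 0 u v = u.
Proof. by case: u v => [? ?] [? ?]; rewrite /lerp /= subr0 !mul1r !mul0r !addr0. Qed.
Lemma lerp1 u v : lerp 1 u v = v.
Proof. by case: u v => [? ?] [? ?]; rewrite /lerp /= subrr !mul1r !mul0r !add0r. Qed.
Lemma lerpuu t u : lerp t u u = u.
Proof. by case: u => [x y]; rewrite /lerp /=; congr (_, _); ring. Qed.

(** Both quadratic forms under the maximum are convex, by [(1-t) x^2 + t y^2 - ((1-t) x + t y)^2 = t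
    (1-t) (x-y)^2]. *)
Lemma gauge_lerp k t u v : 0 <= k -> 0 <= t <= 1 ->
  gauge k u <= 1 -> gauge k v <= 1 -> gauge k (lerp t u v) <= 1.
Proof.
move=> k0 /andP[t0 t1]; rewrite !gauge_le /lerp /= => /andP[u1 u2] /andP[v1 v2].
have h : 0 <= t * (1 - t) by rewrite mulr_ge0 // subr_ge0.
have h1 : 0 <= t * (1 - t) * (u.1 - v.1) ^+ 2 by rewrite mulr_ge0 // sqr_ge0.
have h2 : 0 <= t * (1 - t) * (u.2 - v.2) ^+ 2 by rewrite mulr_ge0 // sqr_ge0.
have h3 : 0 <= k * (t * (1 - t) * (u.1 - v.1) ^+ 2) by rewrite mulr_ge0.
have h4 : 0 <= k * (t * (1 - t) * (u.2 - v.2) ^+ 2) by rewrite mulr_ge0.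
have h5 : 0 <= 1 - t by rewrite subr_ge0.
have e1 := ler_wpM2l h5 u1; have e2 := ler_wpM2l t0 v1.
have e3 := ler_wpM2l h5 u2; have e4 := ler_wpM2l t0 v2.
by apply/andP; split; lra.
Qed.

(** The Euclidean part leaves the positive defect [k t (1-t) |u-v|^2]. *)
Lemma gauge_lerp_lt k t u v : 0 < k -> 0 < t < 1 -> u != v ->
  gauge k u <= 1 -> gauge k v <= 1 -> gauge k (lerp t u v) < 1.
Proof.
move=> k0 /andP[t0 t1] uv; rewrite !gauge_le gauge_lt /lerp /= => /andP[u1 u2] /andP[v1 v2].
have h : 0 < t * (1 - t) by rewrite mulr_gt0 // subr_gt0.
have h0 : 0 < (u.1 - v.1) ^+ 2 + (u.2 - v.2) ^+ 2.
  rewrite lt_neqAle addr_ge0 ?sqr_ge0 // andbT eq_sym paddr_eq0 ?sqr_ge0 //.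
  rewrite !sqrf_eq0 !subr_eq0; apply: contra uv => /andP[/eqP h1 /eqP h2].
  by case: u v h1 h2 {u1 u2 v1 v2} => [? ?] [? ?] /= -> ->.
have h1 : 0 <= t * (1 - t) * (u.1 - v.1) ^+ 2 by rewrite mulr_ge0 ?sqr_ge0 // ltW.
have h2 : 0 <= t * (1 - t) * (u.2 - v.2) ^+ 2 by rewrite mulr_ge0 ?sqr_ge0 // ltW.
have h3 : 0 < k * (t * (1 - t) * ((u.1 - v.1) ^+ 2 + (u.2 - v.2) ^+ 2)).
  by rewrite mulr_gt0 // mulr_gt0.
have h5 : 0 <= 1 - t by rewrite subr_ge0 ltW.
have e1 := ler_wpM2l h5 u1; have e2 := ler_wpM2l (ltW t0) v1.
have e3 := ler_wpM2l h5 u2; have e4 := ler_wpM2l (ltW t0) v2.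
by apply/andP; split; lra.
Qed.

Lemma gauge_extreme k t e u v : 0 < k -> 0 <= t <= 1 -> gauge k e = 1 ->
  gauge k u <= 1 -> gauge k v <= 1 -> e = lerp t u v -> e = u \/ e = v.
Proof.
move=> k0 /andP[t0 t1] e1 u1 v1 E.
have [uv|uv] := eqVneq u v; first by left; rewrite E uv lerpuu.
have [t00|t00] := eqVneq t 0; first by left; rewrite E t00 lerp0.
have [t11|t11] := eqVneq t 1; first by right; rewrite E t11 lerp1.
have t01 : 0 < t < 1 by rewrite !lt_neqAle t0 t1 eq_sym t00 t11.
by have := @gauge_lerp_lt k t u v k0 t01 uv u1 v1; rewrite -E e1 ltxx.
Qed.

(** Crossing parallel chords would lie on one line, which would carry the three distinct points [a],
    [b], [c] of the curve; one of them would be between the other two, against strict convexity. *)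
Lemma chords_cross_det k s t a b c d : 0 < k -> 0 <= s <= 1 -> 0 <= t <= 1 ->
  gauge k a = 1 -> gauge k b = 1 -> gauge k c = 1 -> gauge k d = 1 ->
  a <> b -> c <> a -> c <> b ->
  lerp s a b = lerp t c d -> (b.1 - a.1) * (d.2 - c.2) - (b.2 - a.2) * (d.1 - c.1) != 0.
Proof.
move=> k0 s01 t01 ga gb gc gd ab ca cb E; apply/eqP => D0.
have [m Em] : exists m, c = lerp m a b.
  have [l [l1 l2]] : exists l, d.1 - c.1 = l * (b.1 - a.1) /\ d.2 - c.2 = l * (b.2 - a.2).
    have [h|h] := eqVneq b.1 a.1.
      have h2 : b.2 - a.2 != 0.
        rewrite subr_eq0; apply/eqP => h2; apply: ab.
        by case: (a) (b) h h2 => [? ?] [? ?] /= -> ->.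
      exists ((d.2 - c.2) / (b.2 - a.2)); split; last by rewrite divfK.
      move: D0; rewrite h subrr mul0r sub0r mulr0 => /eqP.
      by rewrite oppr_eq0 mulf_eq0 (negbTE h2) /= => /eqP.
    have h2 : b.1 - a.1 != 0 by rewrite subr_eq0.
    exists ((d.1 - c.1) / (b.1 - a.1)); split; first by rewrite divfK.
    apply: (mulfI h2); have -> : (b.1 - a.1) * ((d.1 - c.1) / (b.1 - a.1) * (b.2 - a.2)) = (b.2 - a.2) * (d.1 - c.1) by field.
    by apply/eqP; rewrite -subr_eq0; apply/eqP.
  (* Read off from [a + s (b-a) = c + t l (b-a)]. *)
  exists (s - t * l); case: E; rewrite /lerp => E1 E2.
  by rewrite [c]surjective_pairing; congr (_, _); nra.
have le1 (x : R) : x = 1 -> x <= 1 by move=> ->.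
have [m0|m0] := ltP m 0.
  have [] := @gauge_extreme k (- m / (1 - m)) a c b k0 _ ga (le1 _ gc) (le1 _ gb); [| |by move=> h; apply: ca|by []].
    by rewrite divr_ge0 ?ler_pdivrMr; lra.
  have hm : 1 - m != 0 by rewrite gt_eqF //; lra.
  by rewrite [a in LHS]surjective_pairing Em /lerp /=; congr (_, _); field.
have [m1|m1] := ltP 1 m.
  have [] := @gauge_extreme k (m^-1) b a c k0 _ gb (le1 _ ga) (le1 _ gc); [| |by move=> h; apply: ab|by move=> h; apply: cb].
    by rewrite invr_ge0 m0 /= invf_le1 ?ltW //; lra.
  have hm : m != 0 by rewrite gt_eqF //; lra.
  by rewrite [b in LHS]surjective_pairing Em /lerp /=; congr (_, _); field.
by have [] := @gauge_extreme k m c a b k0 _ gc (le1 _ ga) (le1 _ gb) Em; rewrite ?m0.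
Qed.

Definition clamp01 (x : R) : R := Num.min (Num.max x 0) 1.
(** The distance from [x] to [0, 1]. Within [-1, 2] it equals 1 only at the ends, where the
    deformation into the chord is complete. *)
Definition excess (x : R) : R := Num.max (- x) 0 + Num.max (x - 1) 0.

Lemma clamp01_itv x : 0 <= clamp01 x <= 1.
Proof. by rewrite /clamp01 le_min le_max lexx orbT ler01 /= ge_min lexx orbT. Qed.
Lemma clamp01_id x : 0 <= x <= 1 -> clamp01 x = x.
Proof. by rewrite /clamp01 => /andP[h0 h1]; rewrite max_l // min_l. Qed.
Lemma excess_itv x : -1 <= x <= 2 -> 0 <= excess x <= 1.
Proof. by rewrite /excess; case: (leP (-x) 0); case: (leP (x-1) 0); lra. Qed.
Lemma clamp01_cases x : [\/ 0 <= x <= 1 /\ excess x = 0, clamp01 x = 0 | clamp01 x = 1].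
Proof.
rewrite /excess /clamp01; case: (leP (-x) 0); case: (leP (x-1) 0) => h1 h2.
- by apply: Or31; split; lra.
- by apply: Or33; rewrite max_l ?min_r; lra.
- by apply: Or32; rewrite max_r ?min_l; lra.
- lra.
Qed.
Lemma cont_clamp01 : continuous clamp01.
Proof. by apply: cont_min; [apply: cont_max; [exact: cont_id|exact: contC]|exact: contC]. Qed.
Lemma cont_excess : continuous excess.
Proof.
apply: contD; apply: cont_max; try exact: contC.
  by apply: contN; exact: cont_id.
by apply: contB; [exact: cont_id|exact: contC].
Qed.

Lemma cont_comp1 (f : R -> R) : continuous f -> continuous (fun z : R * R => f z.1).
Proof. by move=> cf; apply: cont_comp cf; exact: cont_fst. Qed.
Lemma cont_comp2 (f : R -> R) : continuous f -> continuous (fun z : R * R => f z.2).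
Proof. by move=> cf; apply: cont_comp cf; exact: cont_snd. Qed.

(* Extend A - B to [-1, 2]^2 by deforming each arc into its chord outside [0, 1]; strict
   convexity keeps the extension away from 0 on the collar, so Poincare-Miranda turns a
   crossing of the chords into a crossing of the arcs. *)
Lemma disjoint_arcs_chords k (A1 A2 B1 B2 : R -> R)
  (A := fun t => (A1 t, A2 t)) (B := fun t => (B1 t, B2 t)) :
  0 < k -> continuous A1 -> continuous A2 -> continuous B1 -> continuous B2 ->
  (forall t, 0 <= t <= 1 -> gauge k (A t) <= 1) ->
  (forall t, 0 <= t <= 1 -> gauge k (B t) <= 1) ->
  gauge k (A 0) = 1 -> gauge k (A 1) = 1 -> gauge k (B 0) = 1 -> gauge k (B 1) = 1 ->
  (forall s t, 0 <= s <= 1 -> 0 <= t <= 1 -> A s <> B t) -> A 0 <> A 1 ->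
  forall s t, 0 <= s <= 1 -> 0 <= t <= 1 -> lerp s (A 0) (A 1) <> lerp t (B 0) (B 1).
Proof.
move=> k0 cA1 cA2 cB1 cB2 FA FB ga gb gc gd AB ab s0 t0 s01 t01 E0.
set a := A 0 in ga ab E0 *; set b := A 1 in gb ab E0 *.
set c := B 0 in gc E0 *; set d := B 1 in gd E0 *.
have i0 : 0 <= (0 : R) <= 1 by rewrite lexx ler01.
have i1 : 0 <= (1 : R) <= 1 by rewrite lexx ler01.
have nca : c <> a by move=> h; exact: (AB 0 0).
have ncb : c <> b by move=> h; exact: (AB 1 0).
have nda : d <> a by move=> h; exact: (AB 0 1).
have ndb : d <> b by move=> h; exact: (AB 1 1).
have [Ea [Eb [Ec Ed]]] : A 0 = a /\ A 1 = b /\ B 0 = c /\ B 1 = d by [].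
have AB' (s : R) : 0 <= s <= 1 -> [/\ a <> B s, b <> B s, A s <> c & A s <> d].
  by move=> hs; split; apply: AB.
clearbody a b c d.
have D0 := chords_cross_det k0 s01 t01 ga gb gc gd ab nca ncb E0.
set D := (X in X != 0) in D0.
have le1 (x : R) : x = 1 -> x <= 1 by move=> ->.
(* The arc [A] is deformed when the parameter [t] of the other arc leaves [0, 1]. Where [s] itself
   is outside, [A'] rests at an end of the arc, which belongs to the chord too; so on the whole
   boundary of the large square both [A'] and [B'] are chord points. *)
pose A' s t := lerp (excess t) (A (clamp01 s)) (lerp (clamp01 s) a b).
pose B' s t := lerp (excess s) (B (clamp01 t)) (lerp (clamp01 t) c d).
have LF u v x : gauge k u = 1 -> gauge k v = 1 -> gauge k (lerp (clamp01 x) u v) <= 1.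
  by move=> h1 h2; apply: gauge_lerp; [exact: ltW|exact: clamp01_itv|exact: le1|exact: le1].
(* Outside [0, 1]^2 one of the two points is an end of its arc, hence extreme in the convex set, and
   could equal the other point only by lying on the other arc. *)
have nz s t : -1 <= s <= 2 -> -1 <= t <= 2 -> A' s t <> B' s t.
  move=> /excess_itv es /excess_itv et; rewrite /A' /B'.
  have HA : excess t = 0 -> lerp (excess t) (A (clamp01 s)) (lerp (clamp01 s) a b) = A (clamp01 s).
    by move=> ->; rewrite lerp0.
  have HB : excess s = 0 -> lerp (excess s) (B (clamp01 t)) (lerp (clamp01 t) c d) = B (clamp01 t).
    by move=> ->; rewrite lerp0.
  have A_end e : gauge k e = 1 -> (forall x, 0 <= x <= 1 -> e <> B x) ->
      e <> lerp (excess s) (B (clamp01 t)) (lerp (clamp01 t) c d).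
    move=> ge eB h.
    have [] := gauge_extreme k0 es ge (FB _ (clamp01_itv t)) (LF _ _ t gc gd) h.
      by apply: eB; exact: clamp01_itv.
    move=> h'; have [] := gauge_extreme k0 (clamp01_itv t) ge (le1 _ gc) (le1 _ gd) h'.
      by rewrite -Ec; exact: eB.
    by rewrite -Ed; exact: eB.
  have B_end e : gauge k e = 1 -> (forall x, 0 <= x <= 1 -> A x <> e) ->
      lerp (excess t) (A (clamp01 s)) (lerp (clamp01 s) a b) <> e.
    move=> ge eB h.
    have [h'|] := gauge_extreme k0 et ge (FA _ (clamp01_itv s)) (LF _ _ s ga gb) (esym h).
      by apply: (eB (clamp01 s)); [exact: clamp01_itv|].
    move=> h'; have [h''|h''] := gauge_extreme k0 (clamp01_itv s) ge (le1 _ ga) (le1 _ gb) h'.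
      by apply: (eB 0); rewrite ?Ea.
    by apply: (eB 1); rewrite ?Eb.
  have [[s1 es0]|cs|cs] := clamp01_cases s.
  - have [[t1 et0]|ct|ct] := clamp01_cases t.
    + by rewrite HA // HB //; apply: AB; exact: clamp01_itv.
    + rewrite HB // ct ?Ec ?Ed; apply: B_end => // x x01; by have [] := AB' x x01.
    + rewrite HB // ct ?Ec ?Ed; apply: B_end => // x x01; by have [] := AB' x x01.
  - rewrite cs lerp0 Ea lerpuu; apply: A_end => // x x01; by have [] := AB' x x01.
  - rewrite cs lerp1 Eb lerpuu; apply: A_end => // x x01; by have [] := AB' x x01.
(* Cramer's rule: up to sign, the coordinates of [A' - B'] along the two chords. On the boundary
   they reduce to [clamp01 s - s0] and [clamp01 t - t0]. *)
pose f s t := (((A' s t).1 - (B' s t).1) * (d.2 - c.2) - ((A' s t).2 - (B' s t).2) * (d.1 - c.1)) / D.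
pose g s t := - ((b.1 - a.1) * ((A' s t).2 - (B' s t).2) - (b.2 - a.2) * ((A' s t).1 - (B' s t).1)) / D.
have c1 := cont_comp1 cont_clamp01; have c2 := cont_comp2 cont_clamp01.
have x1 := cont_comp1 cont_excess; have x2 := cont_comp2 cont_excess.
have cA'1 := cont_comp c1 cA1; have cA'2 := cont_comp c1 cA2.
have cB'1 := cont_comp c2 cB1; have cB'2 := cont_comp c2 cB2.
have E01 : (1 - s0) * a.1 + s0 * b.1 = (1 - t0) * c.1 + t0 * d.1 by case: E0.
have E02 : (1 - s0) * a.2 + s0 * b.2 = (1 - t0) * c.2 + t0 * d.2 by case: E0.
have bd s t : A' s t = lerp (clamp01 s) a b -> B' s t = lerp (clamp01 t) c d ->
   f s t = clamp01 s - s0 /\ g s t = clamp01 t - t0.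
  rewrite /f /g => -> ->; rewrite /lerp /=; set x := clamp01 s; set y := clamp01 t.
  have e1 : (1 - x) * a.1 + x * b.1 - ((1 - y) * c.1 + y * d.1) = (x - s0) * (b.1 - a.1) - (y - t0) * (d.1 - c.1).
    by move: E01; lra.
  have e2 : (1 - x) * a.2 + x * b.2 - ((1 - y) * c.2 + y * d.2) = (x - s0) * (b.2 - a.2) - (y - t0) * (d.2 - c.2).
    by move: E02; lra.
  by rewrite !{}e1 !{}e2; split; apply: (mulIf D0); rewrite divfK // /D; ring.
have bdA s t : excess t = 1 -> A' s t = lerp (clamp01 s) a b by rewrite /A' => ->; rewrite lerp1.
have bdA' s t : clamp01 s = 0 \/ clamp01 s = 1 -> A' s t = lerp (clamp01 s) a b.
  by rewrite /A'; case=> ->; rewrite ?lerp0 ?lerp1 ?Ea ?Eb lerpuu.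
have bdB s t : excess s = 1 -> B' s t = lerp (clamp01 t) c d by rewrite /B' => ->; rewrite lerp1.
have bdB' s t : clamp01 t = 0 \/ clamp01 t = 1 -> B' s t = lerp (clamp01 t) c d.
  by rewrite /B'; case=> ->; rewrite ?lerp0 ?lerp1 ?Ec ?Ed lerpuu.
have cm : clamp01 (-1) = 0 by rewrite /clamp01 max_r ?min_l //; lra.
have cp : clamp01 2 = 1 by rewrite /clamp01 max_l ?min_r //; lra.
have em : excess (-1) = 1 by rewrite /excess max_l ?max_r //; lra.
have ep : excess 2 = 1 by rewrite /excess max_r ?max_l //; lra.
(* An end of one chord lying on the other chord would be an end of it as well. The strict
   inequalities give the signs on the boundary. *)
have s0p : 0 < s0 < 1.
  rewrite !lt_neqAle; case/andP: (s01) => -> ->; rewrite !andbT; apply/andP; split; apply/eqP => h.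
  - move: E0; rewrite -h lerp0 => E0.
    by have [/esym|/esym] := gauge_extreme k0 t01 ga (le1 _ gc) (le1 _ gd) E0.
  - move: E0; rewrite h lerp1 => E0.
    by have [/esym|/esym] := gauge_extreme k0 t01 gb (le1 _ gc) (le1 _ gd) E0.
have t0p : 0 < t0 < 1.
  rewrite !lt_neqAle; case/andP: (t01) => -> ->; rewrite !andbT; apply/andP; split; apply/eqP => h.
  - move: E0; rewrite -h lerp0 => /esym E0.
    by have [] := gauge_extreme k0 s01 gc (le1 _ ga) (le1 _ gb) E0.
  - move: E0; rewrite h lerp1 => /esym E0.
    by have [] := gauge_extreme k0 s01 gd (le1 _ ga) (le1 _ gb) E0.
have m12 : (-1 : R) < 2 by lra.
have cf : continuous (fun z : R * R => f z.1 z.2).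
  rewrite /f /A' /B' /lerp /=.
  by cont.
have cg : continuous (fun z : R * R => g z.1 z.2).
  rewrite /g /A' /B' /lerp /=.
  by cont.
have [||||s [t [s1 t1 fz gz]]] := poincare_miranda m12 cf cg.
- move=> t _; have [|| -> _] := bd (-1) t; [by apply: bdA'; left|by apply: bdB|].
  by rewrite cm; lra.
- move=> t _; have [|| -> _] := bd 2 t; [by apply: bdA'; right|by apply: bdB|].
  by rewrite cp; lra.
- move=> s _; have [|| _ ->] := bd s (-1); [by apply: bdA|by apply: bdB'; left|].
  by rewrite cm; lra.
- move=> s _; have [|| _ ->] := bd s 2; [by apply: bdA|by apply: bdB'; right|].
  by rewrite cp; lra.
apply: (nz s t s1 t1).
move: fz gz; rewrite /f /g => /eqP + /eqP; rewrite !mulf_eq0 !invr_eq0 (negbTE D0) !orbF oppr_eq0.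
set X := (A' s t).1 - _; set Y := (A' s t).2 - _ => /eqP h1 /eqP h2.
have hX : X = 0.
  apply: (mulIf D0); rewrite mul0r /D.
  have -> : X * ((b.1 - a.1) * (d.2 - c.2) - (b.2 - a.2) * (d.1 - c.1)) =
    (b.1 - a.1) * (X * (d.2 - c.2) - Y * (d.1 - c.1)) + (d.1 - c.1) * ((b.1 - a.1) * Y - (b.2 - a.2) * X) by ring.
  by rewrite h1 h2 !mulr0 addr0.
have hY : Y = 0.
  apply: (mulIf D0); rewrite mul0r /D.
  have -> : Y * ((b.1 - a.1) * (d.2 - c.2) - (b.2 - a.2) * (d.1 - c.1)) =
    (b.2 - a.2) * (X * (d.2 - c.2) - Y * (d.1 - c.1)) + (d.2 - c.2) * ((b.1 - a.1) * Y - (b.2 - a.2) * X) by ring.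
  by rewrite h1 h2 !mulr0 addr0.
by rewrite [LHS]surjective_pairing [RHS]surjective_pairing; congr (_, _); apply/eqP; rewrite -subr_eq0; apply/eqP.
Qed.
End Gauge.

(** * Chords inside a square cell *)

Section Cell.
Variable R : realType.
Implicit Types (u v z a b c d e q : R * R) (t s k m : R).

(* The square [nm z <= 1] is not strictly convex: chords are drawn between the radial
   projections [hat k] of its boundary points onto the strictly convex curve
   [gauge k z = 1], which lies just inside. *)
Definition scl m z : R * R := (m * z.1, m * z.2).
Definition nm z : R := Num.max (z.1 ^+ 2) (z.2 ^+ 2).
Definition rad k q : R := (Num.sqrt (gauge k q))^-1.
Definition hat k q : R * R := scl (rad k q) q.

Lemma nm_le z x : (nm z <= x) = (z.1 ^+ 2 <= x) && (z.2 ^+ 2 <= x).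
Proof. by rewrite /nm ge_max. Qed.
Lemma nm_scl m z : nm (scl m z) = m ^+ 2 * nm z.
Proof. by rewrite /nm /scl /= !exprMn maxr_pMr // sqr_ge0. Qed.
Lemma gauge_scl k m z : gauge k (scl m z) = m ^+ 2 * gauge k z.
Proof. by rewrite /gauge -/(nm _) nm_scl /scl /= /nm; ring. Qed.
Lemma gauge_nm k z : gauge k z = nm z + k * (z.1 ^+ 2 + z.2 ^+ 2).
Proof. by []. Qed.
Lemma nm_sum z : nm z <= z.1 ^+ 2 + z.2 ^+ 2 <= 2 * nm z.
Proof.
have h1 := sqr_ge0 z.1; have h2 := sqr_ge0 z.2.
by rewrite /nm; case: (leP (z.1 ^+ 2) (z.2 ^+ 2)) => h; apply/andP; split; lra.
Qed.
Lemma gauge_bounds k z : 0 < k -> (1 + k) * nm z <= gauge k z <= (1 + 2 * k) * nm z.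
Proof.
move=> k0; rewrite gauge_nm; have /andP[h1 h2] := nm_sum z.
have h3 := ler_wpM2l (ltW k0) h1; have h4 := ler_wpM2l (ltW k0) h2.
by apply/andP; split; lra.
Qed.
Lemma gauge_lt_nm k z : 0 < k -> gauge k z <= 1 -> nm z < 1.
Proof.
move=> k0 h; have /andP[h1 _] := gauge_bounds z k0; rewrite ltNge; apply/negP => h2.
have := ler_pM2l k0 1 (nm z); rewrite h2 => h3; have {h3} : k * 1 <= k * nm z by rewrite h3.
lra.
Qed.

Lemma gauge_gt1 k q (k0 : 0 < k) (q1 : nm q = 1) : 1 < gauge k q <= 1 + 2 * k.
Proof. by have /andP[h1 h2] := gauge_bounds q k0; rewrite q1 !mulr1 in h1 h2; apply/andP; split; lra. Qed.
Lemma rad_sqr k q (k0 : 0 < k) (q1 : nm q = 1) : rad k q ^+ 2 * gauge k q = 1.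
Proof.
have /andP[g1 _] := gauge_gt1 k0 q1.
by rewrite /rad exprVn sqr_sqrtr ?mulVf ?gt_eqF //; lra.
Qed.
Lemma rad_gt0 k q (k0 : 0 < k) (q1 : nm q = 1) : 0 < rad k q.
Proof. by rewrite invr_gt0 sqrtr_gt0; have /andP[] := gauge_gt1 k0 q1; lra. Qed.
Lemma rad_lt1 k q (k0 : 0 < k) (q1 : nm q = 1) : rad k q < 1.
Proof.
rewrite invf_lt1 ?sqrtr_gt0; last by have /andP[] := gauge_gt1 k0 q1; lra.
by rewrite -[ltLHS]sqrtr1 ltr_sqrt; have /andP[] := gauge_gt1 k0 q1; lra.
Qed.
Lemma rad_gt k q (k0 : 0 < k) (q1 : nm q = 1) : (Num.sqrt (1 + 3 * k))^-1 < rad k q.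
Proof.
have /andP[h1 h2] := gauge_gt1 k0 q1.
rewrite /rad ltf_pV2 ?posrE ?sqrtr_gt0; [|lra|lra].
by rewrite ltr_sqrt; lra.
Qed.
(** Here [gauge k q <= 1 + 2k] is set against [(1-k)^2 (1+2k) = 1 - 3k^2 + 2k^3 < 1] for
    [0 < k < 1]. Consequently [hat k] displaces a boundary point of the square by at most [k] in
    each coordinate. *)
Lemma rad_ge k q (k0 : 0 < k) (q1 : nm q = 1) : 1 - k <= rad k q.
Proof.
have h := rad_sqr k0 q1; have h0 := rad_gt0 k0 q1; have /andP[h1 h2] := gauge_gt1 k0 q1.
rewrite leNgt; apply/negP => h3.
have h4 : rad k q ^+ 2 < (1 - k) ^+ 2 by rewrite ltr_pXn2r ?nnegrE //; lra.
have h5 : rad k q ^+ 2 * gauge k q <= rad k q ^+ 2 * (1 + 2 * k) by rewrite ler_wpM2l // sqr_ge0.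
have h6 : rad k q ^+ 2 * (1 + 2 * k) < (1 - k) ^+ 2 * (1 + 2 * k) by rewrite ltr_pM2r //; lra.
have h7 : k < 1 by lra.
have h8 : 0 <= k * k * (1 - k) by rewrite !mulr_ge0 //; lra.
have h9 : 0 <= k * k by rewrite mulr_ge0 // ltW.
nra.
Qed.
Lemma gauge_hat k q (k0 : 0 < k) (q1 : nm q = 1) : gauge k (hat k q) = 1.
Proof. by rewrite gauge_scl rad_sqr. Qed.

Lemma scl_eq m m' e e' : 0 < m -> 0 < m' -> nm e = 1 -> nm e' = 1 -> scl m e = scl m' e' -> m = m' /\ e = e'.
Proof.
move=> m0 m0' e1 e1' E; have mm : m = m'.
  apply/eqP; rewrite -(eqrXn2 (n:=2)) ?ltW //.
  by have := congr1 nm E; rewrite !nm_scl e1 e1' !mulr1 => ->.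
split=> //; subst m'; case: E => /(mulfI (lt0r_neq0 m0)) h1 /(mulfI (lt0r_neq0 m0)) h2.
by rewrite [e]surjective_pairing [e']surjective_pairing h1 h2.
Qed.

Lemma hat_inj k e e' : 0 < k -> nm e = 1 -> nm e' = 1 -> hat k e = hat k e' -> e = e'.
Proof. by move=> k0 e1 e1' h; have [] := scl_eq (rad_gt0 k0 e1) (rad_gt0 k0 e1') e1 e1' h. Qed.

(** The arcs may run along the sides of the square, outside the strictly convex curve. They are
    shrunk by the factor [sg] and prolonged radially from both ends up to the points given by
    [hat k]. The prolongations leave the shrunk square along rays that differ because the ends do,
    so the new arcs are still disjoint and [disjoint_arcs_chords] applies to them. *)
Lemma cell_chords k (A1 A2 B1 B2 : R -> R)
  (A := fun t => (A1 t, A2 t)) (B := fun t => (B1 t, B2 t)) :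
  0 < k -> continuous A1 -> continuous A2 -> continuous B1 -> continuous B2 ->
  (forall t, 0 <= t <= 1 -> nm (A t) <= 1) ->
  (forall t, 0 <= t <= 1 -> nm (B t) <= 1) ->
  nm (A 0) = 1 -> nm (A 1) = 1 -> nm (B 0) = 1 -> nm (B 1) = 1 ->
  (forall s t, 0 <= s <= 1 -> 0 <= t <= 1 -> A s <> B t) -> A 0 <> A 1 ->
  forall s t, 0 <= s <= 1 -> 0 <= t <= 1 ->
   lerp s (hat k (A 0)) (hat k (A 1)) <> lerp t (hat k (B 0)) (hat k (B 1)).
Proof.
move=> k0 cA1 cA2 cB1 cB2 FA FB ga gb gc gd AB ab.
(* Since [1 + 3k] exceeds the bound [1 + 2k] of [gauge k] on the square, the shrunk square lies
   inside the curve and [sg < rad k q] at every boundary point [q]. *)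
pose sg := (Num.sqrt (1 + 3 * k))^-1.
have sg0 : 0 < sg by rewrite invr_gt0 sqrtr_gt0; lra.
have sg2 : sg ^+ 2 * (1 + 3 * k) = 1 by rewrite /sg exprVn sqr_sqrtr ?mulVf ?gt_eqF //; lra.
pose m a b x := sg + (rad k a - sg) * Num.max (- x) 0 + (rad k b - sg) * Num.max (x - 1) 0.
pose ext (Z : R -> R * R) x := scl (m (Z 0) (Z 1) x) (Z (clamp01 x)).
have key (Z : R -> R * R) x : nm (Z 0) = 1 -> nm (Z 1) = 1 -> (forall t, 0 <= t <= 1 -> nm (Z t) <= 1) -> -1 <= x <= 2 ->
   (exists y, [/\ 0 <= y <= 1, ext Z x = scl sg (Z y) & nm (Z y) <= 1]) \/
   exists y e, [/\ 0 <= y <= 1, Z y = e, nm e = 1 & exists2 m, sg < m <= rad k e & ext Z x = scl m e].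
  move=> z0 z1 Zb /andP[xm xp]; rewrite /ext /m.
  have [x0|x0] := ltP x 0.
    right; exists 0, (Z 0); rewrite lexx ler01; split => //.
    have := rad_gt k0 z0; rewrite -/sg => hr.
    have -> : clamp01 x = 0 by rewrite /clamp01 max_r ?min_l //; lra.
    have -> : Num.max (-x) 0 = - x by rewrite max_l //; lra.
    have -> : Num.max (x - 1) 0 = 0 by rewrite max_r //; lra.
    eexists; last by reflexivity.
    have h1 : 0 < (rad k (Z 0) - sg) * (- x) by rewrite mulr_gt0; lra.
    have h2 : 0 <= (rad k (Z 0) - sg) * (1 + x) by rewrite mulr_ge0; lra.
    by apply/andP; split; lra.
  have [x1|x1] := ltP 1 x.
    right; exists 1, (Z 1); rewrite lexx ler01; split => //.
    have := rad_gt k0 z1; rewrite -/sg => hr.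
    have -> : clamp01 x = 1 by rewrite /clamp01 max_l ?min_r //; lra.
    have -> : Num.max (-x) 0 = 0 by rewrite max_r //; lra.
    have -> : Num.max (x - 1) 0 = x - 1 by rewrite max_l //; lra.
    eexists; last by reflexivity.
    have h1 : 0 < (rad k (Z 1) - sg) * (x - 1) by rewrite mulr_gt0; lra.
    have h2 : 0 <= (rad k (Z 1) - sg) * (2 - x) by rewrite mulr_ge0; lra.
    by apply/andP; split; lra.
  left; exists x; rewrite x0 x1; split; [by []| |by apply: Zb; rewrite x0].
  rewrite clamp01_id ?x0 //; congr scl.
  by rewrite !max_r; lra.
have extg (Z : R -> R * R) x : nm (Z 0) = 1 -> nm (Z 1) = 1 -> (forall t, 0 <= t <= 1 -> nm (Z t) <= 1) -> -1 <= x <= 2 ->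
   gauge k (ext Z x) <= 1.
  move=> z0 z1 Zb xb; have [[y [_ -> ny]]|[y [e [_ _ e1 [m' /andP[m0 m1] ->]]]]] := key Z x z0 z1 Zb xb.
    rewrite gauge_scl -sg2 ler_wpM2l ?sqr_ge0 //.
    have /andP[_ h] := gauge_bounds (Z y) k0; apply: (le_trans h).
    have := ler_wpM2l (_ : 0 <= 1 + 2 * k) ny; rewrite mulr1 => h2.
    by apply: (le_trans (h2 _)); lra.
  rewrite gauge_scl -(rad_sqr k0 e1) ler_pM2r; last by have := gauge_gt1 k0 e1; lra.
  by rewrite lerXn2r ?nnegrE //; lra.
have ext_disj x y : -1 <= x <= 2 -> -1 <= y <= 2 -> ext A x <> ext B y.
  move=> xb yb.
  have [[x' [x01 -> nx]]|[x' [e [x01 Ee e1 [m' /andP[m0 m1] ->]]]]] := key A x ga gb FA xb;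
  have [[y' [y01 -> ny]]|[y' [e' [y01 Ee' e1' [m'' /andP[m0' m1'] ->]]]]] := key B y gc gd FB yb => E.
  - apply: (AB x' y' x01 y01); case: E => /(mulfI (lt0r_neq0 sg0)) h1 /(mulfI (lt0r_neq0 sg0)) h2.
    by rewrite /A /B h1 h2.
  - have := congr1 nm E; rewrite !nm_scl e1' mulr1 => h.
    have : sg ^+ 2 * nm (A x') <= sg ^+ 2 * 1 by rewrite ler_wpM2l ?sqr_ge0.
    rewrite h mulr1 leNgt ltr_pXn2r ?nnegrE ?m0' //; lra.
  - have := congr1 nm E; rewrite !nm_scl e1 mulr1 => /esym h.
    have : sg ^+ 2 * nm (B y') <= sg ^+ 2 * 1 by rewrite ler_wpM2l ?sqr_ge0.
    rewrite h mulr1 leNgt ltr_pXn2r ?nnegrE ?m0 //; lra.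
  - have [||_ ee] := scl_eq _ _ e1 e1' E; [lra|lra|].
    by apply: (AB x' y' x01 y01); rewrite Ee Ee' ee.
(* The outer thirds of [0, 1] run through the prolongations, the middle third through the shrunk
   arc. *)
pose rp x : R := 3 * x - 1.
have rpb x : 0 <= x <= 1 -> -1 <= rp x <= 2 by rewrite /rp; lra.
have crp : continuous rp by rewrite /rp; cont.
have ends (Z : R -> R * R) : ext Z (rp 0) = hat k (Z 0) /\ ext Z (rp 1) = hat k (Z 1).
  rewrite /rp /ext /hat; split.
    have -> : 3 * 0 - 1 = -1 :> R by rewrite mulr0 sub0r.
    have -> : clamp01 (-1) = 0 :> R by rewrite /clamp01 max_r ?min_l //; lra.
    by congr scl; rewrite /m max_l ?max_r; lra.
  have -> : 3 * 1 - 1 = 2 :> R by ring.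
  have -> : clamp01 2 = 1 :> R by rewrite /clamp01 max_l ?min_r //; lra.
  by congr scl; rewrite /m max_r ?max_l; lra.
have cm a b : continuous (fun x => m a b (rp x)) by rewrite /m; cont.
have cZ (Z : R -> R) : continuous Z -> continuous (fun x => Z (clamp01 (rp x))).
  by move=> cz; apply: cont_comp cz; apply: cont_comp crp _; exact: cont_clamp01.
move=> s t s01 t01.
have [eA0 eA1] := ends A; have [eB0 eB1] := ends B.
rewrite -eA0 -eA1 -eB0 -eB1.
apply: (@disjoint_arcs_chords R k (fun x => m (A 0) (A 1) (rp x) * A1 (clamp01 (rp x)))
  (fun x => m (A 0) (A 1) (rp x) * A2 (clamp01 (rp x)))
  (fun x => m (B 0) (B 1) (rp x) * B1 (clamp01 (rp x)))
  (fun x => m (B 0) (B 1) (rp x) * B2 (clamp01 (rp x)))) => //.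
- by apply: contM; [exact: cm|exact: cZ].
- by apply: contM; [exact: cm|exact: cZ].
- by apply: contM; [exact: cm|exact: cZ].
- by apply: contM; [exact: cm|exact: cZ].
- by move=> x /rpb xb; exact: (extg A).
- by move=> x /rpb xb; exact: (extg B).
- by change (gauge k (ext A (rp 0)) = 1); rewrite eA0 gauge_hat.
- by change (gauge k (ext A (rp 1)) = 1); rewrite eA1 gauge_hat.
- by change (gauge k (ext B (rp 0)) = 1); rewrite eB0 gauge_hat.
- by change (gauge k (ext B (rp 1)) = 1); rewrite eB1 gauge_hat.
- by move=> x y /rpb xb /rpb yb; exact: ext_disj.
- change (ext A (rp 0) <> ext A (rp 1)); rewrite eA0 eA1 => /(hat_inj k0 ga gb); exact: ab.
Qed.
End Cell.

(** * Simple polygons from chains of arcs *)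

Section Polygon.
Variable R : realType.
Implicit Types (u v z a b c d e q : R * R).

Definition padd u v : R * R := (u.1 + v.1, u.2 + v.2).
Definition psub u v : R * R := (u.1 - v.1, u.2 - v.2).

Lemma paddI c u v : padd c u = padd c v -> u = v.
Proof. by case=> /addrI h1 /addrI h2; rewrite [u]surjective_pairing h1 h2 -surjective_pairing. Qed.
Lemma paddKB c u : padd c (psub u c) = u.
Proof. by rewrite /padd /psub /= !subrKC -surjective_pairing. Qed.
Lemma psubKD c u : psub (padd c u) c = u.
Proof. by rewrite /padd /psub /= ![c.1 + _]addrC ![c.2 + _]addrC !addrK -surjective_pairing. Qed.
Lemma psub_inj c u v : psub u c = psub v c -> u = v.
Proof. by move=> h; rewrite -(paddKB c u) h paddKB. Qed.

Definition simple_polygon (N : nat) (w : nat -> R * R) : Prop :=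
  (forall i, (i < N)%N -> w i <> w i.+1) /\
  forall i i' (x y : R), (i < i')%N -> (i' < N)%N -> 0 <= x <= 1 -> 0 <= y <= 1 ->
    lerp x (w i) (w i.+1) = lerp y (w i') (w i'.+1) -> [/\ i' = i.+1, x = 1 & y = 0].

(* the arc of f between the times s j and s j.+1 lies in the square of center C j
   and half-side 1 *)
Definition chain (f1 f2 : R -> R) (M : nat) (s : nat -> R) (C : nat -> R * R) : Prop :=
  [/\ forall j, (j < M)%N -> s j < s j.+1,
      forall j t, (j < M)%N -> s j <= t <= s j.+1 -> nm (psub (f1 t, f2 t) (C j)) <= 1 &
      forall j, (j < M)%N -> nm (psub (f1 (s j), f2 (s j)) (C j)) = 1 /\
                         nm (psub (f1 (s j.+1), f2 (s j.+1)) (C j)) = 1].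

(** Two successive arcs share an end. If they were in one cell they would not be disjoint, and
    [cell_chords] could not separate their chords. *)
Definition tiled (M : nat) (C : nat -> R * R) : Prop :=
  (forall j, (j.+1 < M)%N -> C j <> C j.+1) /\
  forall i j z, (i < M)%N -> (j < M)%N -> C i <> C j ->
    nm (psub z (C i)) <= 1 -> nm (psub z (C j)) <= 1 -> nm (psub z (C i)) = 1.

(* Each arc contributes two vertices on the inner curve of its cell and one on the grid. *)
Definition vert k (q C : nat -> R * R) (i : nat) : R * R :=
  let j := (i %/ 3)%N in
  match (i %% 3)%N with
  | 0%N => q j
  | 1%N => padd (C j) (hat k (psub (q j) (C j)))
  | _ => padd (C j) (hat k (psub (q j.+1) (C j)))
  end.

(** The three edges contributed by one arc, relative to the centre of its cell: radially inward from
    the grid point [a], along the chord, radially outward to [b]. *)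
Definition useg k a b (r : nat) (x : R) : R * R :=
  match r with
  | 0%N => scl (1 - x + x * rad k a) a
  | 1%N => lerp x (hat k a) (hat k b)
  | _ => scl ((1 - x) * rad k b + x) b
  end.

Lemma vert_useg k (q C : nat -> R * R) i x :
  let j := (i %/ 3)%N in
  lerp x (vert k q C i) (vert k q C i.+1) =
   padd (C j) (useg k (psub (q j) (C j)) (psub (q j.+1) (C j)) (i %% 3)%N x).
Proof.
move=> j; rewrite /vert -/j.
have : (i %% 3 < 3)%N by rewrite ltn_mod.
case E : (i %% 3)%N => [|[|[|//]]] _.
- have -> : (i.+1 %/ 3 = j)%N by rewrite /j; lia.
  have -> : (i.+1 %% 3 = 1)%N by lia.
  by rewrite /lerp /padd /useg /hat /scl /psub /=; congr (_, _); ring.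
- have -> : (i.+1 %/ 3 = j)%N by rewrite /j; lia.
  have -> : (i.+1 %% 3 = 2)%N by lia.
  by rewrite /lerp /padd /useg /lerp /hat /scl /psub /=; congr (_, _); ring.
- have -> : (i.+1 %/ 3 = j.+1)%N by rewrite /j; lia.
  have -> : (i.+1 %% 3 = 0)%N by lia.
  by rewrite /lerp /padd /useg /hat /scl /psub /=; congr (_, _); ring.
Qed.

Section Useg.
Variables (k : R) (a b : R * R).
Hypotheses (k0 : 0 < k) (a1 : nm a = 1) (b1 : nm b = 1).

Lemma useg_conn r x : 0 <= x <= 1 -> (r < 3)%N -> r != 1%N ->
  exists m e, [/\ useg k a b r x = scl m e, (r = 0%N /\ e = a) \/ (r = 2%N /\ e = b),
     rad k e <= m <= 1, (m = 1 -> (r = 0%N /\ x = 0) \/ (r = 2%N /\ x = 1)) &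
      (m = rad k e -> (r = 0%N /\ x = 1) \/ (r = 2%N /\ x = 0))].
Proof.
move=> /andP[x0 x1]; case: r => [|[|[|//]]] // _ _.
- exists (1 - x + x * rad k a), a; have h1 := rad_lt1 k0 a1; have h0 := rad_gt0 k0 a1.
  split; [by []|by left| | |].
  + have p1 : 0 <= (1 - x) * (1 - rad k a) by rewrite mulr_ge0; lra.
    have p2 : 0 <= x * (1 - rad k a) by rewrite mulr_ge0; lra.
    by apply/andP; split; lra.
  + move=> h; left; split => //; apply/eqP.
    have : x * (1 - rad k a) = 0 by lra.
    by move/eqP; rewrite mulf_eq0 => /orP[//|/eqP]; lra.
  + move=> h; left; split => //; apply/eqP; rewrite eq_sym -subr_eq0.
    have : (1 - x) * (1 - rad k a) = 0 by lra.
    by move/eqP; rewrite mulf_eq0 => /orP[//|/eqP]; lra.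
- exists ((1 - x) * rad k b + x), b; have h1 := rad_lt1 k0 b1; have h0 := rad_gt0 k0 b1.
  split; [by []|by right| | |].
  + have p1 : 0 <= (1 - x) * (1 - rad k b) by rewrite mulr_ge0; lra.
    have p2 : 0 <= x * (1 - rad k b) by rewrite mulr_ge0; lra.
    by apply/andP; split; lra.
  + move=> h; right; split => //; apply/eqP; rewrite eq_sym -subr_eq0.
    have : (1 - x) * (1 - rad k b) = 0 by lra.
    by move/eqP; rewrite mulf_eq0 => /orP[//|/eqP]; lra.
  + move=> h; right; split => //; apply/eqP.
    have : x * (1 - rad k b) = 0 by lra.
    by move/eqP; rewrite mulf_eq0 => /orP[//|/eqP]; lra.
Qed.

Lemma useg_chord x : 0 <= x <= 1 -> gauge k (useg k a b 1 x) <= 1.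
Proof. by move=> x01; apply: gauge_lerp => //; rewrite ?gauge_hat // ltW. Qed.

Lemma useg_nm r x : 0 <= x <= 1 -> (r < 3)%N ->
  nm (useg k a b r x) <= 1 /\
  (nm (useg k a b r x) = 1 -> (r = 0%N /\ x = 0) \/ (r = 2%N /\ x = 1)).
Proof.
move=> x01 r3; have [->|r1] := eqVneq r 1%N.
  have := gauge_lt_nm k0 (useg_chord x01) => h; split; first exact: ltW.
  by move=> h'; move: h; rewrite h' ltxx.
have [m [e [-> He /andP[m0 m1] h1 _]]] := useg_conn x01 r3 r1.
have e1 : nm e = 1 by case: He => -[_ ->].
have e0 := rad_gt0 k0 e1.
rewrite nm_scl e1 mulr1; split; first by rewrite expr_le1 // (le_trans _ m0) // ltW.
by move=> /eqP; rewrite sqrf_eq1 => /orP[/eqP //|/eqP h]; move: m0; rewrite h; lra.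
Qed.

(** A connector stays where [gauge k] is at least 1 and the chord where it is at most 1. They can
    only meet on the curve, where strict convexity leaves nothing of the chord but its ends. *)
Lemma useg_conn_chord m e x : nm e = 1 -> rad k e <= m -> 0 <= x <= 1 ->
  scl m e = useg k a b 1 x -> m = rad k e /\ (e = a \/ e = b).
Proof.
move=> e1 m0 x01 E; have r0 := rad_gt0 k0 e1.
have g1 := useg_chord x01; rewrite -E gauge_scl in g1.
have h2 : rad k e ^+ 2 * gauge k e <= m ^+ 2 * gauge k e.
  by rewrite ler_pM2r ?lerXn2r ?nnegrE; have := gauge_gt1 k0 e1; lra.
have hm : m = rad k e.
  have g0 : gauge k e != 0 by have := gauge_gt1 k0 e1; move=> /andP[h _]; rewrite gt_eqF //; lra.
  have : m ^+ 2 * gauge k e = rad k e ^+ 2 * gauge k e.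
    by apply/eqP; rewrite eq_le h2 andbT (rad_sqr k0 e1).
  by move/(mulIf g0)/eqP; rewrite eqrXn2 //; [move/eqP|lra|lra].
split => //; subst m; have gle q : gauge k q = 1 -> gauge k q <= 1 by move=> ->.
have [h|h] := gauge_extreme k0 x01 (gauge_hat k0 e1) (gle _ (gauge_hat k0 a1)) (gle _ (gauge_hat k0 b1)) E.
  by left; exact: hat_inj h.
by right; exact: hat_inj h.
Qed.

Lemma lerp_end0 u v (x : R) : u <> v -> lerp x u v = u -> x = 0.
Proof.
case: u v => [u1 u2] [v1 v2] uv [] /= h1 h2; apply/eqP/negPn/negP => x0; apply: uv.
have e1 : x * (v1 - u1) = 0 by lra.
have e2 : x * (v2 - u2) = 0 by lra.
move/eqP: e1; move/eqP: e2; rewrite !mulf_eq0 (negbTE x0) /= !subr_eq0.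
by move=> /eqP -> /eqP ->.
Qed.
Lemma lerp_end1 u v (x : R) : u <> v -> lerp x u v = v -> x = 1.
Proof.
move=> uv h; have := @lerp_end0 v u (1 - x) (not_eq_sym uv).
have -> : lerp (1 - x) v u = lerp x u v by rewrite /lerp; congr (_, _); ring.
by move=> /(_ h); lra.
Qed.

Lemma useg_simple r r' x y : a <> b -> 0 <= x <= 1 -> 0 <= y <= 1 -> (r < r')%N -> (r' < 3)%N ->
  useg k a b r x = useg k a b r' y -> [/\ r' = r.+1, x = 1 & y = 0].
Proof.
move=> ab x01 y01; have hab : hat k a <> hat k b by move=> /(hat_inj k0 a1 b1).
have e01 : 0 <= (0 : R) <= 1 by rewrite lexx ler01.
have e11 : 0 <= (1 : R) <= 1 by rewrite lexx ler01.
case: r' => [//|[|[|//]]]; case: r => [|[|//]] // _ _ E.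
- have [m [e [Em [[_ He]|[//]] /andP[m0 m1] _ hm]]] := useg_conn (r := 0) x01 isT isT.
  subst e; rewrite Em in E; have [mr _] := useg_conn_chord a1 m0 y01 E.
  have [[_ x1]|[//]] := hm mr; split => //.
  by rewrite mr in E; apply: (lerp_end0 hab); exact: esym E.
- exfalso.
  have [m [e [Em [[_ He]|[//]] /andP[m0 m1] _ hm]]] := useg_conn (r := 0) x01 isT isT.
  have [m' [e' [Em' [[//]|[_ He']] /andP[m0' m1'] _ hm']]] := useg_conn (r := 2) y01 isT isT.
  subst e e'; rewrite Em Em' in E.
  have [||_ /ab //] := scl_eq _ _ a1 b1 E.
    exact: lt_le_trans (rad_gt0 k0 a1) m0.
  exact: lt_le_trans (rad_gt0 k0 b1) m0'.
- have [m' [e' [Em' [[//]|[_ He']] /andP[m0' m1'] _ hm']]] := useg_conn (r := 2) y01 isT isT.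
  subst e'; rewrite Em' in E; have [mr _] := useg_conn_chord b1 m0' x01 (esym E).
  have [[//]|[_ x1]] := hm' mr; split => //.
  by rewrite mr in E; apply: (lerp_end1 hab); exact: E.
Qed.

Lemma useg_nondeg r : a <> b -> (r < 3)%N -> useg k a b r 0 <> useg k a b r 1.
Proof.
move=> ab r3 E.
have e01 : 0 <= (0 : R) <= 1 by rewrite lexx ler01.
have e11 : 0 <= (1 : R) <= 1 by rewrite lexx ler01.
have [r1|r1] := eqVneq r 1%N.
  by move: E; rewrite r1 /useg lerp0 lerp1 => /(hat_inj k0 a1 b1).
move: r3 r1 E; case: r => [|[|[|//]]] // _ _.
  rewrite /= subr0 mul0r addr0 subrr add0r mul1r => E.
  have [||h _] := scl_eq _ _ a1 a1 E; [exact: ltr01|exact: rad_gt0|].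
  by have := rad_lt1 k0 a1; rewrite -h ltxx.
rewrite /= subr0 mul1r addr0 subrr mul0r add0r => E.
have [||h _] := scl_eq _ _ b1 b1 E; [exact: rad_gt0|exact: ltr01|].
by have := rad_lt1 k0 b1; rewrite h ltxx.
Qed.
End Useg.

Lemma useg_disjoint k a b c d r r' x y : 0 < k ->
  nm a = 1 -> nm b = 1 -> nm c = 1 -> nm d = 1 ->
  a <> c -> a <> d -> b <> c -> b <> d ->
  (forall s t, 0 <= s <= 1 -> 0 <= t <= 1 -> lerp s (hat k a) (hat k b) <> lerp t (hat k c) (hat k d)) ->
  0 <= x <= 1 -> 0 <= y <= 1 -> (r < 3)%N -> (r' < 3)%N ->
  useg k a b r x <> useg k c d r' y.
Proof.
move=> k0 a1 b1 c1 d1 ac ad bc bd H x01 y01 r3 r3' E.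
have [r1|r1] := eqVneq r 1%N; have [r1'|r1'] := eqVneq r' 1%N.
- by move: E; rewrite r1 r1'; exact: H.
- have [m [e [Em He /andP[m0 m1] _ hm]]] := useg_conn k0 c1 d1 y01 r3' r1'.
  have e1 : nm e = 1 by case: He => -[_ ->].
  rewrite r1 Em in E; have [_ hh] := useg_conn_chord k0 a1 b1 e1 m0 x01 (esym E).
  by case: He => -[_ He]; subst e; case: hh => h; subst.
- have [m [e [Em He /andP[m0 m1] _ hm]]] := useg_conn k0 a1 b1 x01 r3 r1.
  have e1 : nm e = 1 by case: He => -[_ ->].
  rewrite r1' Em in E; have [_ hh] := useg_conn_chord k0 c1 d1 e1 m0 y01 E.
  by case: He => -[_ He]; subst e; case: hh => h; subst.
- have [m [e [Em He /andP[m0 m1] _ hm]]] := useg_conn k0 a1 b1 x01 r3 r1.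
  have [m' [e' [Em' He' /andP[m0' m1'] _ hm']]] := useg_conn k0 c1 d1 y01 r3' r1'.
  have e1 : nm e = 1 by case: He => -[_ ->].
  have e1' : nm e' = 1 by case: He' => -[_ ->].
  rewrite Em Em' in E; have [||_ hh] := scl_eq _ _ e1 e1' E.
    exact: lt_le_trans (rad_gt0 k0 e1) m0.
    exact: lt_le_trans (rad_gt0 k0 e1') m0'.
  by case: He => -[_ He]; case: He' => -[_ He']; subst.
Qed.

Lemma chain_lt f1 f2 M s C : chain f1 f2 M s C ->
  forall i j, (i < j)%N -> (j <= M)%N -> s i < s j.
Proof.
case=> hs _ _ i j; elim: j => [//|j IH]; rewrite ltnS leq_eqVlt => /orP[/eqP ->|ij] jM; first exact: hs.
by apply: lt_trans (IH ij (ltnW jM)) (hs _ jM).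
Qed.

Lemma arc_chords k f1 f2 c (p1 p2 p3 p4 : R) (q := fun t => psub (f1 t, f2 t) c) : 0 < k ->
  continuous f1 -> continuous f2 -> p1 < p2 -> p3 < p4 ->
  (forall t, p1 <= t <= p2 -> nm (q t) <= 1) -> (forall t, p3 <= t <= p4 -> nm (q t) <= 1) ->
  nm (q p1) = 1 -> nm (q p2) = 1 -> nm (q p3) = 1 -> nm (q p4) = 1 ->
  (forall t t', p1 <= t <= p2 -> p3 <= t' <= p4 -> q t <> q t') -> q p1 <> q p2 ->
  forall s t, 0 <= s <= 1 -> 0 <= t <= 1 ->
   lerp s (hat k (q p1)) (hat k (q p2)) <> lerp t (hat k (q p3)) (hat k (q p4)).
Proof.
move=> k0 cf1 cf2 p12 p34 H1 H2 n1 n2 n3 n4 dj ne.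
pose L (x y t : R) := x + t * (y - x).
have L0 x y : L x y 0 = x by rewrite /L mul0r addr0.
have L1 x y : L x y 1 = y by rewrite /L mul1r subrKC.
have Li x y t : x < y -> 0 <= t <= 1 -> x <= L x y t <= y.
  rewrite /L => xy /andP[t0 t1].
  have h1 : 0 <= t * (y - x) by rewrite mulr_ge0 // subr_ge0 ltW.
  have h2 : 0 <= (1 - t) * (y - x) by rewrite mulr_ge0 // subr_ge0 // ltW.
  by clear - h1 h2; apply/andP; split; lra.
have cL x y : continuous (L x y) by rewrite /L; cont.
pose A1 x y (t : R) := f1 (L x y t) - c.1.
pose A2 x y (t : R) := f2 (L x y t) - c.2.
have c1 x y : continuous (A1 x y) by apply: contB; [apply: cont_comp cf1; exact: cL|exact: contC].
have c2 x y : continuous (A2 x y) by apply: contB; [apply: cont_comp cf2; exact: cL|exact: contC].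
have Aq x y t : (A1 x y t, A2 x y t) = q (L x y t) by [].
have := @cell_chords R k (A1 p1 p2) (A2 p1 p2) (A1 p3 p4) (A2 p3 p4) k0 (c1 _ _) (c2 _ _) (c1 _ _) (c2 _ _).
rewrite !Aq !L0 !L1; apply => //.
- by move=> t t01; rewrite Aq; apply: H1; exact: Li.
- by move=> t t01; rewrite Aq; apply: H2; exact: Li.
- by move=> t t' t01 t01'; rewrite !Aq; apply: dj; exact: Li.
Qed.

(** Edges of two arcs in one cell are kept apart by [cell_chords]: the arcs are not successive,
    hence disjoint by injectivity. Edges in different cells can only meet on the grid, which the
    polygon touches at the distinct points [q j] alone. *)
Lemma chain_polygon f1 f2 M s C k : 0 < k ->
  continuous f1 -> continuous f2 -> chain f1 f2 M s C -> tiled M C ->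
  (forall t t', s 0%N <= t <= s M -> s 0%N <= t' <= s M -> f1 t = f1 t' -> f2 t = f2 t' -> t = t') ->
  simple_polygon (3 * M) (vert k (fun j => (f1 (s j), f2 (s j))) C).
Proof.
move=> k0 cf1 cf2 ch [tl1 tl2] inj; have chlt := chain_lt ch; case: ch => hs hc he.
set q := fun j => _.
have chle i j : (i <= j)%N -> (j <= M)%N -> s i <= s j.
  by rewrite leq_eqVlt => /orP[/eqP ->|ij jM]; [|apply/ltW/chlt].
have qinj i j : (i <= M)%N -> (j <= M)%N -> q i = q j -> i = j.
  move=> iM jM [h1 h2]; have : s i = s j.
    by apply: inj => //; apply/andP; split; apply: chle.
  have [ij|ij|//] := ltngtP i j.
    by have := chlt _ _ ij jM => + h; rewrite h ltxx.
  by have := chlt _ _ ij iM => + h; rewrite h ltxx.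
have e01 : 0 <= (0 : R) <= 1 by rewrite lexx ler01.
have e11 : 0 <= (1 : R) <= 1 by rewrite lexx ler01.
have jM i : (i < 3 * M)%N -> (i %/ 3 < M)%N by lia.
have r3 i : (i %% 3 < 3)%N by rewrite ltn_mod.
have na j : (j < M)%N -> nm (psub (q j) (C j)) = 1 by move=> /he[].
have nb j : (j < M)%N -> nm (psub (q j.+1) (C j)) = 1 by move=> /he[].
have ab j : (j < M)%N -> psub (q j) (C j) <> psub (q j.+1) (C j).
  by move=> jm /psub_inj/qinj h; have := h (ltnW jm) jm; clear; lia.
split.
  move=> i iM E; have := @useg_nondeg k _ _ k0 (na _ (jM _ iM)) (nb _ (jM _ iM)) _ (ab _ (jM _ iM)) (r3 i).
  apply; apply: (@paddI (C (i %/ 3)%N)).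
  by rewrite -!vert_useg lerp0 lerp1.
move=> i i' x y ii' iM' x01 y01; have iM : (i < 3 * M)%N by exact: ltn_trans iM'.
rewrite !vert_useg; set j := (i %/ 3)%N; set j' := (i' %/ 3)%N => E.
have jm : (j < M)%N by exact: jM. have jm' : (j' < M)%N by exact: jM.
have jj' : (j <= j')%N by rewrite /j /j'; clear -ii'; lia.
have [j_j'|j_j'] := eqVneq j j'.
  rewrite -j_j' in E; have {}E := paddI E.
  have rr : (i %% 3 < i' %% 3)%N by move: j_j'; rewrite /j /j'; clear -ii'; lia.
  have [h1 h2 h3] := useg_simple k0 (na _ jm) (nb _ jm) (ab _ jm) x01 y01 rr (r3 _) E.
  by split => //; move: j_j' h1; rewrite /j /j'; clear -ii'; lia.
have {}jj' : (j < j')%N by rewrite ltn_neqAle j_j' jj'.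
have [cc|cc] := pselect (C j = C j').
  exfalso; have j2 : (j.+1 < j')%N.
    have [//|h] := ltnP j.+1 j'; have jE : j' = j.+1 by apply/eqP; rewrite eqn_leq h jj'.
    by have := tl1 j; rewrite -jE => /(_ jm'); rewrite cc.
  rewrite cc in E; move: (paddI E).
  have nq i1 i2 c : (i1 <= M)%N -> (i2 <= M)%N -> i1 != i2 -> psub (q i1) c <> psub (q i2) c.
    by move=> h1 h2 h3 /psub_inj/qinj h; move: h3; rewrite h ?eqxx.
  have na' : nm (psub (q j) (C j')) = 1 by rewrite -cc; exact: na.
  have nb' : nm (psub (q j.+1) (C j')) = 1 by rewrite -cc; exact: nb.
  apply: (useg_disjoint k0 na' nb' (na _ jm') (nb _ jm')); [apply: nq|apply: nq|apply: nq|apply: nq| |exact: x01|exact: y01|exact: r3|exact: r3]; try (by clear -jm jm' jj' j2; lia).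
  have c1 := chlt j.+1 j' j2 (ltnW jm').
  have c2 := chle 0%N j (leq0n _) (ltnW jm).
  have c3 := chle j'.+1 M jm' (leqnn _).
  have d1 := hs _ jm; have d2 := hs _ jm'.
  apply: (arc_chords k0 cf1 cf2 d1 d2).
  - by move=> t t01; rewrite -cc; exact: hc.
  - by move=> t t01; exact: hc.
  - by rewrite -cc; exact: na.
  - by rewrite -cc; exact: nb.
  - exact: na.
  - exact: nb.
  - move=> t t' /andP[t1 t2] /andP[t3 t4] /psub_inj[h1 h2].
    have lt' : t < t' by apply: (le_lt_trans t2); apply: lt_le_trans t3.
    have E' : t = t'.
      apply: inj => //; apply/andP; split.
      - exact: le_trans t1.
      - by apply: le_trans c3; apply: le_trans t4; exact: ltW.
      - by apply: le_trans (ltW lt'); exact: le_trans t1.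
      - exact: le_trans c3.
    by move: lt'; rewrite E' ltxx.
  - by rewrite -cc; exact: ab.
(* Different cells: a common point lies on the boundary of both, so it is a grid vertex of both
   edges. *)
have [n1 m1] := useg_nm k0 (na _ jm) (nb _ jm) x01 (r3 i).
have [n2 m2] := useg_nm k0 (na _ jm') (nb _ jm') y01 (r3 i').
set u := useg _ _ _ _ _ in E n1 m1; set u' := useg _ _ _ _ _ in E n2 m2.
have t1 := tl2 j j' (padd (C j) u) jm jm' cc.
have t2 := tl2 j' j (padd (C j) u) jm' jm (not_eq_sym cc).
rewrite E psubKD -E psubKD in t1 t2.
have e1 := m1 (t1 n1 n2).
have e2 := m2 (t2 n2 n1).
have z1 : (i %% 3 = 0 /\ padd (C j) u = q j)%N \/ [/\ (i %% 3 = 2)%N, x = 1 & padd (C j) u = q j.+1].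
  rewrite /u; case: e1 => -[-> ->]; [left|right]; split => //.
    by rewrite /= subr0 mul0r addr0 /scl !mul1r -surjective_pairing paddKB.
  by rewrite /= subrr mul0r add0r /scl !mul1r -surjective_pairing paddKB.
have z2 : [/\ (i' %% 3 = 0)%N, y = 0 & padd (C j') u' = q j'] \/ (i' %% 3 = 2 /\ padd (C j') u' = q j'.+1)%N.
  rewrite /u'; case: e2 => -[-> ->]; [left|right]; split => //.
    by rewrite /= subr0 mul0r addr0 /scl !mul1r -surjective_pairing paddKB.
  by rewrite /= subrr mul0r add0r /scl !mul1r -surjective_pairing paddKB.
rewrite E in z1.
case: z1 => [[h1 g1]|[h1 hx g1]]; case: z2 => [[h2 hy g2]|[h2 g2]]; rewrite g1 in g2; have /qinj := g2.
- by move=> /(_ (ltnW jm) (ltnW jm')); clear -jj'; lia.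
- by move=> /(_ (ltnW jm) jm'); clear -jj'; lia.
- by move=> /(_ jm (ltnW jm')) h; split => //; move: h; rewrite /j /j'; clear -h1 h2; lia.
- by move=> /(_ jm jm'); clear -jj'; lia.
Qed.
End Polygon.

(** * Cutting a curve along the grid *)

Section Grid.
Variable R : realType.

Lemma eventually_all (T : eqType) (l : seq T) (P : T -> R -> Prop) :
  (forall x, x \in l -> exists2 r, 0 < r & forall r', 0 < r' <= r -> P x r') ->
  exists2 r, 0 < r & forall r', 0 < r' <= r -> forall x, x \in l -> P x r'.
Proof.
elim: l => [|y l IH] H; first by exists 1.
have [r1 r10 H1] := H y (mem_head _ _).
have [x xl|r2 r20 H2] := IH; first by apply: H; rewrite inE xl orbT.
exists (Num.min r1 r2); first by rewrite lt_min r10.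
move=> r' /andP[r'0]; rewrite le_min => /andP[h1 h2] x; rewrite inE => /orP[/eqP ->|xl].
  by apply: H1; rewrite r'0.
by apply: H2 => //; rewrite r'0.
Qed.

(** The grid is normalised: its lines are at the odd integers, so that the cells are the unit balls
    of [nm] around the points with even coordinates. *)
Definition odd_line (x : R) : Prop := exists m : int, x = 2 * m%:~R + 1.
Definition even_ctr (c : R * R) : Prop := exists m n : int, c = (2 * m%:~R, 2 * n%:~R).
Definition hit (f1 f2 : R -> R) (t : R) : Prop := odd_line (f1 t) \/ odd_line (f2 t).

Lemma sqr_le1 (x : R) : `|x| <= 1 -> x ^+ 2 <= 1.
Proof. by move=> h; rewrite -(real_normK (num_real x)) expr_le1. Qed.

Lemma nm_le1 (z : R * R) : (nm z <= 1) = (`|z.1| <= 1) && (`|z.2| <= 1).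
Proof. by rewrite nm_le -(real_normK (num_real z.1)) -(real_normK (num_real z.2)) !expr_le1. Qed.

Lemma odd_line_1 (x : R) (m : int) : odd_line x -> `|x - 2 * m%:~R| <= 1 -> `|x - 2 * m%:~R| = 1.
Proof.
move=> [n ->] h; have [nm|nm] := leP m n.
  have : (1 : R) <= 2 * n%:~R + 1 - 2 * m%:~R.
    have : (m%:~R : R) <= n%:~R by rewrite ler_int.
    lra.
  by move: h; rewrite ler_norml => /andP[_ h1] h2; rewrite ger0_norm; lra.
have : 2 * n%:~R + 1 - 2 * m%:~R <= (- 1 : R).
  have : (n + 1)%:~R <= (m%:~R : R) by rewrite ler_int lezD1.
  rewrite intrD; lra.
by move: h; rewrite ler_norml => /andP[h1 _] h2; rewrite ler0_norm; lra.
Qed.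

Lemma hit_nm1 f1 f2 t c : even_ctr c -> hit f1 f2 t ->
  nm (psub (f1 t, f2 t) c) <= 1 -> nm (psub (f1 t, f2 t) c) = 1.
Proof.
move=> [m [n ->]] h; rewrite nm_le1 /psub /= => /andP[h1 h2].
have s1 : (f1 t - 2 * m%:~R) ^+ 2 <= 1 by exact: sqr_le1.
have s2 : (f2 t - 2 * n%:~R) ^+ 2 <= 1 by exact: sqr_le1.
apply/eqP; rewrite eq_le nm_le s1 s2 /= /nm le_max /=.
case: h => h; have := odd_line_1 h; [move=> /(_ m h1) h'|move=> /(_ n h2) h'].
  by rewrite -(real_normK (num_real (f1 t - _))) h' expr1n lexx.
by rewrite -(real_normK (num_real (f2 t - _))) h' expr1n lexx orbT.
Qed.

Lemma even_ctr_tile c c' z : even_ctr c -> even_ctr c' -> c <> c' ->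
  nm (psub z c) <= 1 -> nm (psub z c') <= 1 -> nm (psub z c) = 1.
Proof.
move=> [m [n ->]] [m' [n' ->]] ne; rewrite !nm_le1 /psub /= => /andP[h1 h2] /andP[h1' h2'].
have s1 : (z.1 - 2 * m%:~R) ^+ 2 <= 1 by exact: sqr_le1.
have s2 : (z.2 - 2 * n%:~R) ^+ 2 <= 1 by exact: sqr_le1.
have key (x : R) (a b : int) : a <> b -> `|x - 2 * a%:~R| <= 1 -> `|x - 2 * b%:~R| <= 1 -> (x - 2 * a%:~R) ^+ 2 = 1.
  move=> ab; rewrite !ler_norml => /andP[u1 u2] /andP[v1 v2].
  have [lab|lab] := ltP a b.
    have : (a + 1)%:~R <= (b%:~R : R) by rewrite ler_int lezD1.
    rewrite intrD => hh; have -> : x - 2 * a%:~R = 1 by lra.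
    by rewrite expr1n.
  have : (b + 1)%:~R <= (a%:~R : R) by rewrite ler_int lezD1 lt_neqAle lab andbT eq_sym; exact/eqP.
  rewrite intrD => hh; have -> : x - 2 * a%:~R = -1 by lra.
  by rewrite sqrrN expr1n.
apply/eqP; rewrite eq_le nm_le s1 s2 /= /nm le_max /=.
have [mm|mm] := eqVneq m m'; last first.
  by rewrite (key z.1 m m') ?lexx //; exact/eqP.
have nn : n <> n' by move=> nn; apply: ne; rewrite mm nn.
by rewrite (key z.2 n n') ?lexx ?orbT.
Qed.

(** The strip is the one that contains the value at the midpoint, an interior time and therefore off
    the lines. By the intermediate value theorem, leaving it would cost a hit at an interior
    time. *)
Lemma strip (g : R -> R) (a b : R) : continuous g -> a <= b ->
  (forall t, a < t < b -> ~ odd_line (g t)) ->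
  exists m : int, forall t, a <= t <= b -> `|g t - 2 * m%:~R| <= 1.
Proof.
move=> cg ab no.
pose c := (a + b) / 2.
pose m := Num.floor ((g c + 1) / 2).
have m1 : 2 * m%:~R - 1 <= g c.
  by have := ge_floor ((g c + 1) / 2); rewrite -/m; lra.
have m2 : g c < 2 * m%:~R + 1.
  by have := floorD1_gt ((g c + 1) / 2); rewrite -/m intrD; lra.
have cc (x y v : R) : x < y -> Num.min (g x) (g y) <= v <= Num.max (g x) (g y) ->
   exists2 z, x <= z <= y & g z = v.
  move=> xy hv; have [|z] := IVT (ltW xy) _ hv; first exact: continuous_subspaceT.
  by rewrite in_itv => zz E; exists z.
have [E|ne] := eqVneq a b.
  exists m => t; rewrite E => /andP[t1 t2]; have -> : t = c by rewrite /c E; lra.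
  by rewrite ler_norml; apply/andP; split; lra.
have lab : a < b by rewrite lt_neqAle ne.
have m1' : 2 * m%:~R - 1 < g c.
  rewrite lt_neqAle m1 andbT; apply/eqP => h; apply: (no c); first by rewrite /c; lra.
  by exists (m - 1); rewrite -h intrD; lra.
exists m => t /andP[t1 t2].
have hop x y : a <= x <= b -> a <= y <= b -> forall z v, odd_line v -> g z = v -> x <= z <= y -> g x != v -> g y != v -> False.
  move=> /andP[x1 x2] /andP[y1 y2] z v ov gz /andP[z1 z2] gx gy.
  have xz : x < z by rewrite lt_neqAle z1 andbT; apply: contra gx => /eqP ->; rewrite gz.
  have zy : z < y by rewrite lt_neqAle z2 andbT; apply: contra gy => /eqP <-; rewrite gz.
  by apply: (no z); [apply/andP; split; lra|rewrite gz].
have cab : a <= c <= b by rewrite /c; lra.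
have tab : a <= t <= b by rewrite t1.
have op : odd_line (2 * m%:~R + 1) by exists m.
have om : odd_line (2 * m%:~R - 1) by exists (m - 1); rewrite intrD; lra.
rewrite ler_norml; apply/andP; split; rewrite leNgt; apply/negP => h.
- have gt : g t != 2 * m%:~R - 1 by apply/eqP; lra.
  have gc : g c != 2 * m%:~R - 1 by apply/eqP; lra.
  have [tc|ct] := ltP t c.
    have [|z zz E] := cc t c (2 * m%:~R - 1) tc; last by apply: (hop t c tab cab z _ om E zz).
    by rewrite ge_min le_max; apply/andP; split; apply/orP; [left|right]; lra.
  have ct' : c < t by rewrite lt_neqAle ct andbT; apply/eqP => E; move: h; rewrite -E; lra.
  have [|z zz E] := cc c t (2 * m%:~R - 1) ct'; last by apply: (hop c t cab tab z _ om E zz).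
  by rewrite ge_min le_max; apply/andP; split; apply/orP; [right|left]; lra.
- have gt : g t != 2 * m%:~R + 1 by apply/eqP; lra.
  have gc : g c != 2 * m%:~R + 1 by apply/eqP; lra.
  have [tc|ct] := ltP t c.
    have [|z zz E] := cc t c (2 * m%:~R + 1) tc; last by apply: (hop t c tab cab z _ op E zz).
    by rewrite ge_min le_max; apply/andP; split; apply/orP; [right|left]; lra.
  have ct' : c < t by rewrite lt_neqAle ct andbT; apply/eqP => E; move: h; rewrite -E; lra.
  have [|z zz E] := cc c t (2 * m%:~R + 1) ct'; last by apply: (hop c t cab tab z _ op E zz).
  by rewrite ge_min le_max; apply/andP; split; apply/orP; [left|right]; lra.
Qed.

Lemma strip2 f1 f2 (a b : R) : continuous f1 -> continuous f2 -> a <= b ->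
  (forall t, a < t < b -> ~ hit f1 f2 t) ->
  exists2 c, even_ctr c & forall t, a <= t <= b -> nm (psub (f1 t, f2 t) c) <= 1.
Proof.
move=> c1 c2 ab no.
have [m1 H1] := strip c1 ab (fun t tt h => no t tt (or_introl h)).
have [m2 H2] := strip c2 ab (fun t tt h => no t tt (or_intror h)).
exists (2 * m1%:~R, 2 * m2%:~R); first by exists m1, m2.
by move=> t tt; rewrite nm_le1 /psub /= H1 ?H2.
Qed.

(** Besides the arcs between hits, the loose ends before the first and after the last hit are
    recorded, each within one cell; they give rise to the end pieces. A single hit gives [M = 0]. *)
Definition good_chain f1 f2 (u v : R) M s C : Prop :=
  [/\ chain f1 f2 M s C, (forall j, (j < M)%N -> even_ctr (C j)) /\
      (forall j, (j <= M)%N -> hit f1 f2 (s j)), u <= s 0%N, s M <= v &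
      (exists2 c, even_ctr c & forall t, u <= t <= s 0%N -> nm (psub (f1 t, f2 t) c) <= 1) /\
      (exists2 c, even_ctr c & forall t, s M <= t <= v -> nm (psub (f1 t, f2 t) c) <= 1)].

Lemma good_chain_exists f1 f2 (u v : R) : continuous f1 -> continuous f2 -> u <= v ->
  finite_set [set t | u <= t <= v /\ hit f1 f2 t] ->
  (exists2 t, u <= t <= v & hit f1 f2 t) ->
  exists M s C, good_chain f1 f2 u v M s C.
Proof.
move=> c1 c2 uv /finite_seqP[l0 El0] [t0 t0uv ht0].
pose l := sort <=%R (undup l0).
have ml t : t \in l <-> u <= t <= v /\ hit f1 f2 t.
  rewrite mem_sort mem_undup; have := congr1 (fun A : set R => A t) El0 => /= ->; by [].
have sl : sorted <%R l by rewrite lt_sorted_uniq_le sort_uniq undup_uniq sort_le_sorted.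
have t0l : t0 \in l by apply/ml.
have sl0 : (0 < size l)%N by case: (l) t0l.
pose M := (size l).-1.
have sM : size l = M.+1 by rewrite prednK.
pose s j := nth 0 l j.
have sP j : (j <= M)%N -> u <= s j <= v /\ hit f1 f2 (s j).
  by move=> jM; apply/ml; rewrite mem_nth // sM.
have slt i j : (i < j)%N -> (j <= M)%N -> s i < s j.
  move=> ij jM; rewrite /s lt_sorted_ltn_nth // inE sM ltnS //.
  exact: ltnW (leq_trans ij jM).
have sle i j : (i <= j)%N -> (j <= M)%N -> s i <= s j.
  by rewrite leq_eqVlt => /orP[/eqP -> //|ij jM]; exact: ltW (slt _ _ ij jM).
have getidx t : u <= t <= v -> hit f1 f2 t -> exists2 i, (i <= M)%N & t = s i.
  move=> tuv ht; have tl : t \in l by apply/ml.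
  exists (index t l); last by rewrite /s nth_index.
  by rewrite -ltnS -sM index_mem.
have /choice [C HC] : forall j, exists c, (j < M)%N -> even_ctr c /\ forall t, s j <= t <= s j.+1 -> nm (psub (f1 t, f2 t) c) <= 1.
  move=> j; have [jM|jM] := ltnP j M; last by exists (0, 0).
  have [||c ec Hc] := @strip2 f1 f2 (s j) (s j.+1) c1 c2; last by exists c.
    by apply: sle.
  move=> t /andP[t1 t2] ht.
  have [/andP[h1 h1'] _] := sP j (ltnW jM); have [/andP[h2 h2'] _] := sP j.+1 jM.
  have [|i iM E] := getidx t _ ht; first by apply/andP; split; lra.
  subst t; have [ij|ij] := leqP i j.
    by have := sle _ _ ij (ltnW jM); rewrite leNgt t1.
  by have := sle _ _ ij iM; rewrite leNgt t2.
exists M, s, C; split.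
- split=> [j jM|j t jM|j jM].
  + exact: slt.
  + by have [_] := HC j jM; apply.
  + have [e H] := HC j jM; have lt1 := ltW (slt j j.+1 (leqnn _) jM).
    split; apply: hit_nm1 => //.
    * by have [] := sP j (ltnW jM).
    * by apply: H; rewrite lexx.
    * by have [] := sP j.+1 jM.
    * by apply: H; rewrite lexx andbT.
- by split=> [j jM|j jM]; [have [] := HC j jM|have [] := sP j jM].
- by have [/andP[]] := sP 0%N (leq0n _).
- by have [/andP[]] := sP M (leqnn _).
- have [/andP[u0 v0] _] := sP 0%N (leq0n _); have [/andP[uM vM] _] := sP M (leqnn _).
  split; apply: strip2 => // t /andP[t1 t2] ht.
    have [|i iM E] := getidx t _ ht; first by apply/andP; split; lra.
    by have := sle 0%N i (leq0n _) iM; rewrite leNgt -E t2.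
  have [|i iM E] := getidx t _ ht; first by apply/andP; split; lra.
  by have := sle i M iM (leqnn _); rewrite leNgt -E t1.
Qed.

(** Take a chain with the fewest arcs: two successive arcs in the same cell could be merged into
    one. This also absorbs the arcs created where the curve touches a line and turns back. *)
Lemma good_chain_tiled f1 f2 (u v : R) : continuous f1 -> continuous f2 -> u <= v ->
  finite_set [set t | u <= t <= v /\ hit f1 f2 t] ->
  (exists2 t, u <= t <= v & hit f1 f2 t) ->
  exists M s C, good_chain f1 f2 u v M s C /\ tiled M C.
Proof.
move=> c1 c2 uv fin ex.
have [M0 [s0 [C0 H0]]] := good_chain_exists c1 c2 uv fin ex.
have exM : exists M, `[< exists s C, good_chain f1 f2 u v M s C >].
  by exists M0; apply/asboolP; exists s0, C0.
case: (ex_minnP exM) => M /asboolP[s [C H]] minM.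
exists M, s, C; split=> //; split; last first.
  case: H => _ [ev _] _ _ _ i j z iM jM; apply: even_ctr_tile; exact: ev.
move=> j jM cc; case: H => -[hs hc he] [ev hh] us sv [e1 e2].
have : (M <= M.-1)%N; last by lia.
(* [bump j.+1] skips the index [j.+1] of the time at which the two arcs are merged. *)
apply: minM; apply/asboolP; pose b := bump j.+1.
have bM i : (i < M.-1)%N -> (b i < M)%N by rewrite /b /bump; lia.
exists (s \o b), (C \o b).
have bcase i : (i < M.-1)%N -> b i.+1 = (b i).+1 \/ [/\ i = j, b i = j & b i.+1 = j.+2].
  rewrite /b /bump => iM; have [ij|ij] := eqVneq i j; [right|left].
    by subst i; rewrite ltnn ltnSn; split.
  by lia.
have M0' : b M.-1 = M by rewrite /b /bump; lia.
split => //=.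
- split=> [i iM|i t iM|i iM] /=.
  + have [->|[-> -> ->]] := bcase i iM; first exact: hs (bM _ iM).
    by apply: lt_trans (hs _ jM); apply: hs; exact: ltnW.
  + have [->|[-> -> ->]] := bcase i iM; first exact: hc (bM _ iM).
    move=> /andP[t1 t2]; have [h|h] := leP t (s j.+1).
      by apply: hc; [exact: ltnW|rewrite t1].
    by rewrite cc; apply: hc => //; rewrite t2 (ltW h).
  + have [->|[-> -> ->]] := bcase i iM; first exact: he (bM _ iM).
    by split; [have [] := he j (ltnW jM)|rewrite cc; have [] := he j.+1 jM].
- by split=> i iM; [apply: ev; exact: bM|apply: hh; rewrite /b /bump; lia].
- by rewrite M0'.
- by split => //; rewrite M0'.
Qed.
End Grid.

(** * Squeezing along the grid *)

Section Compress.
Variable R : realType.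

(* tent r: 0, then slope 1 on [0, r], slope -1 on [r, 2r], then 0 *)
Definition tent (r s : R) : R := Num.max (Num.min s (2 * r - s)) 0.
(** Odd about [x0]: slope [th] up to distance [r], slope [2 - th] between [r] and [2 r], the
    identity beyond. *)
Definition squeeze (r th x0 x : R) : R :=
  x - (1 - th) * (tent r (x - x0) - tent r (x0 - x)).

Lemma cont_tent r : continuous (tent r).
Proof. by rewrite /tent; cont. Qed.
Lemma tent_lip r s s' : s <= s' -> tent r s' - tent r s <= s' - s.
Proof.
rewrite /tent => h.
case: (leP s (2 * r - s)) => a1; case: (leP s' (2 * r - s')) => a2; rewrite /Num.max;
repeat match goal with |- context [if ?b then _ else _] => case: ifPn; rewrite -?leNgt => ? end; lra.
Qed.
Lemma tent_neg r s : s <= 0 -> tent r s = 0.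
Proof. by move=> h; rewrite /tent max_r // ge_min h. Qed.
Lemma tent_far r s : 0 <= r -> 2 * r <= s -> tent r s = 0.
Proof. by move=> r0 h; rewrite /tent max_r // ge_min; apply/orP; right; lra. Qed.
Lemma tent_near r s : 0 <= s <= r -> tent r s = s.
Proof. by move=> /andP[h1 h2]; rewrite /tent min_l ?max_l //; lra. Qed.

Section Squeeze.
Variables (r th x0 : R).
Lemma cont_squeeze : continuous (squeeze r th x0).
Proof.
have c1 : continuous (fun x => x - x0) by cont.
have c2 : continuous (fun x : R => x0 - x) by cont.
have h1 := cont_comp c1 (@cont_tent r); have h2 := cont_comp c2 (@cont_tent r).
by rewrite /squeeze; cont.
Qed.
Lemma squeeze_lt (x y : R) : 0 < th <= 1 -> x < y -> squeeze r th x0 x < squeeze r th x0 y.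
Proof.
move=> /andP[t0 t1] xy; rewrite /squeeze.
have lip a b : a <= b -> (tent r (b - x0) - tent r (x0 - b)) - (tent r (a - x0) - tent r (x0 - a)) <= b - a.
  move=> ab; have [h|h] := leP b x0.
    rewrite (tent_neg r (_ : b - x0 <= 0)); last by lra.
    rewrite (tent_neg r (_ : a - x0 <= 0)); last by lra.
    have := @tent_lip r (x0 - b) (x0 - a); lra.
  have [h'|h'] := leP x0 a.
    rewrite (tent_neg r (_ : x0 - b <= 0)); last by lra.
    rewrite (tent_neg r (_ : x0 - a <= 0)); last by lra.
    have := @tent_lip r (a - x0) (b - x0); lra.
  rewrite (tent_neg r (_ : x0 - b <= 0)); last by lra.
  rewrite (tent_neg r (_ : a - x0 <= 0)); last by lra.
  have e0 : tent r 0 = 0 by exact: tent_neg.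
  have := @tent_lip r 0 (b - x0); have := @tent_lip r 0 (x0 - a); rewrite e0; lra.
have h := ler_wpM2l (_ : 0 <= 1 - th) (lip _ _ (ltW xy)).
have {}h := h ltac:(lra).
have h2 : 0 < th * (y - x) by rewrite mulr_gt0 // subr_gt0.
lra.
Qed.
Lemma squeeze_center : squeeze r th x0 x0 = x0.
Proof. by rewrite /squeeze subrr mulr0 subr0. Qed.
Lemma squeeze_far x : 0 <= r -> 2 * r <= `|x - x0| -> squeeze r th x0 x = x.
Proof.
rewrite /squeeze => r0; case: (ler0P (x - x0)) => h h1.
  by rewrite (tent_neg r h) (tent_far r0) ?subr0 ?mulr0 ?subr0 //; lra.
by rewrite (tent_far r0 h1) (tent_neg r (_ : x0 - x <= 0)) ?subr0 ?mulr0 ?subr0 //; lra.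
Qed.
Lemma squeeze_near x : `|x - x0| <= r -> squeeze r th x0 x - x0 = th * (x - x0).
Proof.
rewrite /squeeze; case: (ler0P (x - x0)) => h h1.
  rewrite (tent_neg r h) tent_near; last by apply/andP; split; lra.
  ring.
rewrite tent_near; last by rewrite h1 ltW.
rewrite (tent_neg r (_ : x0 - x <= 0)); last by lra.
ring.
Qed.
End Squeeze.

(** One squeeze per point of [l], composed. With gaps of at least [3 r], whatever is within [r] of
    one centre is at least [2 r] away from the others and is not moved by their squeezes. *)
Lemma compress (l : seq R) (r th : R) : uniq l -> 0 < r -> 0 < th <= 1 ->
  (forall x y, x \in l -> y \in l -> x != y -> 3 * r <= `|x - y|) ->
  exists h : R -> R, [/\ continuous h, (forall x y, x < y -> h x < h y),
    (forall y, (forall x, x \in l -> y = x \/ 2 * r <= `|y - x|) -> h y = y) &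
    forall x y, x \in l -> `|y - x| <= r -> `|h y - x| <= th * r].
Proof.
move=> + r0 th01; elim: l => [_ _|x1 l IH /= /andP[x1l ul] sep].
  by exists (fun x => x); split => //; exact: cont_id.
have [|h [ch ih fh nh]] := IH ul.
  by move=> x y xl yl; apply: sep; rewrite inE ?xl ?yl orbT.
have t0 : 0 <= th by case/andP: th01 => /ltW.
have t1 : th * r <= r by case/andP: th01 => _ t1; rewrite ger_pMl.
have nr y : `|y - x1| <= r -> `|squeeze r th x1 y - x1| <= th * r.
  by move=> h1; rewrite squeeze_near // normrM ger0_norm // ler_wpM2l.
have sepx x : x \in l -> 3 * r <= `|x1 - x|.
  move=> xl; apply: sep; rewrite ?mem_head // ?inE ?xl ?orbT //.
  by apply: contra x1l => /eqP ->.
exists (fun y => h (squeeze r th x1 y)); split.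
- by apply: cont_comp ch; exact: cont_squeeze.
- by move=> x y xy; apply: ih; exact: squeeze_lt.
- move=> y Hy; have -> : squeeze r th x1 y = y.
    have [->|h1] := Hy x1 (mem_head _ _); first exact: squeeze_center.
    by apply: squeeze_far => //; exact: ltW.
  by apply: fh => x xl; apply: Hy; rewrite inE xl orbT.
- move=> x y; rewrite inE => /orP[/eqP -> yx|xl yx].
    rewrite fh; first exact: nr.
    move=> x' xl'; right; have h1 := sepx _ xl'; have h2 := nr _ yx.
    have h3 : `|x1 - x'| <= `|squeeze r th x1 y - x1| + `|squeeze r th x1 y - x'|.
      rewrite [leRHS]addrC; apply: le_trans (ler_normB _ _).
      by rewrite le_eqVlt; apply/orP; left; apply/eqP; congr Num.norm; ring.
    lra.
  rewrite squeeze_far; [exact: nh|exact: ltW|].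
  have h1 := sepx _ xl.
  have h3 : `|x1 - x| <= `|y - x1| + `|y - x|.
    rewrite [leRHS]addrC; apply: le_trans (ler_normB _ _).
    by rewrite le_eqVlt; apply/orP; left; apply/eqP; congr Num.norm; ring.
  lra.
Qed.

Lemma odd_gap (x : R) : exists2 r, 0 < r & forall y, odd_line y -> y = x \/ r <= `|y - x|.
Proof.
pose n := Num.floor ((x - 1) / 2).
have m1 := ge_floor ((x - 1) / 2); have m2 := floorD1_gt ((x - 1) / 2).
rewrite -/n in m1 m2; rewrite intrD in m2.
have int_cases (m : int) : (m%:~R : R) <= n%:~R \/ (m%:~R : R) >= n%:~R + 1.
  have [h|h] := leP m n; [left|right]; first by rewrite ler_int.
  by rewrite -[1]/(1%:~R) -intrD ler_int lezD1.
have [E|ne] := eqVneq x (2 * n%:~R + 1).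
  exists 2 => // y [m ->]; have [h|h] := int_cases m.
    have [E'|ne'] := eqVneq m n; first by left; rewrite E' E.
    have : ((m + 1)%:~R : R) <= n%:~R.
      by rewrite ler_int lezD1 lt_neqAle ne'; move: h; rewrite ler_int.
    rewrite intrD => h'; right; rewrite ler0_norm; lra.
  right; rewrite ger0_norm; lra.
have lx : 0 < x - (2 * n%:~R + 1).
  by rewrite subr_gt0 lt_neqAle eq_sym ne /=; lra.
exists (Num.min (x - (2 * n%:~R + 1)) (2 * n%:~R + 3 - x)).
  by rewrite lt_min lx /=; lra.
move=> y [m ->]; right; rewrite ge_min; apply/orP; have [h|h] := int_cases m.
  by left; rewrite ler0_norm; lra.
by right; rewrite ger0_norm; lra.
Qed.

(* squeezing towards finitely many coordinates without moving the grid *)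
Lemma compress_grid (l : seq R) : exists2 r, 0 < r & forall th, 0 < th ->
  exists h : R -> R, [/\ continuous h, (forall x y, x < y -> h x < h y),
    (forall y, odd_line y -> h y = y) &
    forall x y, x \in l -> `|y - x| <= r -> `|h y - x| <= th].
Proof.
have [|r1 r10 H1] := @eventually_all R _ (undup l) (fun x r => forall y, y \in undup l -> x != y -> 3 * r <= `|x - y|).
  move=> x xl; apply: eventually_all => y yl.
  have [->|ne] := eqVneq x y; first by exists 1.
  exists (`|x - y| / 3); first by rewrite divr_gt0 // normr_gt0 subr_eq0.
  by move=> r' /andP[_ h] _; lra.
have [|r2 r20 H2] := @eventually_all R _ (undup l) (fun x r => forall y, odd_line y -> y = x \/ 2 * r <= `|y - x|).
  move=> x xl; have [r r0 H] := odd_gap x; exists (r / 2); first by lra.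
  move=> r' /andP[_ h] y /H [->|h']; [by left|right; lra].
pose r := Num.min r1 r2.
have r0 : 0 < r by rewrite lt_min r10.
have h1 : 0 < r <= r1 by rewrite r0 ge_min lexx.
have h2 : 0 < r <= r2 by rewrite r0 ge_min lexx orbT.
exists r => // th th0.
(* The quotient by [r] turns the factor of the squeeze into the absolute bound [th]. *)
pose th' := Num.min 1 (th / r).
have th01 : 0 < th' <= 1 by rewrite lt_min ltr01 divr_gt0 //= ge_min lexx.
have [|h [ch ih fh nh]] := @compress (undup l) r th' (undup_uniq _) r0 th01.
  by move=> x y xl yl; exact: H1.
exists h; split => //.
- by move=> y oy; apply: fh => x xl; exact: H2.
- move=> x y xl yx; apply: (le_trans (nh _ _ _ yx)); first by rewrite mem_undup.
  by rewrite -ler_pdivlMr // ge_min lexx orbT.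
Qed.
End Compress.

(** * Crossings of a nearby curve, and slopes of its polygon *)

Section Straighten.
Variable R : realType.
Implicit Types (f g : R -> R).

Lemma cont_eps f x e : continuous f -> 0 < e -> exists2 d : R, 0 < d & forall t, `|t - x| <= d -> `|f t - f x| <= e.
Proof.
move=> cf e0; have /nbhs_ballP[d /= d0 Hd] : nbhs x (f @^-1` ball (f x) e).
  by apply: cf; exact: nbhsx_ballx.
exists (d / 2); first by rewrite divr_gt0.
move=> t h; have := Hd t; rewrite /ball /= => H.
by rewrite distrC ltW // H // distrC (le_lt_trans h) // ltr_pdivrMr // ltr_pMr // ltr1n.
Qed.

Lemma dist_chain (a b c x y : R) : `|a - b| <= x -> `|b - c| <= y -> `|a - c| <= x + y.
Proof. by move=> h1 h2; apply: le_trans (ler_distD b _ _) _; exact: lerD. Qed.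

(** Compactness: around a hit every time is within [rho] of [l]; around any other time [odd_gap] and
    continuity keep the curve away from all lines at once. Finitely many such neighbourhoods cover
    [[u, v]]. *)
Lemma grid_gap f (u v rho : R) (l : seq R) : continuous f -> 0 < rho ->
  (forall t, u <= t <= v -> odd_line (f t) -> t \in l) ->
  exists2 eta, 0 < eta & forall t, u <= t <= v -> (forall x, x \in l -> rho < `|t - x|) ->
    forall o, odd_line o -> eta < `|f t - o|.
Proof.
move=> cf rho0 Hl.
have cK : compact (`[u, v]%classic : set R) by exact: segment_compact.
have := (compact_near_coveringP _).1 cK; rewrite /near_covering.
move=> /(_ R ((0:R)^'+) (fun r t => (exists2 x, x \in l & `|t - x| <= rho) \/ forall o, odd_line o -> r < `|f t - o|)).
case.
- move=> t /=; rewrite in_itv /= => tuv.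
  have [ot|nt] := pselect (odd_line (f t)).
    exists (ball t rho, [set: R]); first by split; [exact: nbhsx_ballx|exact: filterT].
    move=> [t' r] [/= bt _]; left; exists t; first exact: Hl.
    by move: bt; rewrite /ball /= distrC => /ltW.
  have [r r0 Hr] := odd_gap (f t).
  have [d d0 Hd] := @cont_eps f t (r / 2) cf (ltac:(lra)).
  exists (ball t d, [set r' | r' < r / 2]).
    split; first exact: nbhsx_ballx.
    by apply: nbhs_right_lt; lra.
  move=> [t' r'] [/= bt r'r]; right => o oo.
  have [E|ge] := Hr o oo; first by case: nt; rewrite -E.
  have h1 : `|f t' - f t| <= r / 2.
    by apply: Hd; move: bt; rewrite /ball /= distrC => /ltW.
  have := ler_distD (f t') (f t) o.
  move: ge h1 r'r; rewrite (distrC o) (distrC (f t') (f t)); clear; lra.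
- move=> e /= e0 He; exists (e / 2); first by rewrite divr_gt0.
  move=> t tuv far o oo.
  have := He (e / 2); rewrite /ball /= sub0r normrN ger0_norm; last by rewrite ltW // divr_gt0.
  have e20 : 0 < e / 2 by rewrite divr_gt0.
  move=> /(_ (ltac:(lra)) e20 t); rewrite /= in_itv /= => /(_ tuv) [[x xl h]|]; last exact.
  by have := far x xl; rewrite ltNge h.
Qed.

(** Localises the crossings of an approximant: away from [l] the curve keeps a distance from the
    lines that an [eta]-close curve cannot bridge. A given hit of [f] may have no hit of [g] nearby,
    or many. *)
Lemma hits_near f1 f2 (u v rho : R) (l : seq R) : continuous f1 -> continuous f2 -> 0 < rho ->
  (forall t, u <= t <= v -> hit f1 f2 t -> t \in l) ->
  exists2 eta, 0 < eta & forall g1 g2,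
    (forall t, u <= t <= v -> `|g1 t - f1 t| <= eta /\ `|g2 t - f2 t| <= eta) ->
    forall s, u <= s <= v -> hit g1 g2 s -> exists2 x, x \in l & `|s - x| <= rho.
Proof.
move=> c1 c2 rho0 Hl.
have [e1 e10 H1] := grid_gap c1 rho0 (fun t tt h => Hl t tt (or_introl h)).
have [e2 e20 H2] := grid_gap c2 rho0 (fun t tt h => Hl t tt (or_intror h)).
exists (Num.min e1 e2); first by rewrite lt_min e10.
move=> g1 g2 Hg s suv hs; apply: contrapT => no.
have far x : x \in l -> rho < `|s - x|.
  by move=> xl; rewrite ltNge; apply/negP => h; apply: no; exists x.
have [] := Hg s suv; rewrite !le_min => /andP[h1 _] /andP[_ h2].
case: hs => oo.
  by have := H1 s suv far _ oo; rewrite distrC ltNge h1.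
by have := H2 s suv far _ oo; rewrite distrC ltNge h2.
Qed.

Definition osc f (a b w : R) : Prop := forall x y, a <= x <= b -> a <= y <= b -> `|f x - f y| <= w.

Lemma osc_near f (a b c w : R) : (forall x, a <= x <= b -> `|f x - c| <= w) -> osc f a b (w + w).
Proof. by move=> H x y xab yab; apply: dist_chain (H x xab) _; rewrite distrC; exact: H. Qed.

Lemma osc_le f (a b w w' : R) : w <= w' -> osc f a b w -> osc f a b w'.
Proof. by move=> h H x y hx hy; apply: le_trans h; exact: H. Qed.

Definition slope (T w : nat -> R) i : R := (w i.+1 - w i) / (T i.+1 - T i).

(* f stays 7/4-close to the center c on the enlarged time interval [e, e' + tau] when g
   stays in the unit square around c on [s, s'] *)
Lemma arc_near f g (c e e' s s' tau rho x : R) :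
  (forall t, s <= t <= s' -> `|g t - c| <= 1) -> (forall t, s <= t <= s' -> `|g t - f t| <= 4^-1) ->
  (forall t, `|t - e| <= rho -> `|f t - f e| <= 4^-1) ->
  (forall t, `|t - e'| <= rho -> `|f t - f e'| <= 4^-1) ->
  s <= s' -> `|s - e| <= rho -> `|s' - e'| <= rho -> tau <= rho ->
  e <= x <= e' + tau -> `|f x - c| <= 7 / 4.
Proof.
move=> H1 H2 H3 H4 ss' se s'e' tr /andP[x1 x2].
have near t : s <= t <= s' -> `|f t - c| <= 5 / 4.
  move=> tt; have -> : 5 / 4 = 4^-1 + 1 :> R by field.
  by apply: dist_chain (H1 t tt); rewrite distrC; exact: H2.
(* In total: 1 for the cell, 1/4 for the distance from [g] to [f], and twice 1/4 for the motion of
   [f] close to a hit. *)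
have sum : 7 / 4 = 4^-1 + (4^-1 + 5 / 4) :> R by field.
have /andP[u1 u2] : - rho <= s - e <= rho by rewrite -ler_norml.
have /andP[u3 u4] : - rho <= s' - e' <= rho by rewrite -ler_norml.
clear se s'e'.
have [xs|sx] := ltP x s.
  rewrite sum. apply: (@dist_chain (f x) (f e)  c _ (4^-1 + 5 / 4)).
    by apply: H3; rewrite ler_norml; apply/andP; split; lra.
  apply: (@dist_chain (f e) (f s) c); last by apply: near; rewrite lexx.
  by rewrite distrC; apply: H3; rewrite ler_norml; apply/andP; split; lra.
have [s'x|xs'] := ltP s' x.
  rewrite sum; apply: (@dist_chain (f x) (f e') c _ (4^-1 + 5 / 4)).
    by apply: H4; rewrite ler_norml; apply/andP; split; lra.
  apply: (@dist_chain (f e') (f s') c); last by apply: near; rewrite lexx ss'.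
  by rewrite distrC; apply: H4; rewrite ler_norml; apply/andP; split; lra.
by apply: le_trans (near x _) _; [rewrite sx|lra].
Qed.

Lemma nm1_abs (z : R * R) : nm z <= 1 -> `|z.1| <= 1 /\ `|z.2| <= 1.
Proof. by rewrite nm_le1 => /andP. Qed.

(** The vertices [3j-1], [3j] and [3j+1] surround the crossing [q j]: one is on the grid, the others
    on the inner curves of the two adjacent cells. The index [i.+1 %/ 3] is their common [j]. The
    bound adds the displacement by [hat k] and the distance from [q j] to [p j]. *)
Lemma vert_near k (q C : nat -> R * R) M (p : nat -> R * R) th i : 0 < k ->
  (forall j, (j < M)%N -> nm (psub (q j) (C j)) = 1 /\ nm (psub (q j.+1) (C j)) = 1) ->
  (forall j, (j <= M)%N -> `|(q j).1 - (p j).1| <= th /\ `|(q j).2 - (p j).2| <= th) ->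
  (i <= 3 * M)%N ->
  `|(vert k q C i).1 - (p (i.+1 %/ 3)%N).1| <= k + th /\
  `|(vert k q C i).2 - (p (i.+1 %/ 3)%N).2| <= k + th.
Proof.
move=> k0 He Hq iM.
have hatn c z : nm (psub z c) = 1 -> `|(padd c (hat k (psub z c))).1 - z.1| <= k /\ `|(padd c (hat k (psub z c))).2 - z.2| <= k.
  move=> n1; have [] := @nm1_abs (psub z c); first by rewrite n1.
  have r1 := rad_lt1 k0 n1; have r2 := rad_ge k0 n1.
  rewrite /padd /hat /scl; set r := rad _ _ in r1 r2 *; rewrite /psub /= => h1 h2.
  have key a b : `|b - a| <= 1 -> `|a + r * (b - a) - b| <= k.
    move=> h; have -> : a + r * (b - a) - b = (r - 1) * (b - a) by ring.
    rewrite normrM -[k]mulr1; apply: ler_pM => //.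
    by rewrite ler_norml; apply/andP; split; lra.
  by split; exact: key.
have jle : (i.+1 %/ 3 <= M)%N by clear -iM; lia.
have [q1 q2] := Hq _ jle.
rewrite /vert; have : (i %% 3 < 3)%N by rewrite ltn_mod.
case E : (i %% 3)%N => [|[|[|//]]] _.
- have Ei : (i.+1 %/ 3 = i %/ 3)%N by clear -E; lia.
  by rewrite -Ei; split; apply: le_trans (q1) _ || apply: le_trans (q2) _; rewrite lerDr ltW.
- have Ei : (i.+1 %/ 3 = i %/ 3)%N by clear -E; lia.
  rewrite Ei in q1 q2 *.
  have [|h1 h2] := hatn (C (i %/ 3)%N) (q (i %/ 3)%N).
    by have [] := He (i %/ 3)%N (ltac:(clear -iM E; lia)).
  by split; [exact: dist_chain h1 q1|exact: dist_chain h2 q2].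
- have Ei : (i.+1 %/ 3 = (i %/ 3).+1)%N by clear -E; lia.
  rewrite Ei in q1 q2 *.
  have [|h1 h2] := hatn (C (i %/ 3)%N) (q (i %/ 3).+1%N).
    by have [] := He (i %/ 3)%N (ltac:(clear -iM E; lia)).
  by split; [exact: dist_chain h1 q1|exact: dist_chain h2 q2].
Qed.

Definition inj_on f1 f2 (u v : R) : Prop :=
  forall t t', u <= t <= v -> u <= t' <= v -> f1 t = f1 t' -> f2 t = f2 t' -> t = t'.

(** An increasing map that fixes the odd numbers preserves each interval between neighbouring ones.
    The squeezed curve thus keeps its cells and its hitting times while the crossing points slide
    along the lines. *)
Lemma chain_map f1 f2 h1 h2 M s C :
  (forall x y, x < y -> h1 x < h1 y) -> (forall x y, x < y -> h2 x < h2 y) ->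
  (forall y, odd_line y -> h1 y = y) -> (forall y, odd_line y -> h2 y = y) ->
  (forall j, (j < M)%N -> even_ctr (C j)) -> (forall j, (j <= M)%N -> hit f1 f2 (s j)) ->
  chain f1 f2 M s C -> chain (h1 \o f1) (h2 \o f2) M s C.
Proof.
move=> i1 i2 o1 o2 ev hh [hs hc he].
have key (h : R -> R) (x : R) (m : int) : (forall x y, x < y -> h x < h y) -> (forall y, odd_line y -> h y = y) ->
   `|x - 2 * m%:~R| <= 1 -> `|h x - 2 * m%:~R| <= 1.
  move=> ih oh; rewrite !ler_norml => /andP[a b].
  have hle y y' : y <= y' -> h y <= h y'.
    by rewrite le_eqVlt => /orP[/eqP ->//|/ih/ltW].
  have := hle (2 * m%:~R - 1) x; have := hle x (2 * m%:~R + 1).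
  rewrite (oh (2 * m%:~R + 1)); last by exists m.
  rewrite (oh (2 * m%:~R - 1)); last by exists (m - 1); rewrite intrD; lra.
  by move=> h3 h4; apply/andP; split; lra.
have hc' j t : (j < M)%N -> s j <= t <= s j.+1 -> nm (psub ((h1 \o f1) t, (h2 \o f2) t) (C j)) <= 1.
  move=> jM tt; have := hc j t jM tt; have [m [n ->]] := ev j jM.
  by rewrite !nm_le1 /psub /= => /andP[a b]; apply/andP; split; exact: key.
split => // j jM.
have hh' i : (i <= M)%N -> hit (h1 \o f1) (h2 \o f2) (s i).
  by move=> iM; case: (hh i iM) => o; [left; rewrite /= o1|right; rewrite /= o2].
have lj := ltW (hs j jM).
by split; apply: hit_nm1; [exact: ev|exact: hh' (ltnW jM)|apply: hc' => //; rewrite lexx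
                          |exact: ev|exact: hh'|apply: hc' => //; rewrite lexx andbT].
Qed.
End Straighten.

Section Straighten.
Variable R : realType.
Implicit Types (f g : R -> R).

(* Pieces of kind 0 are long (the slope of the polygon is close to that of the
   interpolation of f), pieces of kind 1 are short (in total), pieces of kind 2 are at the
   ends. *)
Definition straightened f1 f2 (u v eps : R) (N : nat) (T : nat -> R) (w : nat -> R * R) (K : nat -> nat) : Prop :=
  let w1 := fun i => (w i).1 in let w2 := fun i => (w i).2 in
  [/\ (0 < N)%N /\ T 0%N = 0 /\ T N = 1, (forall i, (i < N)%N -> T i < T i.+1), simple_polygon N w,
      (forall i, (i < N)%N -> (K i < 2)%N -> [/\ 0 < T i, T i.+1 < 1, osc f1 (T i) (T i.+1) 4 & osc f2 (T i) (T i.+1) 4]) &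
   [/\ (forall i, (i < N)%N -> K i = 0%N -> `|slope T w1 i - slope T (f1 \o T) i| <= eps /\ `|slope T w2 i - slope T (f2 \o T) i| <= eps),
       (forall i, (i < N)%N -> (0 < K i)%N -> `|slope T w1 i| <= eps /\ `|slope T w2 i| <= eps),
       (forall i, (i < N)%N -> (1 < K i)%N -> forall t, T i <= t <= T i.+1 -> u <= t <= v ->
          (osc f1 u t 4 /\ osc f2 u t 4) \/ (osc f1 t v 4 /\ osc f2 t v 4)) &
       \sum_(i < N | K i == 1%N) (T i.+1 - T i) <= eps]].

(** Serves when the approximant cuts out no arc. The single piece has kind 2 and goes to a
    horizontal segment, whose slope [eps] keeps it from degenerating. *)
Lemma straighten_trivial f1 f2 (u v eps : R) : 0 < eps ->
  (forall t, u <= t <= v -> (osc f1 u t 4 /\ osc f2 u t 4) \/ (osc f1 t v 4 /\ osc f2 t v 4)) ->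
  exists N T w K, straightened f1 f2 u v eps N T w K.
Proof.
move=> e0 H; exists 1%N, (fun i => i%:R), (fun i => (eps * i%:R, 0)), (fun=> 2%N); split => //.
- by move=> i _; rewrite ltr_nat.
- split=> [i i1|i i' x y ii' i1]; last by move: i1; rewrite ltnS leqn0 => /eqP E; move: ii'; rewrite E.
  by case=> /(mulfI (lt0r_neq0 e0))/eqP; rewrite eqr_nat; clear; lia.
- split => //.
  + move=> i i1 _; rewrite /slope /= subr0 mul0r normr0 (ltW e0); split => //.
    have d : (i.+1%:R - i%:R : R) = 1 by rewrite -natr1 addrAC subrr add0r.
    by rewrite -mulrBr d mulr1 divr1 gtr0_norm.
  + by move=> i _ _ t _ tuv; exact: H.
  + by rewrite big_pred0 // ltW.
Qed.

(** * The polygon of one approximating curve and its break times *)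

Section Main.
(** The curve [f] is the limit, [g] an injective approximant with crossing times [s j], and [e j] is
    the hit of [f] near [s j]; several [j] may have the same [e j]. Distinct hits are [gam] apart,
    [m] bounds the motion of [f] within [rho] of a hit, [tau] bounds the drift of the break times,
    and [tiny] the distance from the squeezed crossings of [g] to those of [f]. *)
Variables (f1 f2 g1 g2 : R -> R) (u v eps gam m rho tau tiny : R) (M : nat) (s e : nat -> R) (C : nat -> R * R).
Variables (k1 k2 : R -> R).
Hypotheses (M0 : (0 < M)%N) (u0 : 0 < u) (v1 : v < 1) (eps0 : 0 < eps).
Hypotheses (gam0 : 0 < gam) (m4 : m <= 4^-1) (mg : m <= eps * gam / 4).
Hypotheses (rho0 : 0 < rho) (rg : rho <= gam / 4) (tau0 : 0 < tau) (tr : tau <= rho) (te : tau <= eps) (tv : tau <= (1 - v) / 2).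
Hypotheses (tiny0 : 0 < tiny) (ti1 : tiny <= eps * gam / 8) (ti2 : tiny <= eps * (tau / (3 * M + 1)%N%:R) / 4)
  (ti3 : tiny <= eps * u / 4) (ti4 : tiny <= eps * (1 - v) / 8).
Hypotheses (near1 : forall j t, (j <= M)%N -> `|t - e j| <= rho -> `|f1 t - f1 (e j)| <= m)
           (near2 : forall j t, (j <= M)%N -> `|t - e j| <= rho -> `|f2 t - f2 (e j)| <= m).
Hypothesis egap : forall i j, (i <= M)%N -> (j <= M)%N -> e i != e j -> gam <= `|e i - e j|.
Hypothesis euv : forall j, (j <= M)%N -> u <= e j <= v.
Hypothesis se : forall j, (j <= M)%N -> `|s j - e j| <= rho.
Hypothesis fg : forall t, u <= t <= v -> `|g1 t - f1 t| <= 4^-1 /\ `|g2 t - f2 t| <= 4^-1.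
Hypothesis gch : good_chain g1 g2 u v M s C.
Hypothesis gti : tiled M C.
Hypotheses (cg1 : continuous g1) (cg2 : continuous g2) (ginj : inj_on g1 g2 u v).
Hypotheses (ch1 : continuous k1) (ch2 : continuous k2)
  (ih1 : forall x y, x < y -> k1 x < k1 y) (ih2 : forall x y, x < y -> k2 x < k2 y)
  (oh1 : forall y, odd_line y -> k1 y = y) (oh2 : forall y, odd_line y -> k2 y = y).
Hypothesis hq : forall j, (j <= M)%N -> `|k1 (g1 (s j)) - f1 (e j)| <= tiny /\ `|k2 (g2 (s j)) - f2 (e j)| <= tiny.

Let n : nat := (3 * M)%N.
Let dl : R := tau / (3 * M + 1)%N%:R.
Let E i := e (i.+1 %/ 3)%N.
(** The hits [E i] repeat, so the drift [dl * i] is added to make the times strictly increasing.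
    Over all indices it stays below [tau], hence the last interior break time is at most
    [v + tau < 1]. *)
Let T i : R := if i == 0%N then 0 else if i == n then 1 else E i + dl * i%:R.
Let w := vert tiny (fun j => (k1 (g1 (s j)), k2 (g2 (s j)))) C.
(** Kind 0 is reserved for chords ([i %% 3 = 1]) between different hits of [f]. Connectors, and
    chords between crossings near one and the same hit, have kind 1. *)
Let K i : nat := if (i == 0%N) || (i == n.-1) then 2%N else
   if ((i %% 3 == 1) && (e (i %/ 3) != e (i %/ 3).+1))%N then 0%N else 1%N.

Let slt i j : (i < j)%N -> (j <= M)%N -> s i < s j.
Proof. by case: gch => ch _ _ _ _; exact: (chain_lt ch). Qed.

Let suv j : (j <= M)%N -> u <= s j <= v.
Proof.
move=> jM; have [_ _ us sv _] := gch; apply/andP; split.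
  by apply: (le_trans us); case: j jM => // j jM; exact: ltW (slt _ jM).
apply: le_trans sv; move: (jM); rewrite leq_eqVlt => /orP[/eqP -> //|h].
exact: ltW (slt h (leqnn _)).
Qed.

(** Distinct hits are at least [gam >= 4 rho] apart, and each crossing is within [rho] of its hit,
    so the hits inherit the order of the crossings. *)
Let e_le1 j : (j < M)%N -> e j <= e j.+1.
Proof.
move=> jM; rewrite leNgt; apply/negP => h.
have ne : e j != e j.+1 by rewrite gt_eqF.
have hg := egap (ltnW jM) jM ne.
have h1' := se (ltnW jM); have h2' := se jM; have h3 := slt (ltnSn j) jM.
rewrite ger0_norm in hg; last by rewrite subr_ge0 ltW.
move: h1' h2'; rewrite !ler_norml => /andP[a1 a2] /andP[a3 a4].
by move: hg a1 a2 a3 a4 h3 h rg rho0; lra.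
Qed.

Let e_le i j : (i <= j)%N -> (j <= M)%N -> e i <= e j.
Proof.
elim: j => [|j IH]; first by rewrite leqn0 => /eqP ->.
rewrite leq_eqVlt => /orP[/eqP -> //|ij] jM.
by apply: le_trans (IH ij (ltnW jM)) (e_le1 jM).
Qed.

Let dl0 : 0 < dl.
Proof. by rewrite /dl divr_gt0 // ltr0n addn1. Qed.

Let dlt (i : nat) : (i <= n)%N -> 0 <= dl * i%:R <= tau.
Proof.
move=> iN; rewrite mulr_ge0 ?(ltW dl0) //=.
rewrite /dl -mulrA ger_pMr // mulrC ler_pdivrMr ?mul1r ?ler_nat ?ltr0n ?addn1 //.
by rewrite leqW.
Qed.

Let idx i : (i <= n)%N -> (i.+1 %/ 3 <= M)%N.
Proof. by rewrite /n; clear; lia. Qed.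

Let TE i : (0 < i)%N -> (i < n)%N -> T i = E i + dl * i%:R.
Proof. by rewrite /T; case: i => // i _ iN /=; rewrite ltn_eqF. Qed.

Let T_bounds i : (0 < i)%N -> (i < n)%N -> E i <= T i <= E i + tau.
Proof. by move=> i0 iN; have /andP[a b] := dlt (ltnW iN); rewrite TE // lerDl a lerD2l. Qed.

Let T_itv i : (0 < i)%N -> (i < n)%N -> u <= T i <= v + tau.
Proof.
move=> i0 iN; have /andP[a b] := T_bounds i0 iN; have /andP[c d] := euv (idx (ltnW iN)).
by rewrite (le_trans c a) (le_trans b) // lerD2r.
Qed.

Let n3 : (2 < n)%N.
Proof. by move: M0; rewrite /n; clear; lia. Qed.

Let T0 : T 0%N = 0. Proof. by []. Qed.
Let Tn : T n = 1.
Proof. by rewrite /T eqxx gtn_eqF // (ltn_trans _ n3). Qed.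

Let T_mid i : (0 < i)%N -> (i.+1 < n)%N -> T i.+1 - T i = E i.+1 - E i + dl.
Proof.
move=> i0 iN; rewrite !TE // ?(ltnW iN) // -natr1; ring.
Qed.

Let E_le i : (i < n)%N -> E i <= E i.+1.
Proof. by move=> iN; apply: e_le; [rewrite leq_div2r|exact: idx]. Qed.

Let T_first : u <= T 1%N - T 0%N.
Proof. by rewrite T0 subr0; have /andP[] := @T_itv 1%N isT (ltn_trans (ltnSn _) n3). Qed.

Let T_last : (1 - v) / 2 <= T n - T n.-1.
Proof.
have [||_ h] := andP (@T_itv n.-1 _ _); [by rewrite -ltnS prednK ?(ltn_trans _ n3)|by rewrite ltn_predL (ltn_trans _ n3)|].
by rewrite Tn; move: h tv; lra.
Qed.

Let T_lt i : (i < n)%N -> T i < T i.+1.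
Proof.
move=> iN; rewrite -subr_gt0.
case: i iN => [|i] iN; first by apply: lt_le_trans T_first.
have [iN'|iN'] := ltnP i.+2 n.
  rewrite T_mid // ltr_wpDl // subr_ge0; exact: E_le.
have -> : i.+2 = n by apply/eqP; rewrite eqn_leq iN' iN.
have -> : i.+1 = n.-1 by apply/eqP; rewrite -eqSS prednK ?(ltn_trans _ n3) // eqn_leq iN' iN.
apply: lt_le_trans T_last; rewrite divr_gt0 // subr_gt0 //.
Qed.

Let w_near i : (i <= n)%N -> `|(w i).1 - f1 (E i)| <= tiny + tiny /\ `|(w i).2 - f2 (E i)| <= tiny + tiny.
Proof.
move=> iN; have [ch [ev hh] us sv _] := gch.
have [_ _ he] := chain_map ih1 ih2 oh1 oh2 ev hh ch.
apply: (@vert_near R tiny _ C M (fun j => (f1 (e j), f2 (e j))) tiny i tiny0 he) => //.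
Qed.

Let w_simple : simple_polygon n w.
Proof.
have [ch [ev hh] us sv _] := gch.
have ch' := chain_map ih1 ih2 oh1 oh2 ev hh ch.
have inj (h : R -> R) : (forall x y, x < y -> h x < h y) -> injective h.
  move=> ih x y E'; have [xy|xy|//] := ltgtP x y; have := ih _ _ xy; rewrite E' ltxx //.
apply: (chain_polygon tiny0 _ _ ch' gti).
- exact: cont_comp cg1 ch1.
- exact: cont_comp cg2 ch2.
- move=> t t' /andP[t1 t2] /andP[t3 t4] /(inj _ ih1) e1 /(inj _ ih2) e2.
  by apply: ginj => //; apply/andP; split; apply: le_trans; eauto.
Qed.

Let near_arc j x : (j < M)%N -> e j <= x <= e j.+1 + tau ->
  `|f1 x - (C j).1| <= 7 / 4 /\ `|f2 x - (C j).2| <= 7 / 4.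
Proof.
move=> jM xx; have [[hs hc he] [ev hh] us sv _] := gch.
have sb t : s j <= t <= s j.+1 -> u <= t <= v.
  move=> /andP[a b]; apply/andP; split.
    by apply: le_trans a; apply: (le_trans us); case: (j) jM => // j' jM; exact: ltW (slt _ (ltnW jM)).
  apply: (le_trans b); apply: le_trans sv; move: (jM); rewrite leq_eqVlt => /orP[/eqP -> //|h].
  exact: ltW (slt h (leqnn _)).
have lj := ltW (hs j jM); have jM' := ltnW jM.
have nm1 t : s j <= t <= s j.+1 -> `|g1 t - (C j).1| <= 1 /\ `|g2 t - (C j).2| <= 1.
  by move=> tt; have := nm1_abs (hc j t jM tt).
split.
- apply: (@arc_near R f1 g1 _ (e j) (e j.+1) (s j) (s j.+1) tau rho) => //.
  + by move=> t tt; have [] := nm1 t tt.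
  + by move=> t tt; have [] := fg (sb t tt).
  + by move=> t tt; apply: le_trans m4; exact: near1.
  + by move=> t tt; apply: le_trans m4; exact: near1.
  + exact: se.
  + exact: se.
- apply: (@arc_near R f2 g2 _ (e j) (e j.+1) (s j) (s j.+1) tau rho) => //.
  + by move=> t tt; have [] := nm1 t tt.
  + by move=> t tt; have [] := fg (sb t tt).
  + by move=> t tt; apply: le_trans m4; exact: near2.
  + by move=> t tt; apply: le_trans m4; exact: near2.
  + exact: se.
  + exact: se.
Qed.

Let w74 : 7 / 4 + 7 / 4 <= 4 :> R.
Proof. by lra. Qed.

Let osc_mid i : (0 < i)%N -> (i.+1 < n)%N -> osc f1 (T i) (T i.+1) 4 /\ osc f2 (T i) (T i.+1) 4.
Proof.
move=> i0 iN; have jM : (i %/ 3 < M)%N by move: iN; rewrite /n; clear; lia.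
have /andP[a _] := T_bounds i0 (ltnW iN); have /andP[_ b] := T_bounds (ltn0Sn i) iN.
have a' : e (i %/ 3) <= T i by apply: le_trans a; apply: e_le; [rewrite leq_div2r|exact: idx (ltnW (ltnW iN))].
have b' : T i.+1 <= e (i %/ 3).+1 + tau.
  by apply: (le_trans b); rewrite lerD2r; apply: e_le => //; clear; lia.
split; apply: (osc_le w74); apply: (@osc_near R _ _ _ _ (7 / 4)) => x /andP[x1 x2].
  have [|h _] := near_arc (x := x) jM; [by rewrite (le_trans a' x1) (le_trans x2 b')|exact: h].
have [|_ h] := near_arc (x := x) jM; [by rewrite (le_trans a' x1) (le_trans x2 b')|exact: h].
Qed.
Let E_node i : (i %% 3 != 1)%N -> E i = E i.+1.
Proof. by move=> h; rewrite /E; congr e; move: h; clear; lia. Qed.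

Let K_short i : (i < n)%N -> (0 < K i)%N -> E i = E i.+1.
Proof.
rewrite /K; have [->|i0] := eqVneq i 0%N; first by move=> _ _; exact: E_node.
have [->|iN] := eqVneq i n.-1.
  by move=> _ _; apply: E_node; move: M0; rewrite /n; clear; lia.
have [h|h] := eqVneq (i %% 3)%N 1%N; last by move=> _ _; exact: E_node.
case: eqP => // h' _ _; rewrite /E.
have -> : (i.+1 %/ 3 = i %/ 3)%N by move: h; clear; lia.
have -> : (i.+2 %/ 3 = (i %/ 3).+1)%N by move: h; clear; lia.
by [].
Qed.

Let K_long i : (i < n)%N -> K i = 0%N -> [/\ (0 < i)%N, (i.+1 < n)%N & gam <= E i.+1 - E i].
Proof.
rewrite /K => iN; have [->//|i0] := eqVneq i 0%N.
have [->//|iN'] := eqVneq i n.-1.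
have [h|h] := eqVneq (i %% 3)%N 1%N => //=; case: eqP => //= h' _.
have iN2 : (i.+1 < n)%N.
  rewrite ltn_neqAle iN andbT; apply: contra iN' => /eqP E'.
  by rewrite -E'.
have e1 : (i.+1 %/ 3 = i %/ 3)%N by move: h; clear; lia.
have e2 : (i.+2 %/ 3 = (i %/ 3).+1)%N by move: h; clear; lia.
have jM : (i %/ 3 < M)%N by move: iN; rewrite /n; clear; lia.
split => //; first by rewrite lt0n.
rewrite /E e1 e2; have := egap (ltnW jM) jM; have le := e_le1 jM.
rewrite distrC ger0_norm ?subr_ge0 //; apply; exact/eqP.
Qed.

Let wd (a : R * R -> R) (f : R -> R) : (forall i, (i <= n)%N -> `|a (w i) - f (E i)| <= tiny + tiny) ->
  forall i, (i < n)%N -> E i = E i.+1 -> `|a (w i.+1) - a (w i)| <= 4 * tiny.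
Proof.
move=> H i iN EE; have h1 := H _ iN; have h2 := H _ (ltnW iN); rewrite -EE in h1.
rewrite distrC in h2; have := dist_chain h1 h2.
by have -> : tiny + tiny + (tiny + tiny) = 4 * tiny by ring.
Qed.

(** Both ends are within [2 tiny] of the same point of [f], hence [4 tiny] apart, and the piece
    lasts at least [u], [dl] or [(1-v)/2]. This is the origin of the bounds [ti2], [ti3] and
    [ti4]. *)
Let short_slope (a : R * R -> R) (f : R -> R) : (forall i, (i <= n)%N -> `|a (w i) - f (E i)| <= tiny + tiny) ->
  forall i, (i < n)%N -> (0 < K i)%N -> `|slope T (fun i => a (w i)) i| <= eps.
Proof.
move=> H i iN Ki; have EE := K_short iN Ki.
have h := wd H iN EE; have Tp : 0 < T i.+1 - T i by rewrite subr_gt0 T_lt.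
rewrite /slope normrM normfV (gtr0_norm Tp) ler_pdivrMr //; apply: (le_trans h).
have h4 (x y : R) : tiny <= eps * x / 4 -> x <= y -> 4 * tiny <= eps * y.
  move=> hx xy; have := ler_wpM2l (ltW eps0) xy; move: hx; lra.
have [->|i0] := eqVneq i 0%N; first exact: h4 T_first.
have [iN'|iN'] := ltnP i.+1 n.
  apply: (h4 dl); first exact: ti2.
  by rewrite T_mid ?lt0n // lerDr subr_ge0 E_le.
have -> : i.+1 = n by apply/eqP; rewrite eqn_leq iN iN'.
have -> : i = n.-1 by apply/eqP; rewrite -eqSS prednK ?(ltn_trans _ n3) // eqn_leq iN iN'.
apply: (h4 ((1 - v) / 2)); last exact: T_last.
have -> : eps * ((1 - v) / 2) / 4 = eps * (1 - v) / 8 by field.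
exact: ti4.
Qed.

(** At each end the polygon is within [2 tiny + m <= eps * gam / 2] of [f] at the break time, and
    the piece lasts at least [gam]. *)
Let long_slope (a : R * R -> R) (f : R -> R) : (forall i, (i <= n)%N -> `|a (w i) - f (E i)| <= tiny + tiny) ->
  (forall j t, (j <= M)%N -> `|t - e j| <= rho -> `|f t - f (e j)| <= m) ->
  forall i, (i < n)%N -> K i = 0%N -> `|slope T (fun i => a (w i)) i - slope T (f \o T) i| <= eps.
Proof.
move=> H near i iN Ki; have [i0 iN' ge] := K_long iN Ki.
have Tp : 0 < T i.+1 - T i by rewrite subr_gt0 T_lt.
have Tg : gam <= T i.+1 - T i by rewrite T_mid // (le_trans ge) // lerDl ltW.
have one j : (0 < j)%N -> (j < n)%N -> `|a (w j) - f (T j)| <= eps * gam / 2.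
  move=> j0 jN; have h1 := H j (ltnW jN).
  have /andP[t1 t2] := T_bounds j0 jN.
  have h2 : `|T j - E j| <= rho.
    rewrite ger0_norm ?subr_ge0 // lerBlDl (le_trans t2) // lerD2l.
    exact: tr.
  have h3 := near _ _ (idx (ltnW jN)) h2; rewrite distrC in h3.
  apply: (le_trans (dist_chain h1 h3)).
  by move: ti1 mg; lra.
have os1 := one i i0 iN; have os2 := one i.+1 isT iN'; rewrite distrC in os1.
rewrite /slope -mulrBl normrM normfV (gtr0_norm Tp) ler_pdivrMr //=.
have -> : a (w i.+1) - a (w i) - (f (T i.+1) - f (T i)) = (a (w i.+1) - f (T i.+1)) + (f (T i) - a (w i)) by ring.
apply: (le_trans (ler_normD _ _)); apply: (le_trans (lerD os2 os1)).
have -> : eps * gam / 2 + eps * gam / 2 = eps * gam by field.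
by rewrite ler_wpM2l // ltW.
Qed.

Let near_end_cell j x (c : R * R) (lo hi : R) : (j <= M)%N -> u <= lo -> hi <= v ->
  (forall t, lo <= t <= hi -> nm (psub (g1 t, g2 t) c) <= 1) -> lo <= s j <= hi ->
  (lo <= x <= hi \/ `|x - e j| <= rho) ->
  `|f1 x - c.1| <= 7 / 4 /\ `|f2 x - c.2| <= 7 / 4.
Proof.
move=> jM ul hv Hc sj hx.
have bd t : lo <= t <= hi -> u <= t <= v by move=> /andP[a b]; rewrite (le_trans ul a) (le_trans b hv).
have near t : lo <= t <= hi -> `|f1 t - c.1| <= 5 / 4 /\ `|f2 t - c.2| <= 5 / 4.
  move=> tt; have [a1 a2] := nm1_abs (Hc t tt); have [b1 b2] := fg (bd t tt).
  rewrite distrC in b1; rewrite distrC in b2.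
  have -> : 5 / 4 = 4^-1 + 1 :> R by field.
  by split; [exact: dist_chain b1 a1|exact: dist_chain b2 a2].
have sum : 7 / 4 = 4^-1 + (4^-1 + 5 / 4) :> R by field.
case: hx => hx.
  have [a b] := near x hx; split; [apply: (le_trans a)|apply: (le_trans b)]; lra.
have [a b] := near _ sj; rewrite sum; split.
- apply: dist_chain (le_trans (near1 jM hx) m4) _; apply: dist_chain a.
  by rewrite distrC; apply: le_trans m4; apply: near1 => //; exact: se.
- apply: dist_chain (le_trans (near2 jM hx) m4) _; apply: dist_chain b.
  by rewrite distrC; apply: le_trans m4; apply: near2 => //; exact: se.
Qed.

Let K_end i : (i < n)%N -> (1 < K i)%N -> forall t, T i <= t <= T i.+1 -> u <= t <= v ->
  (osc f1 u t 4 /\ osc f2 u t 4) \/ (osc f1 t v 4 /\ osc f2 t v 4).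
Proof.
rewrite /K => iN; have [->|i0] := eqVneq i 0%N => [_ t /andP[_ tT] /andP[ut tv']|]; [left|].
  have [_ _ us sv [[c ec Hc] _]] := gch.
  have tT' : t <= e 0%N + tau.
    by apply: (le_trans tT); have /andP[] := @T_bounds 1%N isT (ltn_trans (ltnSn _) n3).
  have near x : u <= x <= t -> `|f1 x - c.1| <= 7 / 4 /\ `|f2 x - c.2| <= 7 / 4.
    move=> /andP[x1 x2]; apply: (@near_end_cell 0%N x c u (s 0%N)) => //.
    - by have /andP[] := suv (leq0n M).
    - by rewrite us lexx.
    have [h|h] := leP x (s 0%N); [by left; rewrite x1|right].
    have := se (leq0n M); rewrite !ler_norml => /andP[a b].
    by apply/andP; split; move: x2 h a b tT' tr; lra.
  split; apply: (osc_le w74); apply: osc_near => x xx; [exact: (proj1 (near x xx))|exact: (proj2 (near x xx))].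
move: iN; have [->|ne] := eqVneq i n.-1; last by rewrite orbF; case: ifP.
move=> iN _ t /andP[Tt _] /andP[ut tv']; right.
have [_ _ us sv [_ [c ec Hc]]] := gch.
have tT' : e M <= t.
  apply: le_trans Tt; have [|h _] := andP (@T_bounds n.-1 _ iN).
    by rewrite -ltnS prednK ?(ltn_trans _ n3).
  apply: le_trans h; rewrite /E; suff -> : (n.-1.+1 %/ 3)%N = M by [].
  by move: M0; rewrite /n; clear; lia.
have near x : t <= x <= v -> `|f1 x - c.1| <= 7 / 4 /\ `|f2 x - c.2| <= 7 / 4.
  move=> /andP[x1 x2]; apply: (@near_end_cell M x c (s M) v) => //.
  - by have /andP[] := suv (leqnn M).
  - by rewrite sv lexx.
  have [h|h] := leP (s M) x; [by left; rewrite x2|right].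
  have := se (leqnn M); rewrite !ler_norml => /andP[a b].
  by apply/andP; split; move: x1 h a b tT'; lra.
split; apply: (osc_le w74); apply: osc_near => x xx; [exact: (proj1 (near x xx))|exact: (proj2 (near x xx))].
Qed.
(** A piece of kind 1 joins vertices with the same [E], so it lasts exactly [dl]; there are at most
    [n] of them, and [n dl <= tau <= eps]. *)
Let K_sum : \sum_(i < n | K i == 1%N) (T i.+1 - T i) <= eps.
Proof.
apply: (@le_trans _ _ (\sum_(i < n) dl)).
  apply: (@le_trans _ _ (\sum_(i < n | K i == 1%N) dl)).
    apply: ler_sum => i /eqP Ki; have EE := K_short (ltn_ord i) (ltac:(by rewrite Ki)).
    move: Ki; rewrite /K; have [//|i0] := eqVneq (i : nat) 0%N.
    have [//|iN] := eqVneq (i : nat) n.-1 => _.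
    rewrite T_mid ?lt0n //; last first.
      rewrite ltn_neqAle ltn_ord andbT; apply: contra iN => /eqP E'.
      by apply/eqP; exact: (congr1 predn E').
    by rewrite EE subrr add0r.
  rewrite [leRHS](bigID (fun i : 'I_n => K i == 1%N)) /= lerDl.
  by apply: sumr_ge0 => i _; exact: ltW.
rewrite sumr_const card_ord -mulr_natr; apply: le_trans te.
by have /andP[] := dlt (leqnn n).
Qed.

Lemma straighten_main : straightened f1 f2 u v eps n T w K.
Proof.
split => //; first by split; [exact: ltn_trans n3|].
- move=> i iN Ki.
  have [i0 iN'] : (0 < i)%N /\ (i.+1 < n)%N.
    move: Ki; rewrite /K; have [//|i0] := eqVneq i 0%N.
    have [//|ne] := eqVneq i n.-1 => _; split; first by rewrite lt0n.
    by rewrite ltn_neqAle iN andbT; apply: contra ne => /eqP E'; rewrite -E'.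
  have [os1 os2] := osc_mid i0 iN'.
  split => //.
    by have /andP[h _] := T_itv i0 (ltnW iN'); apply: lt_le_trans h.
  have /andP[_ h] := @T_itv i.+1 isT iN'; move: h tv v1; lra.
split => //.
- move=> i iN Ki; split.
    by apply: (long_slope (a := fst) (f := f1)) => // j jN; have [] := w_near jN.
  by apply: (long_slope (a := snd) (f := f2)) => // j jN; have [] := w_near jN.
- move=> i iN Ki; split.
    by apply: (short_slope (a := fst) (f := f1)) => // j jN; have [] := w_near jN.
  by apply: (short_slope (a := snd) (f := f2)) => // j jN; have [] := w_near jN.
Qed.
End Main.

(** The order of the choices is the point. The squeeze radii, [gam], [m], [rho], [tau] and the
    closeness [eta] depend on [f], [u], [v] and [eps] alone. Only then is the approximant taken,
    which fixes the number [M] of arcs, and [tiny] has to be small in terms of [M]: this is why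
    [compress_grid] provides one radius for all [th]. *)
Lemma straighten f1 f2 (u v : R) : continuous f1 -> continuous f2 -> 0 < u -> u <= v -> v < 1 ->
  finite_set [set t | u <= t <= v /\ hit f1 f2 t] ->
  (forall eta : R, 0 < eta -> exists g1 g2, [/\ continuous g1, continuous g2, inj_on g1 g2 u v,
     finite_set [set t | u <= t <= v /\ hit g1 g2 t] &
     forall t, u <= t <= v -> `|g1 t - f1 t| <= eta /\ `|g2 t - f2 t| <= eta]) ->
  forall eps : R, 0 < eps -> exists N T w K, straightened f1 f2 u v eps N T w K.
Proof.
move=> cf1 cf2 u0 uv v1 /finite_seqP[l El] Happ eps eps0.
have ml t : t \in l <-> u <= t <= v /\ hit f1 f2 t.
  by have := congr1 (fun A : set R => A t) El => /= ->.
have [r1 r10 H1] := compress_grid (map f1 l).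
have [r2 r20 H2] := compress_grid (map f2 l).
have [gam gam0 Hg] : exists2 gam : R, 0 < gam & forall z : R, 0 < z <= gam -> forall x, x \in l -> forall y, y \in l -> x != y -> z <= `|x - y|.
  apply: eventually_all => x xl; apply: eventually_all => y yl.
  have [->|ne] := eqVneq x y; first by exists 1.
  exists `|x - y|; first by rewrite normr_gt0 subr_eq0.
  by move=> r' /andP[_ h] _.
pose m := Num.min (Num.min (r1 / 2) (r2 / 2)) (Num.min 4^-1 (eps * gam / 4)).
have m0 : 0 < m by rewrite !lt_min; apply/andP; split; apply/andP; split; [exact: divr_gt0|exact: divr_gt0|by rewrite invr_gt0|by rewrite divr_gt0 // mulr_gt0].
have [rho1 rho10 Hr] : exists2 rho : R, 0 < rho & forall r' : R, 0 < r' <= rho -> forall x, x \in l -> forall t, `|t - x| <= r' -> `|f1 t - f1 x| <= m /\ `|f2 t - f2 x| <= m.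
  apply: eventually_all => x xl.
  have [d1 d10 D1] := cont_eps x cf1 m0; have [d2 d20 D2] := cont_eps x cf2 m0.
  exists (Num.min d1 d2); first by rewrite lt_min d10.
  move=> r' /andP[_]; rewrite le_min => /andP[a b] t h.
  by split; [apply: D1|apply: D2]; exact: le_trans h _.
pose rho := Num.min rho1 (gam / 4).
have rho0 : 0 < rho by rewrite lt_min rho10 divr_gt0.
pose tau := Num.min rho (Num.min eps ((1 - v) / 2)).
have tau0 : 0 < tau.
  by rewrite lt_min rho0 lt_min eps0 divr_gt0 // subr_gt0.
have [eta eta0 He] := hits_near cf1 cf2 rho0 (fun t tt h => (ml t).2 (conj tt h)).
have [|g1 [g2 [cg1 cg2 ginj gfin gf]]] := Happ (Num.min eta m); first by rewrite lt_min eta0.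
have mle : [/\ m <= r1 / 2, m <= r2 / 2, m <= 4^-1 & m <= eps * gam / 4].
  by split; rewrite /m !ge_min lexx ?orbT.
have [mr1 mr2 m4 mg] := mle.
have gf1 t : u <= t <= v -> `|g1 t - f1 t| <= m /\ `|g2 t - f2 t| <= m.
  by move=> /gf; rewrite !le_min => -[/andP[_ a] /andP[_ b]].
have fg t : u <= t <= v -> `|g1 t - f1 t| <= 4^-1 /\ `|g2 t - f2 t| <= 4^-1.
  by move=> /gf1 [a b]; split; [exact: le_trans a m4|exact: le_trans b m4].
have ocell a b c : u <= a -> b <= v -> (forall t, a <= t <= b -> nm (psub (g1 t, g2 t) c) <= 1) -> osc f1 a b 4 /\ osc f2 a b 4.
  move=> ua bv Hc.
  have w54 : (4^-1 + 1) + (4^-1 + 1) <= 4 :> R by lra.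
  have key t : a <= t <= b -> `|f1 t - c.1| <= 4^-1 + 1 /\ `|f2 t - c.2| <= 4^-1 + 1.
    move=> tt; have [a1 a2] := nm1_abs (Hc t tt); have [|b1 b2] := fg t.
      by case/andP: tt => t1 t2; rewrite (le_trans ua t1) (le_trans t2 bv).
    by rewrite distrC in b1; rewrite distrC in b2; split; [exact: dist_chain b1 a1|exact: dist_chain b2 a2].
  split; apply: (osc_le w54); apply: osc_near => x xx; [exact: (proj1 (key x xx))|exact: (proj2 (key x xx))].
have [exh|noh] := pselect (exists2 t, u <= t <= v & hit g1 g2 t); last first.
  apply: straighten_trivial => // t /andP[ut tv]; left.
  have [|c ec Hc] := strip2 cg1 cg2 uv.
    by move=> x /andP[x1 x2] hx; apply: noh; exists x => //; rewrite (ltW x1) (ltW x2).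
  apply: (ocell u t c (lexx _) tv) => x /andP[x1 x2]; apply: Hc.
  by rewrite x1 (le_trans x2 tv).
have [M [s [C [gch gti]]]] := good_chain_tiled cg1 cg2 uv gfin exh.
have [M0|M0] := eqVneq M 0%N.
  subst M; apply: straighten_trivial => // t /andP[ut tv].
  have [_ _ us sv [[c ec Hc] [c' ec' Hc']]] := gch.
  have [ts|st] := leP t (s 0%N); [left|right].
    apply: (ocell u t c (lexx _) tv) => x /andP[x1 x2]; apply: Hc.
    by rewrite x1 (le_trans x2 ts).
  apply: (ocell t v c' ut (lexx _)) => x /andP[x1 x2]; apply: Hc'.
  by rewrite x2 (le_trans (ltW st) x1).
rewrite -lt0n in M0.
have suv j : (j <= M)%N -> u <= s j <= v.
  move=> jM; have [ch _ us sv _] := gch; apply/andP; split.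
    by apply: (le_trans us); case: j jM => // j jM; exact: ltW (chain_lt ch _ jM).
  apply: le_trans sv; move: (jM); rewrite leq_eqVlt => /orP[/eqP -> //|h].
  exact: ltW (chain_lt ch h (leqnn _)).
have /choice [e He'] : forall j, exists x, (j <= M)%N -> x \in l /\ `|s j - x| <= rho.
  move=> j; have [jM|jM] := leqP j M; last by exists 0.
  have hj : hit g1 g2 (s j) by have [_ [_ hh] _ _ _] := gch; exact: hh.
  have ge t : u <= t <= v -> `|g1 t - f1 t| <= eta /\ `|g2 t - f2 t| <= eta.
    by move=> /gf; rewrite !le_min => -[/andP[a _] /andP[b _]].
  by have [x xl hx] := He g1 g2 ge (s j) (suv j jM) hj; exists x.
have el j : (j <= M)%N -> e j \in l by move=> /He'[].
have se j : (j <= M)%N -> `|s j - e j| <= rho by move=> /He'[].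
pose tiny := Num.min (Num.min (eps * gam / 8) (eps * (tau / (3 * M + 1)%N%:R) / 4)) (Num.min (eps * u / 4) (eps * (1 - v) / 8)).
have dl0 : 0 < tau / (3 * M + 1)%N%:R by rewrite divr_gt0 // ltr0n addn1.
have v0 : 0 < 1 - v by rewrite subr_gt0.
have tiny0 : 0 < tiny.
  by rewrite !lt_min; apply/andP; split; apply/andP; split; rewrite divr_gt0 // mulr_gt0.
have [ti1 ti2 ti3 ti4] : [/\ tiny <= eps * gam / 8, tiny <= eps * (tau / (3 * M + 1)%N%:R) / 4, tiny <= eps * u / 4 & tiny <= eps * (1 - v) / 8].
  by split; rewrite /tiny !ge_min lexx ?orbT.
have [k1 [ck1 ik1 ok1 nk1]] := H1 _ tiny0.
have [k2 [ck2 ik2 ok2 nk2]] := H2 _ tiny0.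
have rr : 0 < rho <= rho1 by rewrite rho0 ge_min lexx.
have near j t : (j <= M)%N -> `|t - e j| <= rho -> `|f1 t - f1 (e j)| <= m /\ `|f2 t - f2 (e j)| <= m.
  by move=> jM; apply: (Hr _ rr); exact: el.
do 4 eexists; apply: (@straighten_main f1 f2 g1 g2 u v eps gam m rho tau tiny M s e C k1 k2) => //.
- by rewrite /rho ge_min lexx orbT.
- by rewrite /tau ge_min lexx.
- by rewrite /tau !ge_min lexx !orbT.
- by rewrite /tau !ge_min lexx !orbT.
- by move=> j t jM h; have [] := near j t jM h.
- by move=> j t jM h; have [] := near j t jM h.
- move=> i j iM jM; apply: (Hg gam _ _ (el _ iM) _ (el _ jM)).
  by rewrite gam0 lexx.
- by move=> j jM; have [] := (ml (e j)).1 (el j jM).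
- move=> j jM; have [a1 a2] := gf1 _ (suv j jM); have [b1 b2] := near j (s j) jM (se j jM).
  split.
    apply: nk1; first by apply: map_f; exact: el.
    by apply: le_trans (dist_chain a1 b1) _; move: mr1; lra.
  apply: nk2; first by apply: map_f; exact: el.
  by apply: le_trans (dist_chain a2 b2) _; move: mr2; lra.
Qed.
End Straighten.

(** * Absolutely continuous functions and weak derivatives *)

Section Prim.
Variable R : realType.
Notation mu := (@lebesgue_measure R).
Notation TR := (measurableTypeR R).
Implicit Types (f g h : R -> R) (a b x y p : R) (D E : set TR).

Definition L1 (D : set TR) g : Prop := mu.-integrable D (EFin \o g).

Lemma measurable_I01 : measurable (@I01 R : set TR).
Proof. exact: measurable_itv. Qed.

Lemma mu_I01 : mu (@I01 R) = 1%E.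
Proof. by rewrite /I01 lebesgue_measure_itv /= lte_fin ltr01 oppr0 adde0. Qed.

Lemma L1_measurable D g : L1 D g -> measurable_fun D g.
Proof. by move=> /measurable_int /measurable_EFinP. Qed.

Lemma L1_le D f g : measurable D -> measurable_fun D f -> (forall x, D x -> `|f x| <= g x) -> L1 D g -> L1 D f.
Proof.
move=> mD mf H ig; apply: le_integrable ig => //; first exact/measurable_EFinP.
by move=> x Dx /=; rewrite lee_fin (le_trans (H x Dx)) // ler_norm.
Qed.

Lemma L1_cst01 (c : R) : L1 (@I01 R) (cst c).
Proof.
apply: measurable_bounded_integrable; [exact: measurable_I01|by rewrite [X in (X < _)%E]mu_I01 ltey|exact: measurable_cst|].
exact: bounded_cst.
Qed.

Lemma L1D D f g : measurable D -> L1 D f -> L1 D g -> L1 D (fun x => f x + g x).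
Proof. by move=> mD h1 h2; exact: (integrableD mD h1 h2). Qed.
Lemma L1B D f g : measurable D -> L1 D f -> L1 D g -> L1 D (fun x => f x - g x).
Proof. by move=> mD h1 h2; exact: (integrableB mD h1 h2). Qed.
Lemma L1Z D (k : R) f : measurable D -> L1 D f -> L1 D (fun x => k * f x).
Proof. by move=> mD h1; exact: (integrableZl mD k h1). Qed.
Lemma L1_norm D f : L1 D f -> L1 D (fun x => `|f x|).
Proof. by move=> h; exact: (integrable_abse h). Qed.
Lemma L1S D E f : measurable D -> measurable E -> E `<=` D -> L1 D f -> L1 E f.
Proof. by move=> mD mE ED; exact: integrableS. Qed.
Lemma L1_mulb D f h (M : R) : measurable D -> L1 D f -> measurable_fun D h -> (forall x, D x -> `|h x| <= M) ->
  L1 D (fun x => f x * h x).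
Proof.
move=> mD If mh hM; apply: (@L1_le _ _ (fun x => M * `|f x|)) => //.
- by apply: measurable_funM => //; exact: L1_measurable.
- by move=> x Dx; rewrite normrM mulrC ler_wpM2r // hM.
- by apply: L1Z => //; exact: L1_norm.
Qed.

Lemma powR_ge_id (x p : R) : 1 <= p -> 0 <= x -> x <= 1 + x `^ p.
Proof.
move=> p1 x0; have [x1|x1] := leP x 1.
  by rewrite (le_trans x1) // lerDl powR_ge0.
have := @ler_powR _ x (ltW x1) _ _ p1; rewrite powRr1 // => /le_trans; apply.
by rewrite lerDr.
Qed.

Lemma isLp_powR p f : 1 <= p -> isLp p f -> L1 (@I01 R) (fun x => `|f x| `^ p).
Proof.
move=> p1 [mf fin]; apply/integrableP; split.
  apply/measurable_EFinP; apply: (@measurableT_comp _ _ _ _ _ _ (@powR R ^~ p)) => //.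
  exact: measurableT_comp.
by under eq_integral do rewrite /= (ger0_norm (powR_ge0 _ _)).
Qed.

Lemma powR_isLp p f : measurable_fun (@I01 R) f -> L1 (@I01 R) (fun x => `|f x| `^ p) -> isLp p f.
Proof.
move=> mf /integrableP[_]; under eq_integral do rewrite /= (ger0_norm (powR_ge0 _ _)).
by split.
Qed.

Lemma isLp_L1 p f : 1 <= p -> isLp p f -> L1 (@I01 R) f.
Proof.
move=> p1 lf; apply: (@L1_le _ _ (fun x => 1 + `|f x| `^ p)) measurable_I01 (proj1 lf) _ _.
  by move=> x _; exact: powR_ge_id.
by apply: L1D measurable_I01 (L1_cst01 1) (isLp_powR p1 lf).
Qed.

Definition prim g x : R := \int[mu]_(t in `]-oo, x]) g t.

Lemma RintegralS_norm (A : set TR) g : measurable A -> L1 setT g -> `|\int[mu]_(t in A) g t| <= \int[mu]_(t in A) `|g t|.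
Proof. by move=> mA ig; apply: le_normr_Rintegral => //; exact: L1S ig. Qed.

Lemma primB g x y : L1 setT g -> x <= y -> prim g y - prim g x = \int[mu]_(t in `]x, y]) g t.
Proof.
move=> ig xy; rewrite /prim (@Rintegral_itvB R g -oo%O (BRight y) x) //.
by apply: L1S ig.
Qed.

Lemma prim_small g (e : R) : L1 setT g -> 0 < e ->
  exists2 d : R, 0 < d & forall x y, x <= y -> y - x < d -> \int[mu]_(t in `]x, y]) `|g t| < e.
Proof.
move=> ig e0; have [d [d0 Hd]] := integral_normr_continuous ig e0.
exists d => // x y xy yx; apply: Hd => //=.
rewrite lebesgue_measure_itv /= lte_fin; case: ifPn => _; last by rewrite lte_fin.
by rewrite -EFinD lte_fin.
Qed.

Lemma cont_prim g : L1 setT g -> continuous (prim g).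
Proof.
move=> ig x; apply/cvgrPdist_lt => e e0.
have [d d0 Hd] := prim_small ig e0.
near=> y.
have yx : `|x - y| < d by near: y; exact: (nbhsx_ballx x d d0).
have key a b : a <= b -> `|a - b| < d -> `|prim g b - prim g a| < e.
  move=> ab h; rewrite primB //; apply: le_lt_trans (RintegralS_norm _ ig) _ => //.
  by apply: Hd => //; move: h; rewrite distrC ger0_norm // subr_ge0.
have [xy|xy] := leP x y.
  by rewrite distrC; exact: key.
by apply: key; [exact: ltW|rewrite distrC].
Unshelve. all: by end_near. Qed.

Lemma prim_ae g : L1 setT g -> {ae mu, forall x, derivable (prim g) x 1 /\ derive1 (prim g) x = g x}.
Proof.
move=> ig; apply: FTC1Ny; first by move=> y; exact: L1S ig.
split; [exact: L1_measurable ig|exact: openT|].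
move=> K _ cK; have /integrableP[_] := L1S measurableT (compact_measurable cK) (@subsetT _ K) ig.
by [].
Qed.

Lemma prim_abs_le g x y : L1 setT g -> x <= y ->
  `|prim g y - prim g x| <= prim (fun t => `|g t|) y - prim (fun t => `|g t|) x.
Proof.
move=> ig xy; rewrite !primB //; first exact: RintegralS_norm.
exact: L1_norm.
Qed.

Lemma L1_patchT D g : measurable D -> L1 D g -> L1 setT (g \_ D).
Proof. by move=> mD ig; rewrite /L1 -restrict_EFin; apply/(integrable_mkcond _ mD). Qed.

Lemma measurable_set_itv (i : interval R) : measurable ([set` i] : set TR).
Proof. exact: measurable_itv. Qed.
End Prim.
#[global] Hint Resolve measurable_I01 measurable_set_itv : core.

(** * Bumps and steps for testing weak derivatives *)

Section Bump.
Variable R : realType.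
Notation mu := (@lebesgue_measure R).
Notation TR := (measurableTypeR R).
Implicit Types (f g h : R -> R) (x y p d t : R) (D E : set TR).

Lemma Rint_eq0 D g : (forall t, D t -> g t = 0) -> \int[mu]_(t in D) g t = 0.
Proof.
move=> H; rewrite (@eq_Rintegral _ _ _ mu D (cst 0)); last by move=> t /set_mem /H.
by rewrite /Rintegral integral0.
Qed.

Lemma Rint_patch D E g : measurable D -> measurable E -> E `<=` D ->
  \int[mu]_(t in D) (g \_ E) t = \int[mu]_(t in E) g t.
Proof. by move=> mD mE ED; rewrite -Rintegral_mkcondr (setIidr ED). Qed.

Lemma L1_patchD D E g : measurable D -> measurable E -> L1 D g -> L1 D (g \_ E).
Proof.
move=> mD mE ig; rewrite /L1 -restrict_EFin; apply/integrable_restrict => //.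
apply: L1S ig => //; exact: measurableI.
Qed.

Lemma L1_cont_itv (a b : R) f : continuous f -> L1 `[a, b] f.
Proof. by move=> cf; apply: continuous_compact_integrable; [exact: segment_compact|exact: continuous_subspaceT]. Qed.

Lemma L1_cont_supp (a b : R) f : continuous f -> (forall t, t < a \/ b < t -> f t = 0) -> L1 setT f.
Proof.
move=> cf H; have -> : f = f \_ (`[a, b] : set R).
  apply/funext => t; rewrite patchE; case: ifPn => // /negP.
  rewrite inE /= in_itv /= => /negP; rewrite negb_and -!ltNge => /orP h; exact: H.
by apply: L1_patchT; [exact: measurable_set_itv|exact: L1_cont_itv].
Qed.

Lemma prim_cont_derive f t : L1 setT f -> continuous f -> derivable (prim f) t 1 /\ derive1 (prim f) t = f t.
Proof.
move=> If cf; have := @continuous_FTC1 R f -oo%O t (t + 1) (ltac:(by rewrite ltrDl)).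
by apply => //; [exact: L1S If|rewrite ltNyr|exact: cf].
Qed.

(** The integral of [s (d - s)] over [[0, d]] is [d^3 / 6], whence the constant. The primitive
    [step] is [C^1], the smoothness asked of test functions. *)
Definition bump x d t : R := 6 / d ^+ 3 * Num.max ((t - x) * (x + d - t)) 0.
Definition step x d : R -> R := prim (bump x d).

Lemma cont_bump x d : continuous (bump x d).
Proof. by rewrite /bump; cont. Qed.

Lemma bump_ge0 x d t : 0 < d -> 0 <= bump x d t.
Proof.
move=> d0; apply: mulr_ge0; last by rewrite le_max lexx orbT.
by rewrite divr_ge0 // exprn_ge0 // ltW.
Qed.

Lemma bump0 x d t : t <= x \/ x + d <= t -> 0 < d -> bump x d t = 0.
Proof.
move=> h d0; rewrite /bump max_r ?mulr0 //; case: h => h.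
  by rewrite mulr_le0_ge0; lra.
by rewrite mulr_ge0_le0; lra.
Qed.

Lemma L1_bump x d : 0 < d -> L1 setT (bump x d).
Proof.
move=> d0; apply: (@L1_cont_supp x (x + d)); first exact: cont_bump.
by move=> t h; apply: bump0 => //; case: h => /ltW; [left|right].
Qed.

Lemma int_bump x d : 0 < d -> \int[mu]_(t in `[x, x + d]) bump x d t = 1.
Proof.
move=> d0.
pose q : {poly R} := (6 / d ^+ 3) *: ((d / 2) *: ('X - x%:P) ^+ 2 - 3^-1 *: ('X - x%:P) ^+ 3).
have xd : x < x + d by rewrite ltrDl.
have dq t : (deriv q).[t] = 6 / d ^+ 3 * ((t - x) * (x + d - t)).
  by rewrite /q !poly.derivE !hornerE /=; field; rewrite gt_eqF.
have Dq t : derivable (fun t => q.[t]) t 1 /\ derive1 (fun t => q.[t]) t = (deriv q).[t].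
  have h := is_derive_poly q t; split; first by [].
  by rewrite derive1E; exact: derive_val.
rewrite /Rintegral (@continuous_FTC2 R (bump x d) (fun t => q.[t]) x (x + d) xd).
- by rewrite /= /q !hornerE /=; field; rewrite gt_eqF.
- by apply: continuous_subspaceT; exact: cont_bump.
- split.
  + by move=> t _; have [] := Dq t.
  + by apply: cvg_at_right_filter; apply: continuous_horner.
  + by apply: cvg_at_left_filter; apply: continuous_horner.
- move=> t; rewrite in_itv /= => /andP[t1 t2]; have [_ ->] := Dq t; rewrite dq /bump max_l //.
  by rewrite mulr_ge0 //; lra.
Qed.

Lemma step_left x d t : 0 < d -> t <= x -> step x d t = 0.
Proof.
move=> d0 tx; apply: Rint_eq0 => s /=; rewrite in_itv /= => st.
by apply: bump0 => //; left; exact: le_trans tx.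
Qed.

Lemma bump_int_sub x d t : 0 < d -> x + d <= t -> \int[mu]_(s in `]x, t]) bump x d s = 1.
Proof.
move=> d0 xt; rewrite -(int_bump x d0).
have I : L1 `]x, x + d] (bump x d) by apply: L1S (L1_bump x d0).
rewrite -Rintegral_itv_obnd_cbnd // -(Rint_patch (D := `]x, t]) (E := `]x, x + d])) //.
  apply: eq_Rintegral => s /set_mem /=; rewrite in_itv /= => /andP[xs st].
  rewrite patchE; case: ifPn => // /negP; rewrite inE /= in_itv /= xs /= => /negP; rewrite -ltNge => h.
  by apply: bump0 => //; right; exact: ltW.
by move=> s /=; rewrite !in_itv /=; move=> /andP[-> h]; exact: le_trans xt.
Qed.

Lemma step_right x d t : 0 < d -> x + d <= t -> step x d t = 1.
Proof.
move=> d0 xt; have := @primB R (bump x d) x t (L1_bump x d0) (ltac:(lra)).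
by rewrite -/(step x d) (step_left d0 (lexx x)) subr0 bump_int_sub.
Qed.

Lemma step_itv x d t : 0 < d -> 0 <= step x d t <= 1.
Proof.
move=> d0.
have mono s s' : s <= s' -> step x d s <= step x d s'.
  move=> ss; rewrite -subr_ge0 /step primB //; last exact: L1_bump.
  by apply: Rintegral_ge0 => r _; exact: bump_ge0.
have [tx|xt] := leP t x; first by rewrite step_left // lexx ler01.
rewrite -{1}(step_left d0 (lexx x)) (mono x t) ?(ltW xt) //=.
have [h|h] := leP t (x + d); last by rewrite step_right // ltW.
by rewrite -(step_right d0 (lexx (x + d))); exact: mono.
Qed.

Lemma bump_mean f x d e : 0 < d -> (`[x, x + d] `<=` @I01 R) -> L1 (@I01 R) f ->
  (forall t, x <= t <= x + d -> `|f t - f x| <= e) ->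
  `|\int[mu]_(t in @I01 R) (f t * bump x d t) - f x| <= e.
Proof.
move=> d0 sub If He.
have ib : L1 (@I01 R) (bump x d) by apply: L1S (L1_bump x d0).
have b1 : \int[mu]_(t in @I01 R) bump x d t = 1.
  rewrite -(int_bump x d0) -(Rint_patch (D := @I01 R) (E := `[x, x + d])) //.
  apply: eq_Rintegral => s _; rewrite patchE; case: ifPn => // /negP.
  rewrite inE /= in_itv /= => /negP; rewrite negb_and -!ltNge => /orP[h|h]; apply: bump0 => //; [left|right]; exact: ltW.
have [M HM] : exists M, forall t, `|bump x d t| <= M.
  exists (6 / d ^+ 3 * (d * d)) => t; rewrite ger0_norm ?bump_ge0 // /bump.
  apply: ler_wpM2l; first by rewrite divr_ge0 // exprn_ge0 // ltW.
  rewrite ge_max; apply/andP; split; last by rewrite mulr_ge0 // ltW.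
  have [h|h] := leP t x; first by apply: (@le_trans _ _ 0); [rewrite mulr_le0_ge0; lra|rewrite mulr_ge0 // ltW].
  have [h'|h'] := leP (x + d) t; first by apply: (@le_trans _ _ 0); [rewrite mulr_ge0_le0; lra|rewrite mulr_ge0 // ltW].
  by apply: ler_pM; lra.
have mb : measurable_fun (@I01 R) (bump x d) by exact: L1_measurable ib.
have ifb : L1 (@I01 R) (fun t => f t * bump x d t) by apply: (L1_mulb _ If mb) => // t _; exact: HM.
have icb : L1 (@I01 R) (fun t => f x * bump x d t) by exact: L1Z.
have -> : f x = \int[mu]_(t in @I01 R) (f x * bump x d t) by rewrite RintegralZl // b1 mulr1.
rewrite -RintegralB //; apply: le_trans (le_normr_Rintegral _ _) _ => //; first exact: L1B.
have -> : e = \int[mu]_(t in @I01 R) (e * bump x d t) by rewrite RintegralZl // b1 mulr1.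
apply: le_Rintegral => //; first by apply: L1_norm; exact: L1B.
  exact: L1Z.
move=> t _ /=; rewrite -mulrBl normrM (ger0_norm (bump_ge0 _ _ d0)).
have [h|h] := boolP (x <= t <= x + d); first by rewrite ler_wpM2r ?bump_ge0 ?He.
by rewrite bump0 ?mulr0 //; move: h; rewrite negb_and -!ltNge => /orP[h|h]; [left|right]; exact: ltW.
Qed.
End Bump.

Section WeakAC.
Variable R : realType.
Notation mu := (@lebesgue_measure R).
Notation TR := (measurableTypeR R).
Implicit Types (f g h : R -> R) (x y p d t : R) (D E : set TR).

Lemma within_eps f x e : {within @I01 R, continuous f} -> @I01 R x -> 0 < e ->
  exists2 d : R, 0 < d & forall t, `|t - x| <= d -> I01 t -> `|f t - f x| <= e.
Proof.
move=> cf Ix e0.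
have cx : {for x, continuous f}.
  move: cf; rewrite continuous_open_subspace; last exact: interval_open.
  by apply; exact/mem_set.
have /nbhs_ballP[d /= d0 Hd] : nbhs x (f @^-1` ball (f x) e).
  by apply: cx; exact: nbhsx_ballx.
exists (d / 2); first by rewrite divr_gt0.
move=> t h _; have := Hd t; rewrite /ball /= => H.
by rewrite distrC ltW // H // distrC (le_lt_trans h) // ltr_pdivrMr // ltr_pMr // ltr1n.
Qed.

Lemma I01P x : @I01 R x <-> 0 < x < 1.
Proof. by rewrite /I01 /= in_itv. Qed.

Lemma derive1_sub (u v : R -> R) t : derivable u t 1 -> derivable v t 1 ->
  derive1 (fun t => u t - v t) t = derive1 u t - derive1 v t.
Proof. by move=> du dv; rewrite !derive1E; exact: deriveB. Qed.

Lemma test_steps x y d : 0 < x -> x < y -> 0 < d -> y + d < 1 ->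
  test_fun (fun t => step x d t - step y d t) /\
  forall t, derive1 (fun t => step x d t - step y d t) t = bump x d t - bump y d t.
Proof.
move=> x0 xy d0 yd.
have D z t : derivable (step z d) t 1 /\ derive1 (step z d) t = bump z d t.
  exact: (@prim_cont_derive R (bump z d) t (L1_bump z d0) (@cont_bump _ z d)).
have dd t : derivable (fun t => step x d t - step y d t) t 1.
  exact: (derivableB (proj1 (D x t)) (proj1 (D y t))).
have de t : derive1 (fun t => step x d t - step y d t) t = bump x d t - bump y d t.
  by have [d1 <-] := D x t; have [d2 <-] := D y t; exact: derive1_sub.
split; last exact: de.
split; first exact: dd.
split.
  have -> : derive1 (fun t => step x d t - step y d t) = (fun t => bump x d t - bump y d t) by apply/funext; exact: de.
  by apply: contB; exact: cont_bump.
exists x, (y + d); split; [exact: x0|lra|exact: yd|].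
move=> t [tx|yt]; first by rewrite !step_left ?subrr //; lra.
by rewrite !step_right ?subrr //; lra.
Qed.

(** The trapezoid [step x d - step y d] differs from the indicator of []x, y]] only on []x, x + d]]
    and []y, y + d]], by at most 1. *)
Lemma step_test_int g x y d e : 0 < x -> x < y -> 0 < d -> x + d <= y -> y + d < 1 -> L1 (@I01 R) g ->
  \int[mu]_(t in `]x, x + d]) `|(g \_ (@I01 R)) t| <= e -> \int[mu]_(t in `]y, y + d]) `|(g \_ (@I01 R)) t| <= e ->
  `|\int[mu]_(t in @I01 R) (g t * (step x d t - step y d t)) - \int[mu]_(t in `]x, y]) (g \_ (@I01 R)) t| <= e + e.
Proof.
move=> x0 xy d0 xd yd Ig h1 h2.
set g0 := g \_ (@I01 R) in h1 h2 *.
have Ig0 : L1 (@I01 R) g0 by exact: L1_patchD.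
have sub a b : 0 < a -> b < 1 -> `]a, b] `<=` @I01 R.
  by move=> a0 b1 t /=; rewrite /I01 /= !in_itv /= => /andP[h h']; rewrite (lt_trans a0 h) (le_lt_trans h' b1).
have cs z : continuous (step z d) by apply: cont_prim; exact: L1_bump.
have ms z : measurable_fun (@I01 R) (step z d).
  by apply: measurable_funS (continuous_measurable_fun (cs z)).
pose psi t := step x d t - step y d t.
have mpsi : measurable_fun (@I01 R) psi by exact: measurable_funB.
have psib t : `|psi t| <= 1.
  have /andP[a b] := step_itv x t d0; have /andP[a' b'] := step_itv y t d0.
  by rewrite /psi ler_norml; apply/andP; split; lra.
have I1 : L1 (@I01 R) (fun t => g0 t * psi t) by apply: (L1_mulb (M := 1)).
have I2 : L1 (@I01 R) (g0 \_ (`]x, y] : set R)) by apply: L1_patchD.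
have Ia a b : 0 < a -> b < 1 -> L1 (@I01 R) ((fun t => `|g0 t|) \_ (`]a, b] : set R)).
  by move=> a0 b1; apply: L1_patchD => //; exact: L1_norm.
have -> : \int[mu]_(t in @I01 R) (g t * (step x d t - step y d t)) = \int[mu]_(t in @I01 R) (g0 t * psi t).
  by apply: eq_Rintegral => t tI; rewrite /g0 patchE tI.
rewrite -(Rint_patch (D := @I01 R) (E := `]x, y])) //; last by apply: sub => //; lra.
rewrite -RintegralB //; apply: le_trans (le_normr_Rintegral _ _) _ => //; first exact: L1B.
apply: (@le_trans _ _ (\int[mu]_(t in @I01 R) (((fun t => `|g0 t|) \_ (`]x, x + d] : set R)) t + ((fun t => `|g0 t|) \_ (`]y, y + d] : set R)) t))).
  apply: le_Rintegral => //; first by apply: L1_norm; exact: L1B.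
    by apply: L1D => //; apply: Ia => //; lra.
  move=> t _ /=; rewrite !patchE.
  have inE' (a b s : R) : (s \in (`]a, b]%classic : set R)) = (a < s <= b).
    by apply/idP/idP; rewrite inE /= in_itv.
  rewrite !inE'.
  have n0 : 0 <= `|g0 t| by [].
  have [tx|xt] := leP t x.
    rewrite /psi !step_left //=; [|lra]; rewrite subrr mulr0 subr0 normr0.
    by case: ifP => _; [rewrite add0r|rewrite addr0].
  have [txd|xdt] := leP t (x + d).
    have -> : (y < t <= y + d) = false by apply/negbTE; rewrite negb_and -!ltNge; apply/orP; left; rewrite -leNgt; lra.
    have -> : (t <= y) by lra.
    rewrite /= addr0 /psi (step_left (x := y)) ?subr0; [|by []|lra].
    rewrite -{2}[g0 t]mulr1 -mulrBr normrM ler_piMr //.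
    by have /andP[a b] := step_itv x t d0; rewrite ler_norml; apply/andP; split; lra.
  rewrite /= /psi (step_right d0 (ltW xdt)).
  have [ty|yt] := leP t y.
    by rewrite step_left // subr0 mulr1 subrr normr0 /= addr0.
  rewrite subr0; have [tyd|ydt] := leP t (y + d).
    rewrite /= add0r normrM ler_piMr //.
    by have /andP[a b] := step_itv y t d0; rewrite ler_norml; apply/andP; split; lra.
  by rewrite (step_right d0 (ltW ydt)) subrr mulr0 normr0 /= addr0.
rewrite RintegralD //; [|by apply: Ia => //; lra|by apply: Ia => //; lra].
by rewrite !Rint_patch //; [apply: lerD|apply: sub => //; lra|apply: sub => //; lra].
Qed.

Lemma close_enough (A B C G fx fy e : R) : `|A - fx| <= e / 4 -> `|B - fy| <= e / 4 -> `|C - G| <= e / 4 + e / 4 ->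
  A - B = - C -> `|fy - fx - G| <= e.
Proof. by rewrite !ler_norml => /andP[? ?] /andP[? ?] /andP[? ?] ?; apply/andP; split; lra. Qed.

(** The weak derivative is tested against the trapezoid [step x d - step y d], whose derivative is a
    difference of two bumps. As [d] tends to 0 the bumps evaluate the continuous [f] at [x] and [y],
    while the trapezoid integrates [g] over []x, y]]. *)
Lemma weak_AC p f g x y : 1 <= p -> {within @I01 R, continuous f} -> W1p_pair p f g ->
  0 < x -> x <= y -> y < 1 ->
  f y - f x = prim (g \_ (@I01 R)) y - prim (g \_ (@I01 R)) x.
Proof.
move=> p1 cf [/(isLp_L1 p1) If /(isLp_L1 p1) Ig wd] x0; rewrite le_eqVlt => /orP[/eqP ->|xy] y1.
  by rewrite !subrr.
have Ig0 := L1_patchT (@measurable_I01 R) Ig.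
have Ix : @I01 R x by apply/I01P; lra.
have Iy : @I01 R y by apply/I01P; lra.
apply/eqP; rewrite -subr_eq0 -normr_le0; apply/ler_addgt0Pr => e e0; rewrite add0r.
have e4 : 0 < e / 4 by rewrite divr_gt0.
have [d1 d10 H1] := within_eps cf Ix e4.
have [d2 d20 H2] := within_eps cf Iy e4.
have [d3 d30 H3] := prim_small Ig0 e4.
pose d := Num.min (Num.min d1 d2) (Num.min (d3 / 2) (Num.min (y - x) ((1 - y) / 2))).
have d0 : 0 < d.
  rewrite lt_min lt_min d10 d20 /= lt_min divr_gt0 //= lt_min subr_gt0 xy /= divr_gt0 // subr_gt0 //.
have [l1 l2 l3 l4 l5] : [/\ d <= d1, d <= d2, d <= d3 / 2, d <= y - x & d <= (1 - y) / 2].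
  by split; rewrite /d !ge_min lexx ?orbT.
have xd : x + d <= y by lra.
have yd : y + d < 1 by lra.
have [tf dE] := test_steps x0 xy d0 yd.
have sub z : 0 < z -> z + d < 1 -> `[z, z + d] `<=` @I01 R.
  by move=> z0 z1 t /=; rewrite in_itv /= => /andP[a b]; apply/I01P; lra.
have ib z : L1 (@I01 R) (bump z d) by apply: L1S (L1_bump z d0).
have := wd _ tf.
have -> : \int[mu]_(t in @I01 R) (f t * derive1 (fun t => step x d t - step y d t) t) =
   \int[mu]_(t in @I01 R) (f t * bump x d t) - \int[mu]_(t in @I01 R) (f t * bump y d t).
  have bb z : exists M, forall t, `|bump z d t| <= M.
    have cK : compact (`[z, z + d] : set R) by exact: segment_compact.
    have [c _ Hc] := @EVT_max R (bump z d) z (z + d) (ltac:(lra)) (continuous_subspaceT (@cont_bump _ z d)).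
    exists (bump z d c) => t; rewrite ger0_norm ?bump_ge0 //.
    have [h|h] := boolP (t \in `[z, z + d]); first exact: Hc.
    rewrite bump0 ?bump_ge0 //; move: h; rewrite in_itv /= negb_and -!ltNge => /orP[h|h]; [left|right]; exact: ltW.
  have ifb z : L1 (@I01 R) (fun t => f t * bump z d t).
    by have [M HM] := bb z; apply: (L1_mulb (M := M)) => //; exact: L1_measurable (ib z).
  rewrite -(RintegralB (@measurable_I01 R) (ifb x) (ifb y)). apply: eq_Rintegral => t _. rewrite dE. ring.
have m1 : `|\int[mu]_(t in @I01 R) (f t * bump x d t) - f x| <= e / 4.
  apply: bump_mean => //; first by apply: sub => //; lra.
  move=> t /andP[a b]; apply: H1; first by rewrite ger0_norm; lra.
  by apply/I01P; apply/andP; split; lra.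
have m2 : `|\int[mu]_(t in @I01 R) (f t * bump y d t) - f y| <= e / 4.
  apply: bump_mean => //; first by apply: sub => //; lra.
  move=> t /andP[a b]; apply: H2; first by rewrite ger0_norm; lra.
  by apply/I01P; apply/andP; split; lra.
move=> E.
have h1 : \int[mu]_(t in `]x, x + d]) `|(g \_ (@I01 R)) t| <= e / 4 by apply: ltW; apply: H3; lra.
have h2 : \int[mu]_(t in `]y, y + d]) `|(g \_ (@I01 R)) t| <= e / 4 by apply: ltW; apply: H3; lra.
have m3 := step_test_int x0 xy d0 xd yd Ig h1 h2.
rewrite (primB Ig0 (ltW xy)).
exact: close_enough m1 m2 m3 E.
Qed.
End WeakAC.

(** * Weak derivatives of piecewise affine functions *)

Section Sobolev.
Variable R : realType.
Notation mu := (@lebesgue_measure R).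
Notation TR := (measurableTypeR R).
Implicit Types (f g h psi : R -> R) (x y t : R) (D E : set TR).

Lemma powR_addle (p x y : R) : 1 <= p -> `|x + y| `^ p <= 2 `^ p * (`|x| `^ p + `|y| `^ p).
Proof.
move=> p1; have p0 : 0 <= p by lra.
pose m := Num.max `|x| `|y|.
have m0 : 0 <= m by rewrite le_max normr_ge0.
have h1 : `|x + y| <= 2 * m.
  apply: (le_trans (ler_normD _ _)).
  have : `|x| <= m by rewrite le_max lexx.
  have : `|y| <= m by rewrite le_max lexx orbT.
  lra.
apply: (@le_trans _ _ ((2 * m) `^ p)).
  by apply: ge0_ler_powR => //; rewrite nnegrE // mulr_ge0.
rewrite powRM // ler_wpM2l ?powR_ge0 //.
by rewrite /m; case: (leP `|x| `|y|) => _; rewrite ?lerDl ?lerDr powR_ge0.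
Qed.

Lemma isLp_meas p f : isLp p f -> measurable_fun (@I01 R : set TR) f.
Proof. by case. Qed.

Lemma measurable_powp p f D : measurable_fun D f -> measurable_fun D (fun x => `|f x| `^ p).
Proof.
move=> mf; apply: (@measurableT_comp _ _ _ _ _ _ (@powR R ^~ p)) => //.
exact: measurableT_comp.
Qed.

Lemma isLp_lin p (a : R) f g : 1 <= p -> isLp p f -> isLp p g -> isLp p (fun x => a * f x + g x).
Proof.
move=> p1 lf lg; have mf := isLp_meas lf; have mg := isLp_meas lg.
have m : measurable_fun (@I01 R : set TR) (fun x => a * f x + g x).
  by apply: measurable_funD => //; exact: measurable_funM.
apply: powR_isLp => //.
have I := isLp_powR p1 lf; have J := isLp_powR p1 lg.
apply: (@L1_le _ _ _ (fun x => 2 `^ p * (`|a| `^ p * `|f x| `^ p + `|g x| `^ p))) => //.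
- exact: measurable_powp.
- move=> x _; rewrite ger0_norm ?powR_ge0 //; apply: (le_trans (powR_addle _ _ p1)).
  by rewrite normrM powRM.
- by apply: L1Z => //; apply: L1D => //; exact: L1Z.
Qed.

Lemma bounded_isLp p f (M : R) : 0 <= p -> measurable_fun (@I01 R : set TR) f -> (forall x, I01 x -> `|f x| <= M) -> isLp p f.
Proof.
move=> p0 mf fM; apply: powR_isLp => //.
apply: (@L1_le _ _ _ (cst (M `^ p))) => //; [exact: measurable_powp| |exact: L1_cst01].
move=> x Ix; rewrite ger0_norm ?powR_ge0 //; apply: ge0_ler_powR => //; rewrite ?nnegrE //.
  by apply: le_trans (fM x Ix).
exact: fM.
Qed.

Lemma cont_bounded01 h : continuous h -> exists M, forall t, 0 <= t <= 1 -> `|h t| <= M.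
Proof.
move=> ch; have cn : continuous (fun t => `|h t|).
  by move=> t; apply: cvg_norm; exact: ch.
have [c _ Hc] := @EVT_max R (fun t => `|h t|) 0 1 ler01 (continuous_subspaceT cn).
by exists `|h c| => t t01; apply: Hc; rewrite in_itv.
Qed.

Lemma I01_cc t : @I01 R t -> 0 <= t <= 1.
Proof. by move=> /I01P /andP[/ltW -> /ltW ->]. Qed.

Lemma cont_meas h D : continuous h -> measurable_fun D h.
Proof. by move=> ch; apply: measurable_funS (continuous_measurable_fun ch). Qed.

Lemma L1_mul_cont f h : L1 (@I01 R) f -> continuous h -> L1 (@I01 R) (fun t => f t * h t).
Proof.
move=> If ch; have [M HM] := cont_bounded01 ch.
apply: (L1_mulb (M := M)) => //; first exact: cont_meas.
by move=> t /I01_cc; exact: HM.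
Qed.

Lemma test_cont psi : test_fun psi -> continuous psi.
Proof.
case=> d _ t; apply: differentiable_continuous.
by apply/derivable1_diffP; exact: d.
Qed.

Lemma weak_deriv_lin (a : R) f1 g1 f2 g2 : L1 (@I01 R) f1 -> L1 (@I01 R) g1 -> L1 (@I01 R) f2 -> L1 (@I01 R) g2 ->
  weak_deriv f1 g1 -> weak_deriv f2 g2 -> weak_deriv (fun t => a * f1 t + f2 t) (fun t => a * g1 t + g2 t).
Proof.
move=> If1 Ig1 If2 Ig2 w1 w2 psi tp.
have cp := test_cont tp; have cp' : continuous (derive1 psi) by case: tp => _ [].
have e1 := w1 _ tp; have e2 := w2 _ tp.
have J1 := L1_mul_cont If1 cp'; have J2 := L1_mul_cont If2 cp'.
have K1 := L1_mul_cont Ig1 cp; have K2 := L1_mul_cont Ig2 cp.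
have E f f' h : L1 (@I01 R) (fun t => f t * h t) -> L1 (@I01 R) (fun t => f' t * h t) ->
   \int[mu]_(t in @I01 R) ((a * f t + f' t) * h t) = a * \int[mu]_(t in @I01 R) (f t * h t) + \int[mu]_(t in @I01 R) (f' t * h t).
  move=> i1 i2; rewrite -(RintegralZl a (@measurable_I01 R) i1) -(RintegralD (@measurable_I01 R) (L1Z a (@measurable_I01 R) i1) i2).
  by apply: eq_Rintegral => t _; rewrite mulrDl mulrA.
by rewrite (E _ _ _ J1 J2) (E _ _ _ K1 K2) e1 e2 opprD mulrN.
Qed.

Lemma W1p_pair_lin p (a : R) f1 g1 f2 g2 : 1 <= p -> W1p_pair p f1 g1 -> W1p_pair p f2 g2 ->
  W1p_pair p (fun t => a * f1 t + f2 t) (fun t => a * g1 t + g2 t).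
Proof.
move=> p1 [lf1 lg1 w1] [lf2 lg2 w2]; split; [exact: isLp_lin|exact: isLp_lin|].
by apply: weak_deriv_lin => //; exact: (isLp_L1 p1).
Qed.

Lemma Rint_split g (a b c : R) : L1 `]a, c] g -> a <= b -> b <= c ->
  \int[mu]_(t in `]a, c]) g t = \int[mu]_(t in `]a, b]) g t + \int[mu]_(t in `]b, c]) g t.
Proof.
move=> ig ab bc; have := @Rintegral_itvB R g (BRight a) (BRight c) b ig.
by rewrite !bnd_simp => /(_ ab bc) <-; rewrite subrKC.
Qed.

Lemma L1_cont_oc (a b : R) f : continuous f -> L1 `]a, b] f.
Proof.
move=> cf; apply: L1S (L1_cont_itv a b cf) => //.
by move=> t /=; rewrite !in_itv /= => /andP[/ltW -> ->].
Qed.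

Lemma FTC_oc (F : R -> R) (a b : R) : (forall t, derivable F t 1) -> continuous (derive1 F) -> a <= b ->
  \int[mu]_(t in `]a, b]) derive1 F t = F b - F a.
Proof.
move=> dF cF; rewrite le_eqVlt => /orP[/eqP ->|ab].
  by rewrite set_itv_ge ?bnd_simp ?ltxx // Rintegral_set0 subrr.
have cFF : continuous F by move=> t; apply: differentiable_continuous; apply/derivable1_diffP; exact: dF.
rewrite Rintegral_itv_obnd_cbnd; last exact: L1_cont_oc.
have cs : {within `[a, b], continuous (derive1 F)} by exact: continuous_subspaceT.
have dLR : derivable_oo_LRcontinuous F a b.
  split; first by move=> t _; exact: dF.
  + by apply: cvg_at_right_filter; exact: cFF.
  + by apply: cvg_at_left_filter; exact: cFF.
by rewrite /Rintegral (continuous_FTC2 ab cs dLR (fun t _ => erefl)).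
Qed.

Lemma I01_oc g : L1 (@I01 R) g -> \int[mu]_(t in @I01 R) g t = \int[mu]_(t in `]0, 1]) g t.
Proof. by move=> ig; rewrite -Rintegral_itv_bndo_bndc. Qed.

Definition clampf (a b t : R) : R := Num.min (Num.max t a) b.
Definition indf (a b t : R) : R := if a < t <= b then 1 else 0.

Lemma cont_clampf a b : continuous (clampf a b).
Proof. by rewrite /clampf; cont. Qed.

Lemma meas_indf a b D : measurable_fun D (indf a b).
Proof.
have -> : indf a b = \1_(`]a, b]%classic : set R).
  by apply/funext => t; rewrite indicE mem_setE in_itv /indf /=; case: ifP.
exact: measurable_indic.
Qed.

Lemma indf_patch a b h : (fun t => indf a b t * h t) = h \_ (`]a, b] : set R).
Proof.
apply/funext => t; rewrite patchE mem_setE in_itv /indf /=.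
by case: ifP => _; rewrite ?mul1r ?mul0r.
Qed.

Lemma test_boundary psi : test_fun psi -> psi 0 = 0 /\ psi 1 = 0.
Proof.
case=> _ [_ [a [b [a0 ab b1 H]]]]; split; apply: H; [left|right] => //.
Qed.

Lemma derive1_idM psi t : derivable psi t 1 -> derivable (fun s : R => s * psi s) t 1 /\
  derive1 (fun s : R => s * psi s) t = psi t + t * derive1 psi t.
Proof.
move=> dp; have did : derivable (@id R) t 1 by exact: derivable_id.
split; first exact: (derivableM did dp).
rewrite !derive1E; have := deriveM did dp; rewrite derive_id => ->.
by rewrite /GRing.scale /= mulr1 addrC.
Qed.

(** Integration by parts on []a, b]], where the function is the identity. On the outer intervals it
    is constant, and all boundary terms cancel because [psi] vanishes at 0 and 1. *)
Lemma weak_deriv_clamp a b : 0 <= a -> a <= b -> b <= 1 -> weak_deriv (clampf a b) (indf a b).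
Proof.
move=> a0 ab b1 psi tp.
have cp := test_cont tp; have dp : forall t, derivable psi t 1 by case: tp.
have cp' : continuous (derive1 psi) by case: tp => _ [].
have [p0 p1] := test_boundary tp.
have cc : continuous (fun t => clampf a b t * derive1 psi t) by apply: contM => //; exact: cont_clampf.
have I01c h : continuous h -> L1 (@I01 R) h.
  move=> ch; apply: L1S (L1_cont_oc 0 1 ch) => //.
  by move=> t /I01P /andP[l0 l1]; rewrite /= in_itv /= l0 ltW.
rewrite I01_oc; last exact: I01c.
rewrite (@Rint_split _ 0 a 1) //; [|exact: L1_cont_oc|lra].
rewrite (@Rint_split _ a b 1) //; last exact: L1_cont_oc.
have e1 : \int[mu]_(t in `]0, a]) (clampf a b t * derive1 psi t) = a * psi a.
  rewrite (@eq_Rintegral _ _ _ mu _ (fun t => a * derive1 psi t)); last first.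
    move=> t /set_mem /=; rewrite in_itv /= => /andP[_ ta].
    by rewrite /clampf max_r // min_l.
  by rewrite RintegralZl //; [rewrite FTC_oc // p0 subr0|exact: L1_cont_oc].
have e3 : \int[mu]_(t in `]b, 1]) (clampf a b t * derive1 psi t) = - b * psi b.
  rewrite (@eq_Rintegral _ _ _ mu _ (fun t => b * derive1 psi t)); last first.
    move=> t /set_mem /=; rewrite in_itv /= => /andP[bt _].
    by rewrite /clampf max_l ?min_r //; [exact: ltW|lra].
  by rewrite RintegralZl //; [rewrite FTC_oc // p1 sub0r mulrN mulNr|exact: L1_cont_oc].
have cid : continuous (fun t : R => t) by exact: cont_id.
have e2 : \int[mu]_(t in `]a, b]) (clampf a b t * derive1 psi t) = b * psi b - a * psi a - \int[mu]_(t in `]a, b]) psi t.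
  have D t := derive1_idM (dp t).
  have E : derive1 (fun s : R => s * psi s) = (fun t => psi t + t * derive1 psi t).
    by apply/funext => t; have [] := D t.
  have cE : continuous (derive1 (fun s : R => s * psi s)).
    by rewrite E; apply: contD => //; exact: contM.
  rewrite -(@FTC_oc (fun s : R => s * psi s) a b _ cE ab); last by move=> t; have [] := D t.
  rewrite -RintegralB //; [|exact: L1_cont_oc|exact: L1_cont_oc].
  apply: eq_Rintegral => t /set_mem /=; rewrite in_itv /= => /andP[at_ tb].
  by rewrite E /clampf max_l ?min_l //; [ring|exact: ltW].
rewrite e1 e2 e3.
have -> : \int[mu]_(t in @I01 R) (indf a b t * psi t) = \int[mu]_(t in `]a, b]) psi t.
  have Iip : L1 (@I01 R) (fun t => indf a b t * psi t).
    by rewrite indf_patch; apply: L1_patchD => //; exact: I01c.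
  rewrite I01_oc // indf_patch Rint_patch //.
  by move=> t /=; rewrite !in_itv /= => /andP[h h']; rewrite (le_lt_trans a0 h) (le_trans h' b1).
ring.
Qed.

Lemma weak_deriv_cst (c : R) : weak_deriv (fun=> c) (fun=> 0).
Proof.
move=> psi tp; have dp : forall t, derivable psi t 1 by case: tp.
have cp' : continuous (derive1 psi) by case: tp => _ [].
have [p0 p1] := test_boundary tp.
have I1 : L1 (@I01 R) (derive1 psi).
  apply: L1S (L1_cont_oc 0 1 cp') => //.
  by move=> t /I01P /andP[l0 l1]; rewrite /= in_itv /= l0 ltW.
rewrite RintegralZl // I01_oc // FTC_oc // p0 p1 subrr mulr0.
by rewrite (Rint_eq0 (fun t _ => mul0r _)) oppr0.
Qed.

(** Piecewise affine interpolation as a sum of clamps: each summand grows on its own piece and then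
    stays at the increment [w i.+1 - w i]. Weak differentiability follows by linearity, without
    gluing pieces. *)
Definition interp (N : nat) (T w : nat -> R) (t : R) : R := w 0%N + \sum_(i < N) slope T w i * (clampf (T i) (T i.+1) t - T i).
Definition dinterp (N : nat) (T w : nat -> R) (t : R) : R := \sum_(i < N) slope T w i * indf (T i) (T i.+1) t.

Lemma W1p_interp p N T w : 1 <= p -> (forall i, (i < N)%N -> T i < T i.+1) -> (forall i, (i <= N)%N -> 0 <= T i <= 1) ->
  W1p_pair p (interp N T w) (dinterp N T w).
Proof.
move=> p1 Tlt T01; have p0 : 0 <= p by lra.
have cst_pair c : W1p_pair p (fun=> c) (fun=> 0).
  split; [| |exact: weak_deriv_cst].
    by apply: (bounded_isLp (M := `|c|)) => //; exact: measurable_cst.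
  by apply: (bounded_isLp (M := 0)) => [//||x _]; [exact: measurable_cst|rewrite normr0].
have clamp_pair a b : 0 <= a -> a <= b -> b <= 1 -> W1p_pair p (fun t => clampf a b t) (indf a b).
  move=> a0 ab b1; split; last exact: weak_deriv_clamp.
    have [M HM] := cont_bounded01 (@cont_clampf a b).
    apply: (bounded_isLp (M := M)) => //; first by apply: cont_meas; exact: cont_clampf.
    by move=> x /I01_cc; exact: HM.
  apply: (bounded_isLp (M := 1)) => //; first exact: meas_indf.
  by move=> x _; rewrite /indf; case: ifP => _; rewrite ?normr0 ?normr1.
elim: N Tlt T01 => [|N IH] Tlt T01.
  have -> : interp 0 T w = (fun=> w 0%N) by apply/funext => t; rewrite /interp big_ord0 addr0.
  have -> : dinterp 0 T w = (fun=> 0) by apply/funext => t; rewrite /dinterp big_ord0.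
  exact: cst_pair.
have {}IH := IH (fun i iN => Tlt i (leqW iN)) (fun i iN => T01 i (leqW iN)).
have -> : interp N.+1 T w = (fun t => slope T w N * clampf (T N) (T N.+1) t + (1 * interp N T w t + (- slope T w N * T N))).
  by apply/funext => t; rewrite /interp big_ord_recr /=; ring.
have -> : dinterp N.+1 T w = (fun t => slope T w N * indf (T N) (T N.+1) t + (1 * dinterp N T w t + 0)).
  by apply/funext => t; rewrite /dinterp big_ord_recr /=; ring.
have /andP[t0 _] := T01 N (leqnSn _); have /andP[_ t1] := T01 N.+1 (leqnn _).
apply: W1p_pair_lin => //; first by apply: clamp_pair => //; exact: ltW (Tlt _ (ltnSn _)).
by apply: W1p_pair_lin.
Qed.

Lemma cont_interp N T w : continuous (interp N T w).
Proof.
elim: N => [|N IH].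
  have -> : interp 0 T w = (fun=> w 0%N) by apply/funext => t; rewrite /interp big_ord0 addr0.
  exact: contC.
have -> : interp N.+1 T w = (fun t => slope T w N * clampf (T N) (T N.+1) t + (interp N T w t + (- slope T w N * T N))).
  by apply/funext => t; rewrite /interp big_ord_recr /=; ring.
have := @cont_clampf (T N) (T N.+1) => c; cont.
Qed.

Lemma T_mono (N : nat) (T : nat -> R) : (forall i, (i < N)%N -> T i < T i.+1) ->
  forall i j, (i <= j)%N -> (j <= N)%N -> T i <= T j.
Proof.
move=> Tlt i; elim=> [|j IH]; first by rewrite leqn0 => /eqP ->.
rewrite leq_eqVlt => /orP[/eqP -> //|ij] jN.
by apply: le_trans (IH ij (ltnW jN)) (ltW (Tlt _ jN)).
Qed.

Lemma interp_piece N T w k t : (forall i, (i < N)%N -> T i < T i.+1) -> (k < N)%N -> T k <= t <= T k.+1 ->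
  interp N T w t = w k + slope T w k * (t - T k).
Proof.
move=> Tlt kN /andP[t1 t2]; have Tm := T_mono Tlt.
have ds i : (i < N)%N -> slope T w i * (T i.+1 - T i) = w i.+1 - w i.
  by move=> iN; rewrite /slope divfK // gt_eqF // subr_gt0 Tlt.
have low n : (n <= k)%N -> \sum_(i < n) slope T w i * (clampf (T i) (T i.+1) t - T i) = w n - w 0%N.
  elim: n => [|n IH] nk; first by rewrite big_ord0 subrr.
  rewrite big_ord_recr /= IH ?(ltnW nk) //.
  have nN : (n < N)%N by exact: ltn_trans nk kN.
  have h : T n.+1 <= t by apply: le_trans t1; apply: Tm => //; exact: ltnW.
  rewrite /clampf max_l; last by apply: le_trans h; apply: ltW; exact: Tlt.
  by rewrite min_r // ds //; ring.
have high n : (k < n)%N -> (n <= N)%N -> \sum_(i < n) slope T w i * (clampf (T i) (T i.+1) t - T i) = w k - w 0%N + slope T w k * (t - T k).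
  elim: n => [//|n IH]; rewrite ltnS leq_eqVlt => /orP[/eqP E|kn] nN.
    subst n; rewrite big_ord_recr /= low // /clampf max_l ?min_l //.
  rewrite big_ord_recr /= IH ?(ltnW nN) //.
  have h : t <= T n by apply: (le_trans t2); apply: Tm => //; exact: ltnW.
  rewrite /clampf max_r // min_l; last by apply: ltW; exact: Tlt.
  by rewrite subrr mulr0 addr0.
by rewrite /interp (high N) //; ring.
Qed.

Lemma dinterp_piece N T w k t : (forall i, (i < N)%N -> T i < T i.+1) -> (k < N)%N -> T k < t <= T k.+1 ->
  dinterp N T w t = slope T w k.
Proof.
move=> Tlt kN /andP[t1 t2]; have Tm := T_mono Tlt.
rewrite /dinterp (bigD1 (Ordinal kN)) //= big1 ?addr0; first by rewrite /indf t1 t2 mulr1.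
move=> [i iN] /= ne; rewrite /indf; case: ifP => [/andP[a b]|_]; last by rewrite mulr0.
have {}ne : i != k by apply: contra ne => /eqP E; apply/eqP/val_inj.
exfalso; have [ik|ki|E] := ltngtP i k; last by rewrite E eqxx in ne.
  by have := Tm i.+1 k ik (ltnW kN); rewrite leNgt (lt_le_trans t1 b).
by have := Tm k.+1 i ki (ltnW iN); rewrite leNgt (lt_le_trans a t2).
Qed.
End Sobolev.

(** * Sobolev norms, suprema and strong convergence *)

Section Norms.
Variable R : realType.
Notation mu := (@lebesgue_measure R).
Notation TR := (measurableTypeR R).
Implicit Types (f g h : R -> R) (phi dphi psi : map2 R) (x y t p : R) (D E : set TR).

(** The p-th power of the [L^p] norm as a real number. *)
Definition lp p f : R := \int[mu]_(t in @I01 R) (`|f t| `^ p).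

Lemma lp_ge0 p f : 0 <= lp p f.
Proof. by apply: Rintegral_ge0 => t _; exact: powR_ge0. Qed.

Lemma lpintE p f : 1 <= p -> isLp p f -> lpint p f = (lp p f)%:E.
Proof.
move=> p1 lf; rewrite /lp /Rintegral fineK //.
exact: (integrable_fin_num (@measurable_I01 R) (isLp_powR p1 lf)).
Qed.

Definition lp2 p phi dphi : R := lp p (comp1 phi) + lp p (comp2 phi) + lp p (comp1 dphi) + lp p (comp2 dphi).

Lemma W1p_normE p phi dphi : 1 <= p -> W1p_with p phi dphi -> W1p_norm p phi dphi = lp2 p phi dphi `^ p^-1.
Proof.
move=> p1 [_ [a b _] [c d _]].
by rewrite /W1p_norm !lpintE.
Qed.

Lemma lp2_ge0 p phi dphi : 0 <= lp2 p phi dphi.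
Proof. by rewrite /lp2 !addr_ge0 ?lp_ge0. Qed.

Lemma lp2_comp p phi dphi : [/\ lp p (comp1 phi) <= lp2 p phi dphi, lp p (comp2 phi) <= lp2 p phi dphi,
  lp p (comp1 dphi) <= lp2 p phi dphi & lp p (comp2 dphi) <= lp2 p phi dphi].
Proof.
have h1 := lp_ge0 p (comp1 phi); have h2 := lp_ge0 p (comp2 phi).
have h3 := lp_ge0 p (comp1 dphi); have h4 := lp_ge0 p (comp2 dphi).
rewrite /lp2; move: h1 h2 h3 h4; move: (lp p (comp1 phi)) (lp p (comp2 phi)) (lp p (comp1 dphi)) (lp p (comp2 dphi)).
by move=> a b c d *; split; lra.
Qed.

Lemma powR_invK p x : 1 <= p -> 0 <= x -> (x `^ p^-1) `^ p = x.
Proof.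
move=> p1 x0; have pn : p != 0 by rewrite gt_eqF // (lt_le_trans ltr01).
by rewrite -powRrM (mulVf pn) powRr1.
Qed.

Lemma powR_inv_le p x y : 1 <= p -> 0 <= x -> 0 <= y -> x <= y `^ p -> x `^ p^-1 <= y.
Proof.
move=> p1 x0 y0 h; have pn : p != 0 by rewrite gt_eqF // (lt_le_trans ltr01).
have -> : y = (y `^ p) `^ p^-1 by rewrite -powRrM (mulfV pn) powRr1.
apply: ge0_ler_powR => //; rewrite ?nnegrE ?powR_ge0 //.
by rewrite invr_ge0; lra.
Qed.

(** The inequality [x <= 1 + x^p], rescaled by [lam], gives [|f| <= lam + lam (|f| / lam)^p]. The
    norm itself is the right [lam]; when it vanishes, every positive [lam] is admissible. *)
Lemma L1_le_lp p f : 1 <= p -> isLp p f -> \int[mu]_(t in @I01 R) `|f t| <= 2 * (lp p f) `^ p^-1.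
Proof.
move=> p1 lf; have If := isLp_powR p1 lf; have I1 := L1_norm (isLp_L1 p1 lf).
have p0 : 0 <= p by lra.
have mI : fine (mu (@I01 R)) = 1 by rewrite mu_I01.
have key lam : 0 < lam -> \int[mu]_(t in @I01 R) `|f t| <= lam + lam / lam `^ p * lp p f.
  move=> l0.
  have -> : lam + lam / lam `^ p * lp p f = \int[mu]_(t in @I01 R) (lam + lam / lam `^ p * (`|f t| `^ p)).
    rewrite RintegralD //; [|exact: L1_cst01|exact: L1Z].
    by rewrite RintegralZl // Rintegral_cst // [X in fine X]mu_I01 mulr1.
  apply: le_Rintegral => //.
    by apply: L1D; [exact: measurable_I01|exact: L1_cst01|exact: L1Z].
  move=> t _; have h := @powR_ge_id R (`|f t| / lam) p p1 (divr_ge0 (normr_ge0 _) (ltW l0)).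
  rewrite powRM ?invr_ge0 ?(ltW l0) // in h.
  have := ler_wpM2l (ltW l0) h.
  rewrite mulrCA mulfV ?gt_eqF // mulr1 mulrDr mulr1.
  have -> : (lam^-1) `^ p = (lam `^ p)^-1 by rewrite -[lam^-1]powR_inv1 ?(ltW l0) // -powRrM mulN1r powRN.
  by rewrite mulrA mulrAC.
have [E|ne] := eqVneq (lp p f) 0.
  apply/ler_addgt0Pr => e e0; have := key e e0; rewrite E mulr0 addr0 powR0 ?mulr0 ?add0r //.
  by rewrite invr_eq0 gt_eqF //; lra.
have l0 : 0 < lp p f `^ p^-1 by rewrite powR_gt0 // lt_neqAle eq_sym ne lp_ge0.
have := key _ l0; rewrite powR_invK ?lp_ge0 // divfK //; lra.
Qed.

Lemma lp_norm p phi dphi z : 1 <= p -> W1p_with p phi dphi -> lp p z <= lp2 p phi dphi -> (lp p z) `^ p^-1 <= W1p_norm p phi dphi.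
Proof.
move=> p1 W h; rewrite W1p_normE //; apply: ge0_ler_powR; rewrite ?nnegrE ?lp_ge0 ?lp2_ge0 //.
by rewrite invr_ge0; lra.
Qed.

Definition AC p f g := {within @I01 R, continuous f} /\ W1p_pair p f g.

Lemma AC_diff p f g x y : 1 <= p -> AC p f g -> 0 < x -> x <= y -> y < 1 ->
  `|f y - f x| <= \int[mu]_(t in `]x, y]) `|(g \_ (@I01 R)) t|.
Proof.
move=> p1 [cf W] x0 xy y1; rewrite (weak_AC p1 cf W) //.
have Ig : L1 setT (g \_ (@I01 R)) by apply: L1_patchT => //; case: W => _ /(isLp_L1 p1).
by rewrite primB //; exact: RintegralS_norm.
Qed.

Lemma int_sub_I01 g (A : set TR) : measurable A -> L1 (@I01 R) g -> 
  \int[mu]_(t in A) `|(g \_ (@I01 R)) t| <= \int[mu]_(t in @I01 R) `|g t|.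
Proof.
move=> mA ig; have ig0 := L1_norm (L1_patchT (@measurable_I01 R) ig).
rewrite -(@Rint_patch R setT A) //.
rewrite -(@Rint_patch R setT (@I01 R) (fun t => `|g t|)) //.
apply: le_Rintegral => //.
- exact: L1_patchD.
- by apply: L1_patchT => //; exact: L1_norm.
- move=> t _.
  rewrite !patchE; case: ifP => _; case: ifP => _; [exact: lexx| |exact: normr_ge0|exact: lexx].
  by change (`|0 : R| <= 0); rewrite normr0.
Qed.

(** Average over [t] the estimate of [|f x|] by [|f t|] plus the total mass of [g]; the interval has
    length 1. *)
Lemma AC_sup p f g x : 1 <= p -> AC p f g -> 0 < x < 1 ->
  `|f x| <= \int[mu]_(t in @I01 R) `|f t| + \int[mu]_(t in @I01 R) `|g t|.
Proof.
move=> p1 A /andP[x0 x1]; have [_ [/(isLp_L1 p1) If /(isLp_L1 p1) Ig _]] := A.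
set G := \int[mu]_(t in @I01 R) `|g t|.
have h t : I01 t -> `|f x| <= `|f t| + G.
  move=> /I01P /andP[t0 t1]; rewrite -lerBlDl.
  apply: (le_trans (lerB_dist _ _)).
  have [tx|xt] := leP t x.
    by apply: (le_trans (AC_diff p1 A t0 tx x1)); exact: int_sub_I01.
  by rewrite distrC; apply: (le_trans (AC_diff p1 A x0 (ltW xt) t1)); exact: int_sub_I01.
have -> : `|f x| = \int[mu]_(t in @I01 R) `|f x|.
  by rewrite Rintegral_cst // [X in fine X]mu_I01 mulr1.
have -> : G = \int[mu]_(t in @I01 R) G by rewrite Rintegral_cst // [X in fine X]mu_I01 mulr1.
rewrite -RintegralD //; [|exact: L1_norm|exact: L1_cst01].
apply: le_Rintegral => //; first exact: L1_cst01.
by apply: L1D => //; [exact: L1_norm|exact: L1_cst01].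
Qed.

Lemma within_pair phi : {within @I01 R, continuous phi} <->
  {within @I01 R, continuous (comp1 phi)} /\ {within @I01 R, continuous (comp2 phi)}.
Proof.
split=> [c|[c1 c2]].
  split=> x.
    exact: (cvg_comp (from_subspace (@I01 R) phi) fst (c x) (@cont_fst R (phi x))).
  exact: (cvg_comp (from_subspace (@I01 R) phi) snd (c x) (@cont_snd R (phi x))).
have -> : phi = (fun x => (comp1 phi x, comp2 phi x)) by apply/funext => x; rewrite [LHS]surjective_pairing.
by move=> x; have := cvg_pair (c1 x) (c2 x); apply; exact: nbhs_filter.
Qed.

Lemma within_lin (a : R) f g : {within @I01 R, continuous f} -> {within @I01 R, continuous g} ->
  {within @I01 R, continuous (fun x => a * f x + g x)}.
Proof.
by move=> cf cg x; apply: cvgD; [apply: cvgM; [exact: cvg_cst|exact: cf]|exact: cg].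
Qed.

Lemma W1p_with_lin p (a : R) phi dphi psi dpsi : 1 <= p -> W1p_with p phi dphi -> W1p_with p psi dpsi ->
  W1p_with p (addm (scalem a phi) psi) (addm (scalem a dphi) dpsi).
Proof.
move=> p1 [/within_pair[c1 c2] w1 w2] [/within_pair[d1 d2] v1 v2]; split.
- by apply/within_pair; split; exact: within_lin.
- exact: (@W1p_pair_lin R p a (comp1 phi) (comp1 dphi) (comp1 psi) (comp1 dpsi)).
- exact: (@W1p_pair_lin R p a (comp2 phi) (comp2 dphi) (comp2 psi) (comp2 dpsi)).
Qed.

Lemma submE phi psi : subm phi psi = addm (scalem (-1) psi) phi.
Proof. by apply/funext => x; rewrite /subm /addm /scalem /= !mulN1r ![- _ + _]addrC. Qed.

Lemma W1p_with_sub p phi dphi psi dpsi : 1 <= p -> W1p_with p phi dphi -> W1p_with p psi dpsi ->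
  W1p_with p (subm phi psi) (subm dphi dpsi).
Proof. by move=> p1 w1 w2; rewrite !submE; exact: W1p_with_lin. Qed.

Lemma strong_weak p (phik : nat -> map2 R) phi : 1 <= p -> W1p_strong p phik phi -> W1p_weak p phik phi.
Proof.
move=> p1 [dk [d [Wk W cv]]]; split; [by move=> k; exists (dk k)|by exists d|].
move=> L [lin [C HC]].
apply/cvgrPdist_le => e e0.
have C0 : 0 < `|C| + 1 by rewrite ltr_wpDl.
move/cvgrPdist_le: cv => /(_ (e / (`|C| + 1)) (divr_gt0 e0 C0)).
apply: filterS => k; rewrite sub0r normrN => h.
have Ws := W1p_with_sub p1 (Wk k) W.
have := HC _ _ Ws; rewrite {1}submE lin; [|by exists d|by exists (dk k)].
rewrite mulN1r addrC distrC => h2; apply: (le_trans h2).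
set n := W1p_norm _ _ _ in h *.
have n0 : 0 <= n by rewrite /n; exact: powR_ge0.
rewrite ger0_norm // ler_pdivlMr // in h.
by apply: le_trans h; rewrite mulrC ler_wpM2l // (le_trans (ler_norm _)) // lerDl.
Qed.

Lemma lp_triangle p f g : 1 <= p -> isLp p f -> isLp p g ->
  lp p (fun t => f t + g t) <= 2 `^ p * (lp p f + lp p g).
Proof.
move=> p1 lf lg; have If := isLp_powR p1 lf; have Ig := isLp_powR p1 lg.
have ls : isLp p (fun t => f t + g t).
  have := isLp_lin 1 p1 lf lg; congr isLp.
  by apply/funext => t; rewrite mul1r.
have Is := isLp_powR p1 ls.
rewrite -RintegralD // -RintegralZl //; last exact: L1D.
apply: le_Rintegral => //; first by apply: L1Z => //; exact: L1D.
by move=> t _; exact: powR_addle.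
Qed.

Lemma strong_bounded p (phik : nat -> map2 R) phi : 1 <= p -> W1p_strong p phik phi -> W1p_bounded p phik.
Proof.
move=> p1 [dk [d [Wk W cv]]].
have /cvg_seq_bounded [M [_ HM]] : cvgn (fun k => W1p_norm p (subm (phik k) phi) (subm (dk k) d)).
  by apply/cvg_ex; exists 0.
pose B := `|M| + 1.
have HB k : W1p_norm p (subm (phik k) phi) (subm (dk k) d) <= B.
  apply: le_trans (ler_norm _) _; apply: HM => //; rewrite /B.
  by apply: le_lt_trans (ler_norm M) _; rewrite ltrDl.
have p0 : 0 <= p by lra.
exists ((2 `^ p * (B `^ p + lp2 p phi d)) `^ p^-1) => k; exists (dk k); split => //.
rewrite W1p_normE //; apply: ge0_ler_powR; rewrite ?nnegrE ?lp2_ge0 ?invr_ge0 //.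
  by rewrite mulr_ge0 ?powR_ge0 // addr_ge0 ?powR_ge0 ?lp2_ge0.
have Ws := W1p_with_sub p1 (Wk k) W.
have h : lp2 p (subm (phik k) phi) (subm (dk k) d) <= B `^ p.
  have := HB k; rewrite W1p_normE // => hb.
  rewrite -[leLHS](powR_invK p1) ?lp2_ge0 //.
  by apply: ge0_ler_powR => //; rewrite nnegrE ?powR_ge0 // /B addr_ge0.
have [_ [a1 a2 _] [a3 a4 _]] := Ws; have [_ [b1 b2 _] [b3 b4 _]] := W.
have c1 := lp_triangle p1 a1 b1; have c2 := lp_triangle p1 a2 b2.
have c3 := lp_triangle p1 a3 b3; have c4 := lp_triangle p1 a4 b4.
have E (u v : map2 R) (c : map2 R -> R -> R) : (c = @comp1 R \/ c = @comp2 R) -> (fun t => c (subm u v) t + c v t) = c u.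
  by case=> ->; apply/funext => t; rewrite /comp1 /comp2 /subm /= subrK.
rewrite !E in c1 c2 c3 c4; try by [left|right].
apply: (@le_trans _ _ (2 `^ p * (lp2 p (subm (phik k) phi) (subm (dk k) d) + lp2 p phi d))).
  move: c1 c2 c3 c4; rewrite /lp2; do 12 move: (lp p _); move: (2 `^ p).
  by move=> *; lra.
apply: ler_wpM2l; first exact: powR_ge0.
by rewrite lerD2r; exact: h.
Qed.
End Norms.

(** * Weak convergence implies uniform convergence *)

Section Hump.
Variable R : realType.
Notation mu := (@lebesgue_measure R).
Notation TR := (measurableTypeR R).

Lemma sum_int_disjoint (S : set TR) (A : nat -> set TR) (v : R -> R) n :
  measurable S -> L1 S v -> (forall j, (j < n)%N -> measurable (A j) /\ A j `<=` S) ->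
  (forall i j, (i < j)%N -> (j < n)%N -> A i `&` A j = set0) ->
  \sum_(j < n) \int[mu]_(t in A j) `|v t| <= \int[mu]_(t in S) `|v t|.
Proof.
move=> mS Iv HA dis.
have U m : (m <= n)%N -> let B := \big[setU/set0]_(j < m) A j in
   [/\ measurable B, B `<=` S & \sum_(j < m) \int[mu]_(t in A j) `|v t| = \int[mu]_(t in B) `|v t|].
  elim: m => [|m IH] mn /=.
    rewrite !big_ord0; split => //; by rewrite Rintegral_set0.
  have [mB BS E] := IH (ltnW mn); have [mA AS] := HA m mn.
  rewrite !big_ord_recr /= E; split.
  - exact: measurableU.
  - by move=> t [/BS|/AS].
  - rewrite Rintegral_setU //.
      by apply: L1S (L1_norm Iv) => //; [exact: measurableU|move=> t [/BS|/AS]].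
    apply/disj_set2P; rewrite -subset0 => t [].
    rewrite -bigcup_mkord => -[j /= jm Ajt] Amt.
    have : (A j `&` A m) t by split.
    by rewrite (dis j m jm mn).
have [mB BS ->] := U n (leqnn n).
rewrite -(@Rint_patch R S _ _ mS mB BS).
apply: le_Rintegral => //.
- by apply: L1_patchD => //; exact: L1_norm.
- exact: L1_norm.
- move=> t _; rewrite patchE; case: ifP => _; [exact: lexx|exact: normr_ge0].
Qed.

(** Functionals of one scalar component, bounded by the [W^{1,1}] norm; [L1_le_lp] turns them into
    elements of the dual in [dual_comp]. *)
Definition dual_bounded p (L : (R -> R) -> R) : Prop :=
  (forall (a : R) u v u' v', AC p u v -> AC p u' v' -> L (fun t => a * u t + u' t) = a * L u + L u') /\
  exists C : R, forall u v, AC p u v -> `|L u| <= C * (\int[mu]_(t in @I01 R) `|u t| + \int[mu]_(t in @I01 R) `|v t|).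

Lemma eval_dual p z : 1 <= p -> 0 < z < 1 -> dual_bounded p (fun u => u z).
Proof. by move=> p1 z01; split => //; exists 1 => u v A; rewrite mul1r; exact: AC_sup A z01. Qed.

Lemma AC_oc p u v a b : 1 <= p -> AC p u v -> 0 < a -> a <= b -> b < 1 ->
  `|u b - u a| <= \int[mu]_(t in `]a, b]) `|v t|.
Proof.
move=> p1 A a0 ab b1; apply: (le_trans (AC_diff p1 A a0 ab b1)).
rewrite le_eqVlt; apply/orP; left; apply/eqP; apply: eq_Rintegral => t /set_mem /=.
rewrite in_itv /= => /andP[at_ tb]; rewrite patchE mem_set //.
by apply/I01P; rewrite (lt_trans a0 at_) (le_lt_trans tb b1).
Qed.

Lemma dist_left (x y t : R) : t <= y -> y < x -> `|y - x| <= `|t - x|.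
Proof. by move=> ty yx; rewrite !ltr0_norm ?subr_lt0 ?(le_lt_trans ty) // !opprB lerD2l lerN2. Qed.

Lemma dist_right (x y t : R) : y <= t -> x < y -> `|y - x| <= `|t - x|.
Proof. by move=> ty yx; rewrite !gtr0_norm ?subr_gt0 ?(lt_le_trans yx) // lerD2r. Qed.

Lemma dist_left_lt (x y t r : R) : r <= x - t -> `|y - x| < r -> t < y.
Proof. by move=> h; rewrite ltr_norml => /andP[+ _]; lra. Qed.

Lemma dist_right_lt (x y t r : R) : r <= t - x -> `|y - x| < r -> y < t.
Proof. by move=> h; rewrite ltr_norml => /andP[_]; lra. Qed.

Lemma three_quarters (e a b c : R) : e / 2 + e / 4 <= a -> b <= e / 4 -> a - b <= c -> e / 2 <= c.
Proof. lra. Qed.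

Lemma window_small (x r d : R) : 0 < r -> r <= d / 3 -> 0 < d -> x - r <= x + r /\ x + r - (x - r) < d.
Proof. by move=> *; split; lra. Qed.

Section HumpMain.
Variables (p xs e : R) (f g : nat -> R -> R).
Hypotheses (p1 : 1 <= p) (HAC : forall k, AC p (f k) (g k)) (e0 : 0 < e) (xs01 : 0 <= xs <= 1).
Hypothesis pt0 : forall z : R, 0 < z < 1 -> (fun k => f k z) @ \oo --> (0 : R).
Hypothesis acc : forall K (r : R), 0 < r -> exists k (x : R), [/\ (K <= k)%N, 0 < x < 1, `|x - xs| < r & e < `|f k x|].

(** The index of a function, the interval on which it has its hump, and a radius around [xs] inside
    which all later intervals have to stay. *)
Definition hump_state := (nat * (R * R) * R)%type.
Definition hidx (s : hump_state) := s.1.1.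
Definition hlo (s : hump_state) := s.1.2.1.
Definition hhi (s : hump_state) := s.1.2.2.
Definition hrad (s : hump_state) := s.2.

(** The list [l] holds the earlier stages. The new interval lies within all their radii and outside
    its own, which makes the intervals disjoint. The new function has a small total increment over
    the earlier intervals, and its derivative has so little mass within the new radius that later
    intervals cannot spoil the hump. *)
Definition hump_step (l : seq hump_state) (s : hump_state) : Prop :=
  [/\ 0 < hrad s, [/\ 0 < hlo s, hlo s <= hhi s & hhi s < 1], (size l <= hidx s)%N,
      (forall y : hump_state, y \in l -> `|hlo s - xs| < hrad y /\ `|hhi s - xs| < hrad y) &
      [/\ (forall t : R, hlo s <= t <= hhi s -> hrad s <= `|t - xs|),
      e / 2 <= `|f (hidx s) (hhi s) - f (hidx s) (hlo s)|,
      \sum_(y <- l) `|f (hidx s) (hhi y) - f (hidx s) (hlo y)| <= e / 8 &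
      \int[mu]_(t in `]xs - hrad s, xs + hrad s] `&` @I01 R) `|g (hidx s) t| <= e / 8]].

Let ev_small (z d : R) : 0 < z < 1 -> 0 < d -> exists K, forall k, (K <= k)%N -> `|f k z| <= d.
Proof.
move=> z01 d0; have /cvgrPdist_le /(_ d d0) [K _ HK] := pt0 z01.
by exists K => k Kk; have := HK k Kk; rewrite sub0r normrN.
Qed.

Let ev_sum (l : seq hump_state) : (forall y : hump_state, y \in l -> 0 < hlo y < 1 /\ 0 < hhi y < 1) ->
  forall d : R, 0 < d -> exists K, forall k, (K <= k)%N -> \sum_(y <- l) `|f k (hhi y) - f k (hlo y)| <= d.
Proof.
elim: l => [_ d d0|y l IH Hl d d0]; first by exists 0%N => k _; rewrite big_nil ltW.
have [||K1 H1] := IH _ (d / 2); [by move=> z zl; apply: Hl; rewrite inE zl orbT|by rewrite divr_gt0|].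
have [ya yb] := Hl y (mem_head _ _).
have d4 : 0 < d / 4 by rewrite divr_gt0.
have [K2 H2] := ev_small ya d4; have [K3 H3] := ev_small yb d4.
exists (maxn K1 (maxn K2 K3)) => k; rewrite !geq_max => /and3P[k1 k2 k3].
rewrite big_cons.
have := ler_normB (f k (hhi y)) (f k (hlo y)); have := H1 k k1; have := H2 k k2; have := H3 k k3.
move: `|f k (hhi y) - f k (hlo y)| `|f k (hhi y)| `|f k (hlo y)| (\sum_(j <- l) _).
by move=> x1 x2 x3 x4; lra.
Qed.

(** The value exceeding [e] may be attained at [xs] itself. Moving slightly to the right costs
    [e / 4] and leaves a positive distance to [xs] for the radius. *)
Let off_center k (x r : R) : 0 < r -> 0 < x < 1 -> `|x - xs| < r -> e < `|f k x| ->
  exists y : R, [/\ 0 < y < 1, y != xs, `|y - xs| < r & e / 2 + e / 4 <= `|f k y|].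
Proof.
have e0' := e0.
move=> r0 x01 xr fx; have [E|ne] := eqVneq x xs; last by exists x; split => //; lra.
have [cf _] := HAC k.
have [d d0 Hd] := within_eps cf (proj2 (I01P x) x01) (ltac:(lra) : 0 < e / 4).
pose y := x + Num.min (Num.min d (r / 2)) ((1 - x) / 2).
have m0 : 0 < Num.min (Num.min d (r / 2)) ((1 - x) / 2).
  by case/andP: x01 => _ x1; rewrite !lt_min d0 !divr_gt0 // subr_gt0.
have m1 : Num.min (Num.min d (r / 2)) ((1 - x) / 2) <= d by rewrite !ge_min lexx.
have m2 : Num.min (Num.min d (r / 2)) ((1 - x) / 2) <= r / 2 by rewrite !ge_min lexx orbT.
have m3 : Num.min (Num.min d (r / 2)) ((1 - x) / 2) <= (1 - x) / 2 by rewrite !ge_min lexx !orbT.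
move: m0 m1 m2 m3 @y; set m := Num.min _ _ => m0 m1 m2 m3 y.
have y01 : 0 < y < 1 by rewrite /y; lra.
exists y; split => //.
- by rewrite -E /y gt_eqF // ltrDl.
- by rewrite -E /y addrC addKr gtr0_norm //; lra.
- have h : `|f k y - f k x| <= e / 4.
    by apply: Hd; [rewrite /y addrC addKr gtr0_norm|exact/I01P].
  have := lerB_dist (f k x) (f k y); rewrite distrC in h; move: h fx.
  by set a := `|_ - _|; set b := `|f k x|; set c := `|f k y|; move: a b c => a b c; lra.
Qed.

(** The interval joins a point [y] with [|f k y| >= 3e/4] to an anchor [zm] or [zp] on the same side
    of [xs] and farther from it. The anchor is fixed before [k], so pointwise convergence makes
    [|f k|] at most [e / 4] there. *)
Lemma hump_step_exists (l : seq hump_state) : (forall y : hump_state, y \in l -> [/\ 0 < hrad y, 0 < hlo y < 1 & 0 < hhi y < 1]) -> exists s, hump_step l s.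
Proof.
have e0' := e0; have [x0 x1] := andP xs01.
move=> Hl.
have [r r0 Hr] : exists2 r : R, 0 < r & forall y : hump_state, y \in l -> r <= hrad y.
  elim: (l) Hl => [_|y l' IH Hl]; first by exists 1.
  have [z zl|r r0 Hr] := IH; first by apply: Hl; rewrite inE zl orbT.
  have [ry _ _] := Hl y (mem_head _ _).
  exists (Num.min r (hrad y)); first by rewrite lt_min r0.
  move=> z; rewrite inE => /orP[/eqP ->|zl]; first by rewrite ge_min lexx orbT.
  by rewrite ge_min Hr.
pose zm := (xs + Num.max 0 (xs - r)) / 2.
pose zp := (xs + Num.min 1 (xs + r)) / 2.
have zmP : 0 < xs -> [/\ 0 < zm, zm < xs & `|zm - xs| < r].
  move=> xx0; rewrite /zm; case: (leP 0 (xs - r)) => h.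
    by split; [lra|lra|rewrite ltr0_norm; lra].
  by split; [lra|lra|rewrite ltr0_norm; lra].
have zpP : xs < 1 -> [/\ zp < 1, xs < zp & `|zp - xs| < r].
  move=> xx0; rewrite /zp; case: (leP 1 (xs + r)) => h.
    by split; [lra|lra|rewrite gtr0_norm; lra].
  by split; [lra|lra|rewrite gtr0_norm; lra].
have e4 : 0 < e / 4 by rewrite divr_gt0.
have e8 : 0 < e / 8 by rewrite divr_gt0.
have [K1 H1] : exists K, forall k, (K <= k)%N -> 0 < xs -> `|f k zm| <= e / 4.
  have [h|h] := ltP 0 xs; last by exists 0%N => k _ h'; lra.
  have [a b c] := zmP h; have [|K HK] := @ev_small zm _ _ e4; first by rewrite a; lra.
  by exists K => k kK _; exact: HK.
have [K2 H2] : exists K, forall k, (K <= k)%N -> xs < 1 -> `|f k zp| <= e / 4.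
  have [h|h] := ltP xs 1; last by exists 0%N => k _ h'; lra.
  have [a b c] := zpP h; have [|K HK] := @ev_small zp _ _ e4; first by rewrite a andbT; lra.
  by exists K => k kK _; exact: HK.
have [|K3 H3] := @ev_sum l _ _ e8; first by move=> y /Hl[].
(* The value 1 is a dummy for a side of [xs] that lies outside (0, 1); no point [y] occurs there. *)
pose rho : R := Num.min (if 0 < xs then xs - zm else 1) (if xs < 1 then zp - xs else 1).
have rho0 : 0 < rho.
  rewrite /rho lt_min; apply/andP; split.
    by case: ifP => // /zmP[_ h _]; rewrite subr_gt0.
  by case: ifP => // /zpP[_ h _]; rewrite subr_gt0.
have [k [x [kK x01 xr fx]]] := acc (maxn (size l) (maxn K1 (maxn K2 K3))) rho0.
move: kK; rewrite !geq_max => /and4P[k0 k1 k2 k3].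
have [y [/andP[y0 y1] yxs yr fy]] := off_center rho0 x01 xr fx.
have Ig : L1 setT (g k \_ (@I01 R)) by apply: L1_patchT => //; case: (HAC k) => _ [_ /(isLp_L1 p1)].
have [d d0 Hd] := prim_small Ig e8.
pose r' : R := Num.min `|y - xs| (d / 3).
have r'0 : 0 < r' by rewrite lt_min normr_gt0 subr_eq0 yxs divr_gt0.
have r'1 : r' <= `|y - xs| by rewrite ge_min lexx.
have r'2 : r' <= d / 3 by rewrite ge_min lexx orbT.
have int_small : \int[mu]_(t in `]xs - r', xs + r'] `&` @I01 R) `|g k t| <= e / 8.
  have [h1 h2] := window_small xs r'0 r'2 d0.
  have := Hd (xs - r') (xs + r') h1 h2 => /ltW; apply: le_trans.
  rewrite Rintegral_mkcondr le_eqVlt; apply/orP; left; apply/eqP; apply: eq_Rintegral => t _.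
  by rewrite !patchE; case: ifP => // _; change (0 = `|0 : R|); rewrite normr0.
have [yx|xy] := ltP y xs.
- have xs0 : 0 < xs := lt_trans y0 yx.
  have [a b c] := zmP xs0.
  have zy : zm < y.
    have : rho <= xs - zm by rewrite /rho xs0 ge_min lexx.
    by move/dist_left_lt; exact.
  exists (k, (zm, y), r'); split => //=.
  + by rewrite /hlo /hhi /=; split => //; exact: ltW.
  + move=> z zl; have h := Hr z zl; rewrite /hlo /hhi /=; split; first exact: lt_le_trans c h.
    by apply: lt_le_trans h; apply: le_lt_trans c; exact: dist_left (ltW zy) yx.
  + split => //.
    * rewrite /hrad /hlo /hhi /= => t /andP[_ ty]; by apply: (le_trans r'1); exact: dist_left.
    * rewrite /hidx /hlo /hhi /=; have := H1 k k1 xs0; have := lerB_dist (f k y) (f k zm).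
      by move=> h h'; exact: three_quarters fy h' h.
    * exact: H3.
- have {}xy : xs < y by rewrite lt_neqAle eq_sym yxs.
  have xs1 : xs < 1 := lt_trans xy y1.
  have [a b c] := zpP xs1.
  have zy : y < zp.
    have : rho <= zp - xs by rewrite /rho xs1 ge_min lexx orbT.
    by move/dist_right_lt; exact.
  exists (k, (y, zp), r'); split => //=.
  + by rewrite /hlo /hhi /=; split => //; exact: ltW.
  + move=> z zl; have h := Hr z zl; rewrite /hlo /hhi /=; split; last exact: lt_le_trans c h.
    by apply: lt_le_trans h; apply: le_lt_trans c; exact: dist_right (ltW zy) xy.
  + split => //.
    * rewrite /hrad /hlo /hhi /= => t /andP[yt _]; by apply: (le_trans r'1); exact: dist_right.
    * rewrite /hidx /hlo /hhi /=; have := H2 k k2 xs1; have := lerB_dist (f k y) (f k zp); rewrite (distrC (f k zp)).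
      by move=> h h'; exact: three_quarters fy h' h.
    * exact: H3.
Qed.
End HumpMain.
End Hump.

Section HumpSeq.
Variable R : realType.
Notation mu := (@lebesgue_measure R).
Notation TR := (measurableTypeR R).

Lemma oc_I01 (a b : R) : 0 < a -> b < 1 -> (`]a, b]%classic : set R) `<=` @I01 R.
Proof.
by move=> a0 b1 t /=; rewrite in_itv /= => /andP[h1 h2]; apply/I01P; rewrite (lt_trans a0 h1) (le_lt_trans h2 b1).
Qed.

Lemma oc_ball (a b x r t : R) : `|a - x| < r -> `|b - x| < r -> a < t -> t <= b -> `|t - x| < r.
Proof. by rewrite !ltr_norml => /andP[h1 h2] /andP[h3 h4] h5 h6; apply/andP; split; lra. Qed.

Lemma hump_arith (e A B C : R) : e / 2 <= `|C| -> `|A| <= e / 8 -> `|B| <= e / 8 -> e / 4 <= `|B + C + A|.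
Proof.
move=> h1 h2 h3; have := lerB_dist C (- (B + A)); rewrite normrN opprK addrA [C + B]addrC => h4.
by have := ler_normD B A; lra.
Qed.

(** The intervals are disjoint, so the increments of [u] over them are absolutely summable, with sum
    at most the integral of [|v|]. *)
Lemma dual_series p (a b : nat -> R) : 1 <= p -> (forall j, [/\ 0 < a j, a j <= b j & b j < 1]) ->
  (forall i j, (i < j)%N -> `]a i, b i]%classic `&` `]a j, b j]%classic = set0) ->
  dual_bounded p (fun u => limn (series (fun j => u (b j) - u (a j)))) /\
  forall u v, AC p u v -> cvgn (series (fun j => u (b j) - u (a j))).
Proof.
move=> p1 Hab dis.
pose d (u : R -> R) j := u (b j) - u (a j).
have bd u v n : AC p u v -> \sum_(0 <= j < n) `|d u j| <= \int[mu]_(t in @I01 R) `|v t|.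
  move=> A; have Iv : L1 (@I01 R) v by case: A => _ [_ /(isLp_L1 p1)].
  rewrite big_mkord; pose B j : set TR := `]a j, b j]%classic.
  have h := @sum_int_disjoint R (@I01 R) B v n (@measurable_I01 R) Iv.
  apply: le_trans (h _ _).
  - apply: ler_sum => j _; have [h1 h2 h3] := Hab j; exact: AC_oc A h1 h2 h3.
  - by move=> j _; have [h1 h2 h3] := Hab j; split; [exact: measurable_set_itv|exact: oc_I01].
  - by move=> i j ij _; exact: dis.
have cv u v : AC p u v -> cvgn (series (d u)).
  move=> A; apply: normed_cvg; apply: nondecreasing_is_cvgn.
    by apply: nondecreasing_series => j _ _; exact: normr_ge0.
  by exists (\int[mu]_(t in @I01 R) `|v t|) => _ [n _ <-]; exact: bd A.
split; last exact: cv.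
split.
  move=> c u v u' v' A A'.
  have -> : series (fun j => c * u (b j) + u' (b j) - (c * u (a j) + u' (a j))) =
     (fun n => c * series (d u) n + series (d u') n).
    apply/funext => n; rewrite /series /= mulr_sumr -big_split /=; apply: eq_bigr => j _.
    by rewrite /d; ring.
  apply/cvg_lim => //; apply: cvgD; last exact: cv A'.
  by apply: cvgM; [exact: cvg_cst|exact: cv A].
exists 1 => u v A; rewrite mul1r.
have h0 : 0 <= \int[mu]_(t in @I01 R) `|u t| by apply: Rintegral_ge0.
apply: (@le_trans _ _ (\int[mu]_(t in @I01 R) `|v t|)); last by rewrite lerDr.
apply: (cvgr_to_le (cvg_norm (cv _ _ A))).
apply: nearW => n; rewrite /series /=; apply: le_trans (ler_norm_sum _ _ _) _; exact: bd A.
Qed.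

Variables (p xs e : R) (f g : nat -> R -> R).
Hypotheses (p1 : 1 <= p) (HAC : forall k, AC p (f k) (g k)) (e0 : 0 < e) (xs01 : 0 <= xs <= 1).
Hypothesis pt0 : forall z : R, 0 < z < 1 -> (fun k => f k z) @ \oo --> (0 : R).
Hypothesis acc : forall K (r : R), 0 < r -> exists k (x : R), [/\ (K <= k)%N, 0 < x < 1, `|x - xs| < r & e < `|f k x|].
Hypothesis weak0 : forall L, dual_bounded p L -> (fun k => L (f k)) @ \oo --> (0 : R).

(* Gliding hump: the intervals are built one after the other, and the K-th term dominates
   the value of the functional at f (hidx (x K)). *)
Lemma hump_contra : False.
Proof.
have [F HF] : {F : seq (hump_state R) -> hump_state R & forall l, (forall y : hump_state R, y \in l -> [/\ 0 < hrad y, 0 < hlo y < 1 & 0 < hhi y < 1]) -> hump_step xs e f g l (F l)}.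
  apply: (@choice (seq (hump_state R)) (hump_state R) (fun l s => (forall y : hump_state R, y \in l -> [/\ 0 < hrad y, 0 < hlo y < 1 & 0 < hhi y < 1]) -> hump_step xs e f g l s)) => l.
  case: (pselect (forall y : hump_state R, y \in l -> [/\ 0 < hrad y, 0 < hlo y < 1 & 0 < hhi y < 1])) => [h|nh].
    by have [s hs] := hump_step_exists p1 HAC e0 xs01 pt0 acc h; exists s.
  by exists (0%N, (0, 0), 0) => /nh.
pose L n := iter n (fun l => F l :: l) [::].
pose x n := F (L n).
have LS n : L n.+1 = x n :: L n by [].
have pos n : forall y : hump_state R, y \in L n -> [/\ 0 < hrad y, 0 < hlo y < 1 & 0 < hhi y < 1].
  elim: n => [|n IH] y //; rewrite LS inE => /orP[/eqP ->|]; last exact: IH.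
  have [r0 [h1 h2 h3] _ _ _] := HF _ IH.
  by split => //; rewrite ?h1 ?h3 ?andbT ?(le_lt_trans h2) ?(lt_le_trans h1).
have st n : hump_step xs e f g (L n) (x n) := HF _ (pos n).
have inL i n : (i < n)%N -> x i \in L n.
  elim: n => // n IH; rewrite ltnS leq_eqVlt LS inE => /orP[/eqP ->|/IH ->]; by rewrite ?eqxx ?orbT.
have sumL n h : \sum_(y <- L n) h y = \sum_(j < n) h (x j) :> R.
  elim: n => [|n IH]; first by rewrite big_nil big_ord0.
  by rewrite LS big_cons big_ord_recr /= IH addrC.
have sizeL n : size (L n) = n by elim: n => // n IH; rewrite LS /= IH.
pose a j := hlo (x j); pose b j := hhi (x j).
have Hab j : [/\ 0 < a j, a j <= b j & b j < 1] by case: (st j).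
have near_ i j t : (i < j)%N -> a j < t -> t <= b j -> `|t - xs| < hrad (x i).
  move=> ij at_ tb; have [_ _ _ /(_ _ (inL _ _ ij))[h1 h2] _] := st j.
  exact: oc_ball h1 h2 at_ tb.
have dis i j : (i < j)%N -> `]a i, b i]%classic `&` `]a j, b j]%classic = set0.
  move=> ij; rewrite -subset0 => t [] /=; rewrite !in_itv /= => /andP[h1 h2] /andP[h3 h4].
  have [_ _ _ _ [h _ _ _]] := st i.
  have h5 : hrad (x i) <= `|t - xs| by apply: h; rewrite (ltW h1) h2.
  by have := near_ i j t ij h3 h4; rewrite ltNge h5.
have [DB cv] := dual_series p1 Hab dis.
have e4 : 0 < e / 4 by rewrite divr_gt0.
have /cvgrPdist_lt /(_ (e / 4) e4) [K _ HK] := weak0 DB.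
pose k := hidx (x K).
have Kk : (K <= k)%N by case: (st K) => _ _; rewrite sizeL.
have := HK k Kk; rewrite sub0r normrN ltNge => /negP; apply.
apply: (cvgr_to_ge (cvg_norm (cv _ _ (HAC k)))).
exists K.+1 => // m /= Km; rewrite /series /= big_mkord.
have [_ _ _ _ [_ h1 h2 h3]] := st K.
rewrite sumL in h2.
have -> : m = (K.+1 + (m - K.+1))%N by rewrite subnKC.
(* Three parts: the intervals before stage [K], small by the choice of the index; the hump, at least
   [e / 2]; the later intervals, all inside the radius of stage [K] and small by the mass bound. *)
move: (m - K.+1)%N => q; rewrite big_split_ord big_ord_recr /=.
have h4 : `|\sum_(i < q) (f k (b (K.+1 + i)%N) - f k (a (K.+1 + i)%N))| <= e / 8.
  apply: le_trans h3.
  pose B i : set TR := `]a (K.+1 + i)%N, b (K.+1 + i)%N]%classic.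
  pose S : set TR := `]xs - hrad (x K), xs + hrad (x K)]%classic `&` @I01 R.
  have mS : measurable S by apply: measurableI; [exact: measurable_set_itv|exact: measurable_I01].
  have Iv : L1 S (g k).
    apply: (@L1S _ (@I01 R)) => //; last by case: (HAC k) => _ [_ /(isLp_L1 p1)].
    by move=> t [].
  have h := @sum_int_disjoint R S B (g k) q mS Iv.
  apply: le_trans (h _ _).
  - apply: le_trans (ler_norm_sum _ _ _) _; apply: ler_sum => j _.
    have [h5 h6 h7] := Hab (K.+1 + j)%N; exact: AC_oc (HAC k) h5 h6 h7.
  - move=> j _; have [h5 h6 h7] := Hab (K.+1 + j)%N; split; first exact: measurable_set_itv.
    move=> t Bt; split; last exact: oc_I01 h5 h7 t Bt.
    move: Bt; rewrite /B /= !in_itv /= => /andP[h8 h9].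
    have := @near_ K (K.+1 + j)%N t (leq_addr _ _) h8 h9.
    by rewrite ltr_norml => /andP[h10 h11]; apply/andP; split; lra.
  - by move=> i j ij _; apply: dis; rewrite ltn_add2l.
have h5 : `|\sum_(i < K) (f k (b i) - f k (a i))| <= e / 8.
  by apply: le_trans (ler_norm_sum _ _ _) h2.
move: h1 h4 h5; rewrite -/k -/(a K) -/(b K).
move: (\sum_(i < q) _) (\sum_(i < K) _) (f k (b K) - f k (a K)) => A B C.
exact: hump_arith.
Qed.
End HumpSeq.

Section WeakUnif.
Variable R : realType.
Notation mu := (@lebesgue_measure R).
Notation TR := (measurableTypeR R).

(** Otherwise there are arbitrarily late indices with points where [|f k|] exceeds [e]; a cluster
    point of these in [0, 1] is the centre for the gliding hump. *)
Lemma dual_unif p (f g : nat -> R -> R) (e : R) : 1 <= p -> (forall k, AC p (f k) (g k)) ->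
  (forall L, dual_bounded p L -> (fun k => L (f k)) @ \oo --> (0 : R)) -> 0 < e ->
  exists N, forall k, (N <= k)%N -> forall x : R, I01 x -> `|f k x| <= e.
Proof.
move=> p1 HAC W e0; apply: contrapT => nex.
have [q Hq] : {q : nat -> nat * R & forall N, [/\ (N <= (q N).1)%N, 0 < (q N).2 < 1 & e < `|f (q N).1 (q N).2|]}.
  apply: (@choice nat (nat * R) (fun N s => [/\ (N <= s.1)%N, 0 < s.2 < 1 & e < `|f s.1 s.2|])) => N.
  apply: contrapT => nq; apply: nex; exists N => k Nk x /I01P x01.
  by rewrite leNgt; apply/negP => h; apply: nq; exists (k, x).
have [xs [xs01 cl]] : (`[0, 1]%classic : set R) `&` cluster ((fun n => (q n).2) @ \oo) !=set0.
  apply: (@segment_compact R 0 1).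
  by exists 0%N => // n _ /=; have [_ /andP[/ltW h1 /ltW h2] _] := Hq n; rewrite in_itv /= h1.
apply: (@hump_contra R p xs e f g p1 HAC e0).
- by move: xs01; rewrite /= in_itv.
- by move=> z z01; exact: W (eval_dual p1 z01).
- move=> K r r0.
  have [|y [[n /= Kn <-]] yb] := cl [set (q n).2 | n in [set n | (K <= n)%N]] (ball xs r) _ (nbhsx_ballx _ _ r0).
    by exists K => // n /= Kn; exists n.
  have [h1 h2 h3] := Hq n; exists (q n).1, (q n).2; split => //; first exact: leq_trans h1.
  by move: yb; rewrite /ball /= distrC.
- exact: W.
Qed.

Lemma W1p_with_AC p (phi dphi : map2 R) : W1p_with p phi dphi ->
  AC p (comp1 phi) (comp1 dphi) /\ AC p (comp2 phi) (comp2 dphi).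
Proof. by case=> /within_pair[c1 c2] w1 w2. Qed.

Lemma norm_bound_arith (C I1 I2 N1 N2 N : R) : I1 <= 2 * N1 -> I2 <= 2 * N2 -> N1 <= N -> N2 <= N ->
  0 <= I1 -> 0 <= I2 -> C * (I1 + I2) <= `|C| * 4 * N.
Proof.
move=> h1 h2 h3 h4 i1 i2.
apply: le_trans (ler_wpM2r _ (ler_norm C)) _; first by lra.
rewrite -mulrA; apply: ler_wpM2l; [exact: normr_ge0|lra].
Qed.

Lemma dual_comp p (c : map2 R -> R -> R) L : 1 <= p -> c = @comp1 R \/ c = @comp2 R ->
  dual_bounded p L -> W1p_dual p (fun phi => L (c phi)).
Proof.
move=> p1 Hc [lin [C HC]].
have HA phi dphi : W1p_with p phi dphi -> AC p (c phi) (c dphi).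
  by move=> /W1p_with_AC[A1 A2]; case: Hc => ->.
split.
  move=> a f g [df /HA Af] [dg /HA Ag].
  by rewrite -(lin a _ _ _ _ Af Ag); congr L; case: Hc => ->.
exists (`|C| * 4) => f df W; have A := HA _ _ W.
apply: (le_trans (HC _ _ A)).
have [_ [l1 l2 _]] := A.
have h1 := L1_le_lp p1 l1; have h2 := L1_le_lp p1 l2.
have [k1 k2 k3 k4] := lp2_comp p f df.
have [h3 h4] : lp p (c f) `^ p^-1 <= W1p_norm p f df /\ lp p (c df) `^ p^-1 <= W1p_norm p f df.
  by case: Hc => ->; split; apply: (lp_norm p1 W); [exact: k1|exact: k3|exact: k2|exact: k4].
have i1 : 0 <= \int[mu]_(t in @I01 R) `|c f t| by apply: Rintegral_ge0.
have i2 : 0 <= \int[mu]_(t in @I01 R) `|c df t| by apply: Rintegral_ge0.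
exact: norm_bound_arith h1 h2 h3 h4 i1 i2.
Qed.

Lemma dist2_le (u v : R * R) : dist2 u v <= `|u.1 - v.1| + `|u.2 - v.2|.
Proof.
rewrite -[leRHS]ger0_norm ?addr_ge0 // -sqrtr_sqr; apply: ler_wsqrtr.
rewrite -[(u.1 - v.1) ^+ 2]real_normK ?num_real // -[(u.2 - v.2) ^+ 2]real_normK ?num_real //.
have : 0 <= `|u.1 - v.1| * `|u.2 - v.2| by rewrite mulr_ge0.
by nra.
Qed.

Lemma weak_unif p (phik : nat -> map2 R) (phi : map2 R) : 1 <= p -> W1p_weak p phik phi -> unif_conv phik phi.
Proof.
move=> p1 [Hk [d Hd] W] e e0.
have [dk Hdk] : {dk : nat -> map2 R & forall k, W1p_with p (phik k) (dk k)} by apply: (@choice nat (map2 R) (fun k d => W1p_with p (phik k) d)).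
have sm (c : map2 R -> R -> R) : c = @comp1 R \/ c = @comp2 R ->
  exists N, forall k, (N <= k)%N -> forall x : R, I01 x -> `|c (subm (phik k) phi) x| <= e / 3.
  move=> Hc; apply: (@dual_unif p _ (fun k => c (subm (dk k) d))) => //; last by rewrite divr_gt0.
    by move=> k; have [] := W1p_with_AC (W1p_with_sub p1 (Hdk k) Hd); case: Hc => ->.
  move=> L DL; have [lin _] := dual_comp p1 Hc DL.
  have := W _ (dual_comp p1 Hc DL).
  have -> : (fun k => L (c (subm (phik k) phi))) = (fun k => L (c (phik k)) - L (c phi)).
    by apply/funext => k; rewrite submE lin; [rewrite mulN1r addrC|exists d|exact: Hk].
  by move=> h; rewrite -(subrr (L (c phi))); apply: cvgB => //; exact: cvg_cst.
have [N1 H1] := sm _ (or_introl erefl); have [N2 H2] := sm _ (or_intror erefl).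
exists (maxn N1 N2) => k; rewrite geq_max => /andP[k1 k2] x x01.
apply: (le_lt_trans (dist2_le _ _)).
have := H1 k k1 x x01; have := H2 k k2 x x01; rewrite /comp1 /comp2 /subm /=.
by move: `|_| `|_| => a b; lra.
Qed.

End WeakUnif.

(** * Convergence of slopes *)

Section SlopeConv.
Variable R : realType.
Notation mu := (@lebesgue_measure R).
Notation TR := (measurableTypeR R).
Implicit Types (F f g h : R -> R) (a b t x y p e : R).

Lemma derive_linear F t e : derivable F t 1 -> 0 < e ->
  exists2 r : R, 0 < r & forall s, `|s - t| <= r -> `|F s - F t - derive1 F t * (s - t)| <= e * `|s - t|.
Proof.
move=> dF e0; have D : is_derive t (1 : R) F (derive1 F t).
  by rewrite derive1E; exact: DeriveDef.
have [q [Hq cq qt]] := (is_derive1_caratheodory F t (derive1 F t)).1 D.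
have /cvgrPdist_le /(_ e e0) /nbhs_ballP [r /= r0 Hr] := cq.
exists (r / 2); first by rewrite divr_gt0.
move=> s st; rewrite Hq -mulrBl normrM; apply: ler_wpM2r => //.
rewrite distrC -qt; apply: Hr; rewrite /ball /= distrC.
by apply: le_lt_trans st _; lra.
Qed.

Lemma slope_combine a b t A B L e : a <= t -> t <= b -> a < b ->
  `|A - L * (a - t)| <= e * `|a - t| -> `|B - L * (b - t)| <= e * `|b - t| -> `|(B - A) / (b - a) - L| <= e.
Proof.
move=> ta tb ab; have l0 : 0 < b - a by rewrite subr_gt0.
rewrite [`|a - t|]ler0_norm ?subr_le0 // [`|b - t|]ger0_norm ?subr_ge0 // => h1 h2.
have -> : (B - A) / (b - a) - L = ((B - L * (b - t)) - (A - L * (a - t))) / (b - a).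
  by field; rewrite gt_eqF.
rewrite normrM normfV (gtr0_norm l0) ler_pdivrMr //.
apply: (le_trans (ler_normB _ _)).
have -> : e * (b - a) = e * (b - t) + e * - (a - t) by ring.
exact: lerD.
Qed.

Lemma slope_small s t A L e w : 0 < `|s - t| -> `|A - L * (s - t)| <= e * `|s - t| -> `|A| <= w -> w <= e * `|s - t| -> `|L| <= 2 * e.
Proof.
move=> r0 h1 h2 h3; have h4 := lerB_dist (L * (s - t)) A; rewrite distrC in h4.
rewrite -(ler_pM2r r0) -normrM -mulrA.
move: h1 h2 h3 h4; move: (`|_ * _|) (`|_ - _ * _|) `|A| (e * _) => x y z u.
by lra.
Qed.

(** Smallness of the oscillation replaces smallness of the piece. If both ends are within [r'] of
    [t], differentiability at [t] applies. Otherwise [F] moves by at most [w] over a distance [r']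
    from [t], which makes [derive1 F t] small, and the slope over the piece, longer than [r'], is
    small as well. *)
Lemma slope_conv F t e : derivable F t 1 -> 0 < t < 1 -> 0 < e ->
  exists2 w, 0 < w & exists2 d, 0 < d &
  [/\ forall a b, a <= t <= b -> a < b -> osc F a b w -> `|(F b - F a) / (b - a) - derive1 F t| <= e,
      forall u, u <= d -> osc F u t w -> `|derive1 F t| <= e &
      forall v, 1 - d <= v -> osc F t v w -> `|derive1 F t| <= e].
Proof.
move=> dF /andP[t0 t1] e0.
have e40 : 0 < e / 4 by rewrite divr_gt0.
have [r r0 Hr] := derive_linear dF e40.
set L := derive1 F t in Hr *.
pose r' : R := Num.min r (Num.min t (1 - t) / 2).
have m0 : 0 < Num.min t (1 - t) by rewrite lt_min t0 subr_gt0.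
have r'0 : 0 < r' by rewrite lt_min r0 divr_gt0.
have r'r : r' <= r by rewrite ge_min lexx.
have r't : r' <= t / 2.
  by rewrite ge_min; apply/orP; right; apply: ler_wpM2r; [rewrite invr_ge0|rewrite ge_min lexx].
have r't1 : r' <= (1 - t) / 2.
  by rewrite ge_min; apply/orP; right; apply: ler_wpM2r; [rewrite invr_ge0|rewrite ge_min lexx orbT].
have far s w : `|s - t| = r' -> `|F s - F t| <= w -> w <= e / 4 * r' -> `|L| <= e / 2.
  move=> E h1 h2; have -> : e / 2 = 2 * (e / 4) by field.
  have st : `|s - t| <= r by rewrite E.
  by apply: (@slope_small s t (F s - F t) L (e / 4) w) => //; rewrite ?E // -E; exact: Hr.
have w0 : 0 < e / 4 * r' by rewrite mulr_gt0.
exists (e / 4 * r') => //; exists r' => //; split.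
- move=> a b /andP[a_t tb] ab H.
  have [ar|ar] := leP (t - a) r'; last first.
    have HL : `|L| <= e / 2.
      have E : `|(t - r') - t| = r' by rewrite addrC addKr normrN gtr0_norm.
      by apply: (far (t - r') (e / 4 * r') E) => //; apply: H; apply/andP; split; lra.
    have HS : `|(F b - F a) / (b - a)| <= e / 4.
      rewrite normrM normfV (@gtr0_norm _ (b - a)) ?subr_gt0 // ler_pdivrMr ?subr_gt0 //.
      apply: (le_trans (H b a _ _)); [by rewrite lexx (ltW ab)|by rewrite lexx (ltW ab)|].
      by apply: ler_wpM2l; lra.
    by apply: (le_trans (ler_normB _ _)); lra.
  have [br|br] := leP (b - t) r'; last first.
    have HL : `|L| <= e / 2.
      have E : `|(t + r') - t| = r' by rewrite addrC addKr gtr0_norm.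
      by apply: (far (t + r') (e / 4 * r') E) => //; apply: H; apply/andP; split; lra.
    have HS : `|(F b - F a) / (b - a)| <= e / 4.
      rewrite normrM normfV (@gtr0_norm _ (b - a)) ?subr_gt0 // ler_pdivrMr ?subr_gt0 //.
      apply: (le_trans (H b a _ _)); [by rewrite lexx (ltW ab)|by rewrite lexx (ltW ab)|].
      by apply: ler_wpM2l; lra.
    by apply: (le_trans (ler_normB _ _)); lra.
  apply: (@le_trans _ _ (e / 4)); last by lra.
  have -> : F b - F a = (F b - F t) - (F a - F t) by ring.
  apply: (@slope_combine a b t) => //; apply: Hr.
    by rewrite ler0_norm ?subr_le0 // opprB (le_trans ar).
  by rewrite ger0_norm ?subr_ge0 // (le_trans br).
- move=> u ud H; apply: (@le_trans _ _ (e / 2)); last by lra.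
  have E : `|(t - r') - t| = r' by rewrite addrC addKr normrN gtr0_norm.
  by apply: (far (t - r') (e / 4 * r') E) => //; apply: H; apply/andP; split; lra.
- move=> v vd H; apply: (@le_trans _ _ (e / 2)); last by lra.
  have E : `|(t + r') - t| = r' by rewrite addrC addKr gtr0_norm.
  by apply: (far (t + r') (e / 4 * r') E) => //; apply: H; apply/andP; split; lra.
Qed.

(* Young's inequality against the constant 1 *)
Lemma powR_bernoulli p x : 1 <= p -> 0 <= x -> 1 + p * (x - 1) <= x `^ p.
Proof.
rewrite le_eqVlt => /orP[/eqP <-|p1] x0; first by rewrite powRr1 //; lra.
have p0 : 0 < p by lra.
have q0 : 0 < p / (p - 1) by rewrite divr_gt0 // subr_gt0.
have := @conjugate_powR R x 1 p (p / (p - 1)) x0 ler01 p0 q0.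
have -> : p^-1 + (p / (p - 1))^-1 = 1 by field; rewrite gt_eqF //; lra.
move=> /(_ erefl); rewrite powR1 mulr1.
have -> : 1 / (p / (p - 1)) = 1 - p^-1 by field; rewrite !gt_eqF //; lra.
move=> h; have := ler_wpM2l (ltW p0) h.
have -> : p * (x `^ p / p + (1 - p^-1)) = x `^ p + p - 1 by field; rewrite gt_eqF.
by lra.
Qed.

(** Integrate the tangent inequality [g^p >= s^p (1 + p (g/s - 1))], which is [powR_bernoulli] at
    [g/s]. *)
Lemma jensen_piece p g a b (s : R) : 1 <= p -> a < b -> (forall t, 0 <= g t) -> L1 `]a, b] g -> L1 `]a, b] (fun t => g t `^ p) ->
  0 <= s -> s * (b - a) <= \int[mu]_(t in `]a, b]) g t -> s `^ p * (b - a) <= \int[mu]_(t in `]a, b]) (g t `^ p).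
Proof.
move=> p1 ab g0 Ig Igp; rewrite le_eqVlt => /orP[/eqP <- _|s0 h].
  rewrite powR0; last by rewrite gt_eqF //; lra.
  by rewrite mul0r; apply: Rintegral_ge0 => t _; exact: powR_ge0.
have mab : fine (mu `]a, b]) = b - a by rewrite lebesgue_measure_itv /= lte_fin ab.
pose c := s `^ p.
have c0 : 0 < c by rewrite powR_gt0.
have Ic (k : R) : L1 `]a, b] (fun=> k) by exact: L1_cont_oc (fun=> @cst_continuous _ _ _ _).
apply: (@le_trans _ _ (\int[mu]_(t in `]a, b]) (c * (1 - p) + c * (p / s) * g t))).
  rewrite RintegralD //; [|exact: Ic|exact: L1Z].
  rewrite Rintegral_cst // mab RintegralZl // -/c.
  have h2 : c * (p / s) * (s * (b - a)) <= c * (p / s) * \int[mu]_(t in `]a, b]) g t.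
    by apply: ler_wpM2l => //; rewrite !mulr_ge0 ?invr_ge0 ?ltW //; lra.
  apply: le_trans (lerD (lexx _) h2).
  rewrite le_eqVlt; apply/orP; left; apply/eqP; field; by rewrite gt_eqF.
apply: le_Rintegral => //; first by apply: L1D => //; exact: L1Z.
move=> t _; have := powR_bernoulli p1 (divr_ge0 (g0 t) (ltW s0)).
rewrite powRM // ?invr_ge0 ?(ltW s0) //.
have -> : (s^-1) `^ p = c^-1 by rewrite -[s^-1]powR_inv1 ?(ltW s0) // -powRrM mulN1r powRN.
move=> h2; have := ler_wpM2l (ltW c0) h2.
have -> : c * (g t `^ p * c^-1) = g t `^ p by field; rewrite gt_eqF.
move=> h3; apply: le_trans h3; rewrite le_eqVlt; apply/orP; left; apply/eqP; field; by rewrite gt_eqF.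
Qed.
End SlopeConv.

(** * From convergence almost everywhere to convergence in L^p *)

Section Scheffe.
Variable R : realType.
Notation mu := (@lebesgue_measure R).
Notation TR := (measurableTypeR R).
Implicit Types (F f g h : R -> R) (a b t x y p e : R).

Lemma ae_mono (P Q : R -> Prop) : (forall t, P t -> Q t) -> {ae mu, forall t, P t} -> {ae mu, forall t, Q t}.
Proof. by move=> PQ; apply: (@negligibleS _ TR _ mu); apply: subsetC => t /PQ. Qed.

Lemma ae_and (P Q : R -> Prop) : {ae mu, forall t, P t} -> {ae mu, forall t, Q t} -> {ae mu, forall t, P t /\ Q t}.
Proof.
move=> hP hQ; apply: (@negligibleS _ TR _ mu _ _ _ (@negligibleU _ TR _ mu _ _ hP hQ)).
by rewrite -setCI; apply: subsetC => t [].
Qed.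

(** [powR_bernoulli] at [y/x] gives the Lipschitz bound [p M^(p-1)] for powers on [[0, M]], which
    covers the limit 0 too. *)
Lemma powR_cvg (a : nat -> R) (l : R) p : 1 <= p -> (forall n, 0 <= a n) -> 0 <= l -> a @ \oo --> l ->
  (fun n => a n `^ p) @ \oo --> l `^ p.
Proof.
move=> p1 a0 l0 cv.
have lip M x y : 0 <= y -> y <= x -> 0 < x -> x <= M -> x `^ p - y `^ p <= p * M `^ (p - 1) * (x - y).
  move=> y0 yx x0 xM; have := powR_bernoulli p1 (divr_ge0 y0 (ltW x0)).
  rewrite powRM ?invr_ge0 ?(ltW x0) //.
  have -> : (x^-1) `^ p = (x `^ p)^-1 by rewrite -[x^-1]powR_inv1 ?(ltW x0) // -powRrM mulN1r powRN.
  have c0 : 0 < x `^ p by rewrite powR_gt0.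
  move=> /(ler_wpM2l (ltW c0)); rewrite mulrCA mulfV ?gt_eqF // mulr1 => h.
  have E : x `^ p = x `^ (p - 1) * x.
    by rewrite -{3}[x]powRr1 ?(ltW x0) // -powRD ?subrK // (gt_eqF x0) implybT.
  have h2 : x `^ (p - 1) <= M `^ (p - 1).
    by apply: ge0_ler_powR => //; rewrite ?subr_ge0 ?nnegrE ?(ltW x0) ?(le_trans (ltW x0)).
  have h3 : x `^ p * (1 + p * (y / x - 1)) = x `^ p - p * x `^ (p - 1) * (x - y).
    by rewrite {1}E [in RHS]E; field; rewrite gt_eqF.
  rewrite h3 in h.
  have h4 : p * x `^ (p - 1) * (x - y) <= p * M `^ (p - 1) * (x - y).
    apply: ler_wpM2r; first by rewrite subr_ge0.
    by apply: ler_wpM2l => //; lra.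
  by move: h h4; lra.
pose C := p * (l + 1) `^ (p - 1) + 1.
have C0 : 0 < C by rewrite ltr_wpDl // mulr_ge0 ?powR_ge0 //; lra.
apply/cvgrPdist_le => e e0.
have d0 : 0 < Num.min 1 (e / C) by rewrite lt_min ltr01 divr_gt0.
move/cvgrPdist_le: cv => /(_ _ d0); apply: filterS => n; rewrite le_min => /andP[h1 h2].
rewrite ler_pdivlMr // in h2; apply: le_trans h2.
have C1 x y : 0 <= y -> y <= x -> x <= l + 1 -> x `^ p - y `^ p <= (x - y) * C.
  move=> y0 yx xl; have [x0|x0] := ltP 0 x; last first.
    have -> : x = y by lra. by rewrite !subrr mul0r.
  apply: (le_trans (lip _ _ _ y0 yx x0 xl)); rewrite /C [leRHS]mulrDr mulr1 [leLHS]mulrC lerDl subr_ge0 //.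
have p0 : 0 <= p by lra.
have [la|al] := leP (a n) l.
  rewrite ger0_norm; last by rewrite subr_ge0; apply: ge0_ler_powR => //; rewrite nnegrE.
  by rewrite [`|l - a n|]ger0_norm ?subr_ge0 //; apply: C1 => //; lra.
rewrite distrC ger0_norm; last by rewrite subr_ge0; apply: ge0_ler_powR; rewrite ?nnegrE ?(ltW al).
rewrite distrC ger0_norm ?subr_ge0 ?(ltW al) //; apply: C1 => //; first exact: ltW.
by move: h1; rewrite distrC ler_norml => /andP[_]; lra.
Qed.

Lemma Rintegral_dct (D : set TR) (f_ : nat -> R -> R) f (G : R -> R) : measurable D ->
  (forall n, measurable_fun D (f_ n)) -> measurable_fun D f -> L1 D G ->
  {ae mu, forall t, D t -> (fun n => f_ n t) @ \oo --> f t} ->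
  (forall n t, D t -> `|f_ n t| <= G t) ->
  (fun n => \int[mu]_(t in D) f_ n t) @ \oo --> \int[mu]_(t in D) f t.
Proof.
move=> mD mf_ mf IG cv dom.
have cv' : {ae mu, forall t, D t -> (fun n => (EFin \o f_ n) t) @ \oo --> (EFin \o f) t}.
  by apply: ae_mono cv => t Ht Dt; apply: cvg_EFin; [exact: nearW|exact: Ht].
have dom' : {ae mu, forall t n, D t -> (`|(EFin \o f_ n) t| <= (EFin \o G) t)%E}.
  by apply: aeW => t n Dt; rewrite lee_fin; exact: dom.
have [If _ h] := @dominated_convergence _ TR R mu D mD (fun n => EFin \o f_ n) (EFin \o f) (EFin \o G)
  (fun n => (measurable_EFinP _ _).2 (mf_ n)) ((measurable_EFinP _ _).2 mf) cv' IG dom'.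
apply: fine_cvg; rewrite fineK //; exact: (integrable_fin_num mD If).
Qed.

Lemma scheffe_arith x y K L e : `|y + y - K| <= e / 2 -> K <= x + y - L -> x <= y + e / 2 -> L <= e.
Proof. by rewrite ler_norml => /andP[_]; lra. Qed.

(** The functions [h n] are nonnegative and tend to [H]. Cutting them off at [H] allows dominated
    convergence, so the integral of [h n] is in the limit at least that of [H]; the bound on the
    norms of [D n] then leaves nothing for the integral of [|D n - g|^p]. *)
Lemma scheffe p (D : nat -> R -> R) g : 1 <= p -> (forall n, isLp p (D n)) -> isLp p g ->
  {ae mu, forall t, @I01 R t -> (fun n => D n t) @ \oo --> g t} ->
  (forall e, 0 < e -> exists N, forall n, (N <= n)%N -> lp p (D n) <= lp p g + e) ->
  forall e, 0 < e -> exists N, forall n, (N <= n)%N -> lp p (fun t => D n t - g t) <= e.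
Proof.
move=> p1 lD lg cv bd e e0.
pose c : R := 2 `^ p; have c0 : 0 < c by rewrite powR_gt0.
pose H t := c * (`|g t| `^ p + `|g t| `^ p).
pose h n t := c * (`|D n t| `^ p + `|g t| `^ p) - `|D n t - g t| `^ p.
pose k n t := Num.min (h n t) (H t).
have IG := isLp_powR p1 lg.
have IH : L1 (@I01 R) H by apply: L1Z => //; exact: L1D.
have lDg n : isLp p (fun t => D n t - g t).
  have := isLp_lin (-1) p1 lg (lD n); congr isLp.
  by apply/funext => t; rewrite mulN1r addrC.
have Ih n : L1 (@I01 R) (h n).
  exact: (L1B (@measurable_I01 R) (L1Z c (@measurable_I01 R) (L1D (@measurable_I01 R) (isLp_powR p1 (lD n)) IG)) (isLp_powR p1 (lDg n))).
have h0 n t : 0 <= h n t.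
  rewrite subr_ge0; apply: (le_trans (powR_addle _ _ p1)); by rewrite normrN.
have H0 t : 0 <= H t by rewrite mulr_ge0 ?(ltW c0) // addr_ge0 ?powR_ge0.
have mk n : measurable_fun (@I01 R : set TR) (k n) by apply: measurable_minr; exact: L1_measurable.
have kH n t : `|k n t| <= H t.
  by rewrite ger0_norm ?le_min ?h0 ?H0 // ge_min lexx orbT.
have cvk : (fun n => \int[mu]_(t in @I01 R) k n t) @ \oo --> \int[mu]_(t in @I01 R) H t.
  apply: (@Rintegral_dct _ _ _ H) => //; first exact: L1_measurable.
  apply: ae_mono cv => t Ht It; have Dt := Ht It.
  have hH : (fun n => h n t) @ \oo --> H t.
    rewrite -[H t]subr0; apply: cvgB.
      apply: cvgM; first exact: cvg_cst.
      apply: cvgD; last exact: cvg_cst.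
      by apply: powR_cvg => //; exact: cvg_norm.
    have -> : (0 : R) = 0 `^ p by rewrite powR0 // gt_eqF //; lra.
    apply: powR_cvg => //; rewrite -(normr0 R) -(subrr (g t)); apply: cvg_norm.
    by apply: cvgB => //; exact: cvg_cst.
  apply/cvgrPdist_le => d d0; move/cvgrPdist_le: hH => /(_ d d0); apply: filterS => n.
  apply: le_trans; rewrite /k; case: (leP (h n t) (H t)) => // _; by rewrite subrr normr0.
have eps0 : 0 < e / 2 by rewrite divr_gt0.
have eps1 : 0 < e / (2 * c) by rewrite divr_gt0 // mulr_gt0.
have [N1 H1] := bd _ eps1.
move/cvgrPdist_le: cvk => /(_ _ eps0) [N2 _ H2].
exists (maxn N1 N2) => n; rewrite geq_max => /andP[n1 n2].
have {}H1 := H1 n n1; have {}H2 := H2 n n2.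
have E1 : \int[mu]_(t in @I01 R) H t = c * (lp p g + lp p g).
  by rewrite RintegralZl // ?RintegralD //; exact: L1D.
have ID := isLp_powR p1 (lD n); have IDg := isLp_powR p1 (lDg n).
have E2 : \int[mu]_(t in @I01 R) h n t = c * (lp p (D n) + lp p g) - lp p (fun t => D n t - g t).
  have IDD := L1D (@measurable_I01 R) ID IG.
  by rewrite RintegralB // ?RintegralZl // ?RintegralD //; exact: L1Z.
have E3 : \int[mu]_(t in @I01 R) k n t <= \int[mu]_(t in @I01 R) h n t.
  apply: le_Rintegral; [exact: measurable_I01|exact: (L1_le (@measurable_I01 R) (mk n) (fun t _ => kH n t) IH)|exact: Ih|].
  by move=> t _; rewrite ge_min lexx.
have h3 : c * lp p (D n) <= c * lp p g + e / 2.
  have -> : e / 2 = c * (e / (2 * c)) by field; rewrite gt_eqF.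
  by rewrite -mulrDr; apply: ler_wpM2l => //; exact: ltW.
rewrite E1 in H2; rewrite E2 in E3; move: H2 E3 h3.
rewrite !mulrDr; exact: scheffe_arith.
Qed.
End Scheffe.

(** * Slopes of the polygons against the derivative *)

Section Fits.
Variable R : realType.
Notation mu := (@lebesgue_measure R).
Notation TR := (measurableTypeR R).
Implicit Types (F f g h : R -> R) (a b t x y p e u v eta : R) (T w : nat -> R) (K : nat -> nat).

(** The accuracy of the n-th polygon: summable, so that Borel-Cantelli applies to the short
    pieces. *)
Definition hpow n : R := 1 / (2 ^ (n + 1))%:R.

Lemma hpow_gt0 n : 0 < hpow n.
Proof. by rewrite divr_gt0 // ltr0n expn_gt0. Qed.

Lemma hpow_le1 n : hpow n <= 1.
Proof. by rewrite /hpow ler_pdivrMr ?mul1r ?ler1n ?ltr0n expn_gt0. Qed.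

Lemma hpow_small e : 0 < e -> exists N, forall n, (N <= n)%N -> hpow n <= e.
Proof.
move=> e0; exists (Num.bound e^-1) => n Nn.
have c0 : 0 < (2 ^ (n + 1))%:R :> R by rewrite ltr0n expn_gt0.
rewrite /hpow ler_pdivrMr // mulrC -ler_pdivrMr // div1r.
apply: (le_trans (ltW (archi_boundP _))); first by rewrite invr_ge0 ltW.
rewrite ler_nat; apply: (leq_trans Nn); apply: ltnW; apply: leq_trans (ltn_expl n (ltnSn 1)) _.
by rewrite leq_exp2l // addn1.
Qed.

(** The conditions of [straightened] for one coordinate, after undoing the normalisation of the
    grid: the oscillation bound is now the accuracy [eta]. *)
Definition fits F u v eta N T w K : Prop :=
 [/\ [/\ (0 < N)%N, T 0%N = 0, T N = 1 & forall i, (i < N)%N -> T i < T i.+1],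
  (forall i, (i < N)%N -> K i = 0%N -> `|slope T w i - slope T (F \o T) i| <= eta),
  (forall i, (i < N)%N -> (0 < K i)%N -> `|slope T w i| <= eta),
  (forall i, (i < N)%N -> (K i < 2)%N -> osc F (T i) (T i.+1) eta) &
  (forall i, (i < N)%N -> (1 < K i)%N -> forall t, T i <= t <= T i.+1 -> u <= t <= v ->
     osc F u t eta \/ osc F t v eta) /\ \sum_(i < N | K i == 1%N) (T i.+1 - T i) <= eta].

Definition short_piece T K (i : nat) : set TR := if K i == 1%N then `]T i, T i.+1]%classic else set0.

Definition short_pieces N T K : set TR := \big[setU/set0]_(i < N) short_piece T K i.

Lemma short_pieces_measurable N T K : measurable (short_pieces N T K).
Proof. by apply: bigsetU_measurable => i _; rewrite /short_piece; case: ifP => _. Qed.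

Lemma short_pieces_le F u v eta N T w K : fits F u v eta N T w K -> (mu (short_pieces N T K) <= eta%:E)%E.
Proof.
move=> [[_ _ _ Tlt] _ _ _ [_ H]].
apply: (le_trans (le_mu_bigsetU _ _)).
  by move=> i _; rewrite /short_piece; case: ifP.
apply: (@le_trans _ _ (\sum_(i < N | K i == 1%N) (T i.+1 - T i))%:E); last by rewrite lee_fin.
rewrite -sumEFin [leRHS]big_mkcond /=; apply: lee_sum => i _; rewrite /short_piece; case: ifP => _.
  by rewrite lebesgue_measure_itv /= lte_fin Tlt // EFinB.
by rewrite measure0.
Qed.

Lemma piece_ex N T t : (forall i, (i < N)%N -> T i < T i.+1) -> T 0%N < t -> t <= T N -> exists2 i, (i < N)%N & T i < t <= T i.+1.
Proof.
elim: N => [|N IH] Tlt t0 tN; first by move: tN; rewrite leNgt t0.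
have [tN'|Nt] := leP t (T N).
  have [i iN Hi] := IH (fun i iN => Tlt i (leqW iN)) t0 tN'.
  by exists i => //; exact: leqW.
by exists N => //; rewrite Nt.
Qed.

Lemma isLp_patch p g : 1 <= p -> isLp p g -> isLp p (g \_ (@I01 R)).
Proof.
move=> p1 lg; have Ig := isLp_L1 p1 lg; have Igp := isLp_powR p1 lg.
have m : measurable_fun (@I01 R : set TR) (g \_ (@I01 R)).
  by apply: L1_measurable; apply: L1_patchD => //; exact: measurable_I01.
apply: powR_isLp => //; apply: L1_le (@measurable_I01 R) (measurable_powp _ m) _ Igp.
by move=> t It; rewrite patchE mem_set // ger0_norm ?powR_ge0.
Qed.

Lemma L1_oc01 h : measurable_fun (setT : set TR) h -> L1 (@I01 R) h -> L1 `]0, 1] h.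
Proof.
move=> mh Ih; apply: (@L1_le _ _ _ (fun t => `|(h \_ (@I01 R)) t| + `|h 1|)) => //.
- exact: measurable_funTS.
- move=> t; rewrite /= in_itv /= => /andP[t0]; rewrite le_eqVlt => /orP[/eqP ->|t1].
    by rewrite lerDr.
  by rewrite patchE mem_set ?lerDl //; apply/I01P; rewrite t0.
- apply: L1D => //; last exact: L1_cont_oc (fun=> @cst_continuous _ _ _ _).
  by apply: (@L1S _ setT) => //; apply: L1_norm; exact: L1_patchT (@measurable_I01 R) Ih.
Qed.

Lemma measurable_dinterp N T w : measurable_fun (setT : set TR) (dinterp N T w).
Proof.
rewrite /dinterp; apply: (@measurable_sum _ TR) => i; apply: measurable_funM; first exact: measurable_cst.
exact: meas_indf.
Qed.

Lemma fits_T01 F u v eta N T w K : fits F u v eta N T w K -> forall i, (i <= N)%N -> 0 <= T i <= 1.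
Proof.
move=> [[_ T0 TN Tlt] _ _ _ _] i iN; have Tm := T_mono Tlt.
by rewrite -T0 -TN !Tm.
Qed.

Lemma fits_isLp p F u v eta N T w K : 1 <= p -> fits F u v eta N T w K -> isLp p (dinterp N T w).
Proof.
move=> p1 H; have T01 := fits_T01 H; move: H => [[_ _ _ Tlt] _ _ _ _].
by case: (W1p_interp w p1 Tlt T01).
Qed.

(** On each piece the slope is in absolute value at most the mean of [|g| + eta]: a long piece
    nearly has the mean of [g] as slope, any other has slope at most [eta]. Jensen's inequality is
    then summed over the pieces. *)
Lemma fits_lp p g u v eta N T w K : 1 <= p -> 0 <= eta -> L1 setT g -> isLp p g -> fits (prim g) u v eta N T w K ->
  lp p (dinterp N T w) <= \int[mu]_(t in @I01 R) `| `|g t| + eta | `^ p.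
Proof.
move=> p1 eta0 Ig lg H; have T01 := fits_T01 H; have lD := fits_isLp p1 H.
move: H => [[N0 T0 TN Tlt] Hl Hs _ _]; have Tm := T_mono Tlt.
have pp : 0 <= p by lra.
pose D := dinterp N T w; pose G t := `|g t| + eta; pose Q t := `|G t| `^ p; pose P t := `|D t| `^ p.
have mG : measurable_fun (setT : set TR) G.
  by apply: measurable_funD; [exact: L1_measurable (L1_norm Ig)|exact: measurable_cst].
have lG : isLp p G.
  have n : isLp p (fun t => `|g t|).
    case: lg => mg fg; split; first by apply: measurableT_comp.
    by move: fg; rewrite /lpint; under eq_integral do rewrite -normr_id.
  have := isLp_lin 1 p1 n (bounded_isLp (M := `|eta|) pp (measurable_cst eta) (fun _ _ => lexx _)).
  by congr isLp; apply/funext => t; rewrite mul1r.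
have mQ : measurable_fun (setT : set TR) Q by exact: measurable_powp.
have mP : measurable_fun (setT : set TR) P by apply: measurable_powp; exact: measurable_dinterp.
have IQ1 := isLp_powR p1 lG; have IP1 := isLp_powR p1 lD.
have IQ : L1 `]0, 1] Q by exact: L1_oc01.
have IP : L1 `]0, 1] P by exact: L1_oc01.
rewrite /lp (I01_oc IP1) (I01_oc IQ1) -/P -/Q.
have subI (a b : R) : 0 <= a -> b <= 1 -> (`]a, b]%classic : set R) `<=` `]0, 1]%classic.
  by move=> a0 b1 t /=; rewrite !in_itv /= => /andP[h1 h2]; rewrite (le_lt_trans a0 h1) (le_trans h2).
have sub (h : R -> R) (a b : R) : L1 `]0, 1] h -> 0 <= a -> b <= 1 -> L1 `]a, b] h.
  by move=> Ih a0 b1; apply: L1S Ih => //; exact: subI.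
rewrite -{1 2}TN.
have : (N <= N)%N by []; move: {-2}N => k; elim: k => [|k IH] kN.
  by rewrite T0 set_itvxx !Rintegral_set0.
have {}IH := IH (ltnW kN).
have [/andP[a0 a1] /andP[b0 b1]] := (T01 k (ltnW kN), T01 k.+1 kN).
have ab := Tlt k kN.
rewrite (Rint_split (sub P 0 _ IP (lexx 0) b1) a0 (ltW ab)).
rewrite (Rint_split (sub Q 0 _ IQ (lexx 0) b1) a0 (ltW ab)).
apply: (lerD IH).
have mab : fine (mu `]T k, T k.+1]) = T k.+1 - T k by rewrite lebesgue_measure_itv /= lte_fin ab.
have Igk : L1 `]T k, T k.+1] g by exact: L1S Ig.
have IGk : L1 `]T k, T k.+1] G.
  by apply: L1D => //; [exact: L1_norm|exact: L1_cont_oc (fun=> @cst_continuous _ _ _ _)].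
have EG : \int[mu]_(t in `]T k, T k.+1]) G t = \int[mu]_(t in `]T k, T k.+1]) `|g t| + eta * (T k.+1 - T k).
  rewrite RintegralD ?Rintegral_cst ?mab //; [exact: L1_norm|].
  exact: L1_cont_oc (fun=> @cst_continuous _ _ _ _).
have Gn t : `|G t| = G t by rewrite ger0_norm // addr_ge0.
pose s := slope T w k.
have key : `|s| * (T k.+1 - T k) <= \int[mu]_(t in `]T k, T k.+1]) G t.
  have l0 : 0 < T k.+1 - T k by rewrite subr_gt0.
  have n0 : 0 <= \int[mu]_(t in `]T k, T k.+1]) `|g t| by apply: Rintegral_ge0.
  rewrite EG; have [K0|K0] := posnP (K k).
    have := Hl k kN K0; set sF := slope T (prim g \o T) k => h.
    have hF : `|sF| * (T k.+1 - T k) <= \int[mu]_(t in `]T k, T k.+1]) `|g t|.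
      have -> : sF = (prim g (T k.+1) - prim g (T k)) / (T k.+1 - T k) by [].
      rewrite normrM normfV (gtr0_norm l0) divfK ?gt_eqF // (primB Ig (ltW ab)).
      exact: RintegralS_norm.
    have hs : `|s| <= `|sF| + eta.
      have -> : s = sF + (s - sF) by ring.
      by apply: (le_trans (ler_normD _ _)); rewrite lerD2l.
    apply: (le_trans (ler_wpM2r (ltW l0) hs)); rewrite mulrDl; exact: lerD.
  apply: (le_trans (ler_wpM2r (ltW l0) (Hs k kN K0))).
  by rewrite lerDr.
apply: (@le_trans _ _ (`|s| `^ p * (T k.+1 - T k))).
  have Ec : \int[mu]_(t in `]T k, T k.+1]) (`|s| `^ p) = `|s| `^ p * (T k.+1 - T k).
    by rewrite Rintegral_cst ?mab.
  rewrite -Ec.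
  apply: le_Rintegral => //; [exact: sub|exact: L1_cont_oc (fun=> @cst_continuous _ _ _ _)|].
  by move=> t; rewrite /= in_itv /= => tk; rewrite /P /D (dinterp_piece w Tlt kN tk).
have E : Q = (fun t => G t `^ p) by apply/funext => t; rewrite /Q Gn.
have IQk := sub _ _ _ IQ a0 b1.
rewrite E in IQk *; apply: jensen_piece => //.
by move=> t; rewrite -Gn.
Qed.
End Fits.

Section FitsCvg.
Variable R : realType.
Notation mu := (@lebesgue_measure R).
Notation TR := (measurableTypeR R).
Implicit Types (F f g h : R -> R) (a b t x y p e u v eta : R).

Lemma shifted_lp p g (eta : nat -> R) : 1 <= p -> L1 setT g -> isLp p g -> (forall n, 0 <= eta n <= 1) -> eta @ \oo --> (0 : R) ->
  (fun n => \int[mu]_(t in @I01 R) `| `|g t| + eta n | `^ p) @ \oo --> lp p g.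
Proof.
move=> p1 Ig lg e01 e0; have p0 : 0 <= p by lra.
have mg : measurable_fun (@I01 R : set TR) (fun t => `|g t|) by case: lg => mg _; exact: measurableT_comp.
have IGp : L1 (@I01 R) (fun t => 2 `^ p * (`|g t| `^ p + 1 `^ p)).
  by apply: L1Z => //; apply: L1D => //; [exact: isLp_powR|exact: L1_cst01].
apply: (Rintegral_dct _ _ _ IGp) => //.
- by move=> n; apply: measurable_powp; apply: measurable_funD => //; exact: measurable_cst.
- by apply: measurable_powp; case: lg.
- apply: aeW => t _.
  have -> : `|g t| `^ p = `| `|g t| + 0 | `^ p by rewrite addr0 normr_id.
  apply: powR_cvg => //; apply: cvg_norm; apply: cvgD => //; exact: cvg_cst.
- move=> n t _; rewrite ger0_norm ?powR_ge0 //.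
  have /andP[h0 h1] := e01 n.
  apply: (le_trans (powR_addle _ _ p1)); rewrite normr_id.
  apply: ler_wpM2l; first exact: powR_ge0.
  by rewrite lerD2l; apply: ge0_ler_powR => //; rewrite ?nnegrE ?ger0_norm.
Qed.

Section Seq.
Variables (p : R) (g : R -> R) (u v : nat -> R) (N : nat -> nat) (T w : nat -> nat -> R) (K : nat -> nat -> nat).
Hypotheses (p1 : 1 <= p) (Ig : L1 setT g) (lg : isLp p g).
Hypothesis Hf : forall n, fits (prim g) (u n) (v n) (hpow R n) (N n) (T n) (w n) (K n).
Hypothesis Hu : forall n, u n <= hpow R n /\ 1 - hpow R n <= v n.

Let S n := short_pieces (N n) (T n) (K n).

(** Borel-Cantelli: the measures of the sets [S n] are bounded by the summable [hpow]. *)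
Lemma short_rare : {ae mu, forall t, exists M, forall n, (M <= n)%N -> ~ S n t}.
Proof.
have mS n : measurable (S n) := short_pieces_measurable (N n) (T n) (K n).
have m0 : mu (lim_sup_set S) = 0%R.
  apply: lim_sup_set_cvg0 => //.
  apply: (@le_lt_trans _ _ (\sum_(0 <= n <oo) (hpow R n)%:E)%E).
    by apply: lee_nneseries => [n _ _|n _]; [exact: measure_ge0|exact: short_pieces_le (Hf n)].
  have := @cvg_geometric_eseries_half R 1 0; move/cvg_lim; rewrite /eseries /= => -> //.
  by rewrite ltry.
have mL : measurable (lim_sup_set S).
  by apply: bigcapT_measurable => n; apply: bigcup_measurable => k _; exact: mS.
have := (negligibleP mu mL).2 m0; apply: (@negligibleS _ TR _ mu).
move=> t /= h; apply: contrapT => nl; apply: h; apply: contrapT => nM; apply: nl => n _.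
apply: contrapT => nb; apply: nM; exists n => k nk St; apply: nb; by exists k.
Qed.

(** Take [t] where the primitive is differentiable with derivative [g t], and which is in no short
    piece from some index on. In a long piece [slope_conv] applies; in an end piece the oscillation
    up to the end of [[u n, v n]] makes [g t] small, and the slope is small too. *)
Lemma fits_ae : {ae mu, forall t, @I01 R t -> (fun n => dinterp (N n) (T n) (w n) t) @ \oo --> g t}.
Proof.
apply: ae_mono (ae_and (prim_ae Ig) short_rare) => t [[dF E] [M1 HM1]] /I01P t01.
apply/cvgrPdist_le => e e0.
have e20 : 0 < e / 2 by rewrite divr_gt0.
have [om om0 [d d0 [C1 C2 C3]]] := slope_conv dF t01 e20; rewrite E in C1 C2 C3.
have m0 : 0 < Num.min (Num.min om d) (Num.min (e / 2) (Num.min t (1 - t))).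
  by case/andP: t01 => t0 t1; rewrite !lt_min om0 d0 e20 t0 subr_gt0.
have [M2 HM2] := hpow_small m0.
exists (maxn M1 M2) => // n /=; rewrite geq_max => /andP[/HM1 nS /HM2].
rewrite !le_min => /andP[/andP[h1 h2] /and3P[h3 h4 h5]].
have [[N0 T0 TN Tlt] Hl Hs Ho [He _]] := Hf n; have [un vn] := Hu n.
have /andP[t0 t1] := t01.
have [i iN ti] := @piece_ex R (N n) (T n) t Tlt ltac:(by rewrite T0) ltac:(by rewrite TN ltW).
rewrite (dinterp_piece _ Tlt iN ti).
have /andP[ti1 ti2] := ti; have tic : T n i <= t <= T n i.+1 by rewrite (ltW ti1).
have [K2|K2] := ltnP (K n i) 2; last first.
  have g2 : `|g t| <= e / 2.
    have tuv : u n <= t <= v n by apply/andP; split; [exact: le_trans un h4|by apply: le_trans vn; rewrite lerBrDl -lerBrDr].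
    case: (He i iN K2 t tic tuv) => H.
      by apply: (C2 (u n)); [exact: le_trans un h2|exact: osc_le h1 H].
    apply: (C3 (v n)); last exact: osc_le h1 H.
    by apply: le_trans vn; rewrite lerD2l lerN2.
  have s2 : `|slope (T n) (w n) i| <= e / 2 by apply: le_trans h3; apply: Hs => //; exact: leq_trans K2.
  by apply: (le_trans (ler_normB _ _)); rewrite [leRHS]splitr lerD.
have [K0|K1] := posnP (K n i).
  have a1 : `|slope (T n) (prim g \o T n) i - g t| <= e / 2.
    by apply: C1 => //; [exact: Tlt|exact: osc_le h1 (Ho i iN K2)].
  have a2 := le_trans (Hl i iN K0) h3.
  rewrite distrC; have -> : slope (T n) (w n) i - g t = (slope (T n) (w n) i - slope (T n) (prim g \o T n) i) + (slope (T n) (prim g \o T n) i - g t) by ring.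
  by apply: (le_trans (ler_normD _ _)); rewrite [leRHS]splitr lerD.
exfalso; apply: nS; rewrite /S /short_pieces -bigcup_mkord; exists i => //=.
have -> : short_piece (T n) (K n) i = `]T n i, T n i.+1]%classic.
  by rewrite /short_piece; have -> : K n i == 1%N by rewrite eqn_leq -ltnS K2.
by rewrite /= in_itv.
Qed.

Lemma fits_cvg e : 0 < e -> exists M, forall n, (M <= n)%N -> lp p (fun t => dinterp (N n) (T n) (w n) t - g t) <= e.
Proof.
apply: (scheffe p1 _ lg fits_ae) => [n|e' e'0]; first exact: fits_isLp p1 (Hf n).
have h01 n : 0 <= hpow R n <= 1 by rewrite hpow_le1 ltW // hpow_gt0.
have hc : hpow R @ \oo --> (0 : R).
  apply/cvgrPdist_le => d /hpow_small[M HM]; exists M => // n /= /HM.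
  by rewrite sub0r normrN ger0_norm // ltW // hpow_gt0.
have /cvgrPdist_le /(_ e' e'0) [M _ HM] := shifted_lp p1 Ig lg h01 hc.
exists M => n /HM; rewrite ler_norml => /andP[h _].
have := fits_lp p1 (ltW (hpow_gt0 R n)) Ig lg (Hf n) => h2; apply: (le_trans h2).
by move: h; move: (lp p g) (\int[mu]_(t in _) _) => x y; lra.
Qed.
End Seq.
End FitsCvg.

(** * Grids in general position *)

Section Indicatrix.
Variable R : realType.
Notation mu := (@lebesgue_measure R).
Notation TR := (measurableTypeR R).

Section OneFunction.
Variables (F G : R -> R) (u v : R).
Hypothesis uv : u < v.
Hypothesis FG : forall x y, u <= x -> x <= y -> y <= v -> `|F y - F x| <= G y - G x.

Let x_ (n i : nat) : R := u + (v - u) * (i%:R / n.+1%:R).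
Let d_ n i : R := G (x_ n i.+1) - G (x_ n i).
(** By the choice of [d_], this interval contains the image of the i-th piece; counting the
    intervals that contain [c] bounds the number of pieces that meet the level. *)
Let A n i : set TR := `[F (x_ n i) - d_ n i, F (x_ n i) + d_ n i]%classic.
Let cnt n c : \bar R := (\sum_(i < n.+1) (\1_(A n i) c)%:E)%E.

Let xS n i : x_ n i < x_ n i.+1.
Proof.
by rewrite /x_ ltrD2l ltr_pM2l ?subr_gt0 // ltr_pM2r ?invr_gt0 ?ltr0n // ltr_nat.
Qed.

Let xstep n i : x_ n i.+1 - x_ n i = (v - u) / n.+1%:R.
Proof.
have : n.+1%:R != 0 :> R by rewrite pnatr_eq0.
by rewrite /x_ -(natr1 i); move: (n.+1%:R : R) => k k0; field.
Qed.

Let x0 n : x_ n 0 = u.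
Proof. by rewrite /x_ mul0r mulr0 addr0. Qed.

Let xN n : x_ n n.+1 = v.
Proof. by rewrite /x_ divff ?pnatr_eq0 // mulr1 addrC subrK. Qed.

Let xuv n i : (i <= n.+1)%N -> u <= x_ n i <= v.
Proof.
have vu : 0 < v - u by rewrite subr_gt0.
move=> ni; rewrite /x_ lerDl mulr_ge0 ?(ltW vu) ?divr_ge0 ?ler0n //=.
rewrite -lerBrDl ler_piMr ?(ltW vu) // ler_pdivrMr ?ltr0n // mul1r ler_nat //.
Qed.

Let d_ge0 n i : (i < n.+1)%N -> 0 <= d_ n i.
Proof.
move=> ni; have /andP[h1 _] := xuv (ltnW ni); have /andP[_ h2] := xuv ni.
by apply: le_trans (FG h1 (ltW (xS n i)) h2).
Qed.

Let int_cnt n : (\int[mu]_c cnt n c = ((G v - G u) *+ 2)%:E)%E.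
Proof.
rewrite ge0_integral_sum //; last first.
  by move=> i; apply/measurable_EFinP; apply: measurable_indic; exact: measurable_set_itv.
transitivity (\sum_(i < n.+1) (d_ n i *+ 2)%:E)%E.
  apply: eq_bigr => i _; rewrite integral_indic //; last exact: measurable_set_itv.
  rewrite setIT; transitivity (mu (`[F (x_ n i) - d_ n i, F (x_ n i) + d_ n i]%classic : set R)) => //.
  rewrite lebesgue_measure_itv /= lte_fin.
  have d0 := d_ge0 (ltn_ord i); have [h|h] := ltP (F (x_ n i) - d_ n i) (F (x_ n i) + d_ n i).
    by rewrite -EFinD; congr (_%:E); rewrite mulr2n; ring.
  have -> : d_ n i = 0 by lra.
  by rewrite mul0rn.
rewrite sumEFin sumrMnl; congr ((_ *+ 2)%:E).
have -> : \sum_(i < n.+1) d_ n i = G (x_ n n.+1) - G (x_ n 0).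
  by rewrite -(big_mkord xpredT (d_ n)) telescope_sumr.
by rewrite x0 xN.
Qed.

(** Once the mesh is below the least gap, distinct solutions lie in distinct pieces. *)
Let cnt_ge (s : seq R) c : uniq s -> (forall t, t \in s -> u < t <= v /\ F t = c) ->
  exists M, forall n, (M <= n)%N -> ((size s)%:R%:E <= cnt n c)%E.
Proof.
move=> us Hs.
have [r r0 Hr] : exists2 r : R, 0 < r & forall t t', t \in s -> t' \in s -> t != t' -> r <= `|t - t'|.
  have [|r r0 Hr] := @eventually_all R _ (allpairs pair s s) (fun q r => q.1 != q.2 -> r <= `|q.1 - q.2|); last first.
    exists r => // t t' ts ts'; apply: (Hr r _ (t, t')); first by rewrite r0 lexx.
    by apply/allpairsP; exists (t, t').
  move=> q _; have [->|nq] := eqVneq q.1 q.2; first by exists 1 => // r' _; rewrite eqxx.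
  exists `|q.1 - q.2|; first by rewrite normr_gt0 subr_eq0.
  by move=> r' /andP[].
exists (Num.bound ((v - u) / r)) => n Mn.
have vu : 0 < v - u by rewrite subr_gt0.
have small : (v - u) / n.+1%:R < r.
  rewrite ltr_pdivrMr ?ltr0n // mulrC -ltr_pdivrMr //.
  apply: (lt_le_trans (archi_boundP _)); first by rewrite divr_ge0 // ltW.
  by rewrite ler_nat; exact: leqW.
have /choice[idx Hidx] : forall t, exists i, t \in s -> (i < n.+1)%N && (x_ n i < t <= x_ n i.+1).
  move=> t; have [ts|] := boolP (t \in s); last by exists 0%N.
  have [/andP[ut tv] _] := Hs t ts.
  have [||i iN Hi] := @piece_ex R n.+1 (x_ n) t (fun i _ => xS n i).
  - by rewrite x0.
  - by rewrite xN.
  - by exists i; rewrite iN Hi.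
pose l := [seq i <- iota 0 n.+1 | c \in A n i].
have sz : (size s <= size l)%N.
  rewrite -(size_map idx); apply: uniq_leq_size.
    rewrite map_inj_in_uniq // => t t' ts ts' E; apply/eqP; apply: contraT => ne.
    have /andP[_ /andP[h1 h2]] := Hidx t ts; have /andP[_ /andP[h3 h4]] := Hidx t' ts'.
    have := Hr t t' ts ts' ne; rewrite leNgt => /negP; case.
    apply: le_lt_trans small; rewrite -(xstep n (idx t)) -E in h3 h4 *.
    by rewrite ler_norml; apply/andP; split; lra.
  move=> i /mapP[t ts ->]; have /andP[iN /andP[h1 h2]] := Hidx t ts.
  rewrite mem_filter mem_iota add0n iN leq0n !andbT; apply/mem_set.
  have [_ <-] := Hs t ts.
  have /andP[a1 _] := xuv (ltnW iN); have /andP[_ a2] := xuv iN.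
  have k1 := FG a1 (ltW h1) (le_trans h2 a2).
  have k2 : `|F (x_ n (idx t).+1) - F t| <= G (x_ n (idx t).+1) - G t.
    by apply: FG => //; exact: le_trans a1 (ltW h1).
  have k3 : 0 <= G (x_ n (idx t).+1) - G t := le_trans (normr_ge0 _) k2.
  rewrite /A /= in_itv /= /d_; move: k1; rewrite ler_norml => /andP[b1 b2].
  by apply/andP; split; lra.
rewrite /cnt sumEFin lee_fin; apply: (@le_trans _ _ (size l)%:R); first by rewrite ler_nat.
have -> : \sum_(i < n.+1) \1_(A n i) c = (\sum_(i < n.+1) (c \in A n i : nat))%:R :> R.
  by rewrite natr_sum; apply: eq_bigr => i _; rewrite indicE.
rewrite ler_nat -(big_mkord xpredT (fun i => (c \in A n i : nat))) /= size_filter.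
by rewrite -sum1_count big_mkcond /= /index_iota subn0; apply: leq_sum => i _; case: ifP.
Qed.

(* Banach's indicatrix: by Fatou, the number of pieces of a partition meeting the level c
   stays bounded along a sequence of partitions, for almost every c. *)
Lemma level_finite : {ae mu, forall c, finite_set [set t | u <= t <= v /\ F t = c]}.
Proof.
have mcnt n : measurable_fun (setT : set TR) (cnt n).
  by apply: emeasurable_sum => i; apply/measurable_EFinP; apply: measurable_indic; exact: measurable_set_itv.
have cnt0 n c : (0 <= cnt n c)%E.
  by apply: sume_ge0 => i _; rewrite lee_fin indicE.
pose h c := limn_einf (cnt ^~ c).
have mh : measurable_fun (setT : set TR) h.
  rewrite /h /limn_einf; apply: measurableT_comp => //.
  apply: (@measurable_fun_limn_esup _ TR _ _ (fun n c => - cnt n c)%E) => n.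
  exact: measurableT_comp.
have h0 c : (0 <= h c)%E.
  rewrite /h limn_einf_lim; apply: lime_ge; first exact: is_cvg_einfs.
  by apply: nearW => n; apply/ereal_infP => y [k _ <-].
have Ih : mu.-integrable (setT : set TR) h.
  apply/integrableP; split => //.
  rewrite (eq_integral h); last by move=> c _; rewrite gee0_abs.
  apply: (@le_lt_trans _ _ ((G v - G u) *+ 2)%:E); last exact: ltry.
  apply: (le_trans (@fatou _ TR R mu setT measurableT cnt mcnt (fun n c _ => cnt0 n c))).
  have -> : (fun n => \int[mu]_(c in (setT : set TR)) cnt n c)%E = (fun=> ((G v - G u) *+ 2)%:E).
    by apply/funext => n; exact: int_cnt.
  by rewrite (cvg_limn_einf_sup (cvg_cst _)).1.
apply: ae_mono (integrable_ae measurableT Ih) => c /(_ I) hfin.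
apply: contrapT => inf.
(* The pieces are half-open, so the time [u] belongs to none and is set aside. *)
have inf' : infinite_set [set t | u < t <= v /\ F t = c].
  move=> fin; apply: inf; apply: (@sub_finite_set _ _ ([set t | u < t <= v /\ F t = c] `|` [set u])).
    move=> t /= [/andP[]]; rewrite le_eqVlt => /orP[/eqP <-|ut] tv E; [by right|left].
    by rewrite ut.
  by rewrite finite_setU; split => //; exact: finite_set1.
pose m := Num.bound (fine (h c)).
have [B HB szB] := infinite_set_fset m.+1 inf'.
have [M HM] := cnt_ge (finmap.fset_uniq B) (fun t tB => HB t tB).
have : (m.+1%:R%:E <= h c)%E.
  rewrite /h limn_einf_lim; apply: lime_ge; first exact: is_cvg_einfs.
  exists M => // n /= Mn; apply/ereal_infP => y [k nk <-].
  apply: le_trans (HM k (leq_trans Mn nk)).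
  by rewrite lee_fin ler_nat.
rewrite -(fineK hfin) lee_fin => hm.
have := archi_boundP (fine_ge0 (h0 c)); rewrite -/m => hm2.
have := le_lt_trans hm hm2; by rewrite ltr_nat ltnNge leqnSn.
Qed.
End OneFunction.

Lemma ae_forall_countable (I : countType) (P : I -> R -> Prop) :
  (forall i, {ae mu, forall t, P i t}) -> {ae mu, forall t, forall i, P i t}.
Proof.
move=> H; have H' n : {ae mu, forall t, if unpickle n is Some i then P i t else True}.
  by case: (unpickle n) => [i|]; [exact: H|exact: (aeW (T := TR))].
apply: (@negligibleS _ TR _ mu _ _ _ (negligible_bigcup H')).
move=> t /= nP; apply: contrapT => nb; apply: nP => i; apply: contrapT => nPi; apply: nb.
by exists (pickle i) => //=; rewrite pickleK.
Qed.

Lemma ae_ex (P : R -> Prop) : {ae mu, forall t, P t} -> exists t, P t.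
Proof.
move=> H; apply: contrapT => nP.
have : mu.-negligible (setT : set TR).
  by apply: (@negligibleS _ TR _ mu _ _ _ H) => t _ /= Pt; apply: nP; exists t.
move=> /(negligibleP mu measurableT).1.
have : (mu (`]0%R, 1%R[%classic : set R) <= mu setT)%E.
  by apply: le_measure => //; rewrite inE; [exact: measurable_I01|exact: measurableT].
by rewrite lebesgue_measure_itv /= lte_fin ltr01 oppr0 adde0 => + E; rewrite E lee_fin ler10.
Qed.

Lemma finite_absz (M : nat) : finite_set [set m : int | (absz m <= M)%N].
Proof.
apply: (@sub_finite_set _ _ ([set Posz n | n in `I_M.+1] `|` [set Negz n | n in `I_M.+1])).
  by move=> [n|n] /= h; [left|right]; exists n => //=; rewrite ltnS // ltnW.
by rewrite finite_setU; split; apply: finite_image; exact: finite_II.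
Qed.

(** Almost every [c] serves all the countably many pairs of a curve and a line. Each curve is
    bounded, so only finitely many lines count, and its hits form a finite union of finite sets. *)
Lemma generic_offset (f G : nat -> R -> R) (u v delta : R) : u < v -> 0 < delta ->
  (forall k x y, u <= x -> x <= y -> y <= v -> `|f k y - f k x| <= G k y - G k x) ->
  exists c, forall k, finite_set [set t | u <= t <= v /\ odd_line ((f k t - c) / delta)].
Proof.
move=> uv d0 FG.
have [c Hc] : exists c, forall q : nat * int, finite_set [set t | u <= t <= v /\ f q.1 t - delta * (2 * q.2%:~R + 1) = c].
  apply: ae_ex; apply: ae_forall_countable => -[k m] /=.
  apply: (@level_finite (fun t => f k t - delta * (2 * m%:~R + 1)) (G k)) => // x y ux xy yv.
  by rewrite opprB addrA subrK; exact: FG.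
exists c => k.
pose B := (`|f k u| + (G k v - G k u) + `|c|) / delta.
apply: (@sub_finite_set _ _ (\bigcup_(m in [set m : int | (absz m <= Num.bound B)%N])
  [set t | u <= t <= v /\ f k t - delta * (2 * m%:~R + 1) = c])); last first.
  by apply: bigcup_finite => [|m _]; [exact: finite_absz|exact: (Hc (k, m))].
move=> t /= [tuv [m E]].
have {}E : f k t - c = delta * (2 * m%:~R + 1) by rewrite -E; field; rewrite gt_eqF.
exists m; last by split => //; rewrite -E opprB addrCA subrr addr0.
have /andP[ut tv] := tuv.
have h1 := FG k u t (lexx u) ut tv.
have h2 : G k t - G k u <= G k v - G k u.
  by rewrite lerD2r -subr_ge0; exact: le_trans (FG k t v ut tv (lexx v)).
have h3 : `|2 * m%:~R + 1 : R| <= B.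
  rewrite /B ler_pdivlMr // -{1}(gtr0_norm d0) -normrM mulrC -E.
  have -> : f k t - c = f k u + (f k t - f k u) - c by ring.
  apply: (le_trans (ler_normB _ _)); rewrite lerD2r; apply: (le_trans (ler_normD _ _)).
  by rewrite lerD2l (le_trans h1).
have h4 : ((absz m)%:R : R) <= `|2 * m%:~R + 1|.
  rewrite -[leLHS]/((Posz (absz m))%:~R) abszE intr_norm.
  case: (lerP 0 m) => m0.
    have : (0 : R) <= m%:~R by rewrite ler0z.
    by move=> h; rewrite !ger0_norm; lra.
  have : (m%:~R : R) <= -1 by rewrite -[-1]/((-1)%:~R) ler_int; lia.
  by move=> h; rewrite !ler0_norm; lra.
have := le_lt_trans (le_trans h4 h3) (archi_boundP (le_trans (normr_ge0 _) h3)).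
by rewrite ltr_nat => /ltnW.
Qed.
End Indicatrix.

(** * Approximation by polygons *)

Section Polyline.
Variable R : realType.
Implicit Types (N : nat) (T : nat -> R) (w : nat -> R * R) (t x : R).

Definition aff (c1 c2 d : R) (z : R * R) : R * R := (c1 + d * z.1, c2 + d * z.2).

Lemma simple_polygon_aff (c1 c2 d : R) N w : d != 0 -> simple_polygon N w -> simple_polygon N (fun i => aff c1 c2 d (w i)).
Proof.
move=> d0 [h1 h2].
have inj : injective (aff c1 c2 d).
  by move=> [a b] [a' b'] /= [/addrI/(mulfI d0) -> /addrI/(mulfI d0) ->].
have lerpE x u v : lerp x (aff c1 c2 d u) (aff c1 c2 d v) = aff c1 c2 d (lerp x u v).
  by rewrite /lerp /aff /=; congr (_, _); ring.
split=> [i iN /inj|i i' x y ii' iN x01 y01]; first exact: h1.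
by rewrite !lerpE => /inj; exact: h2.
Qed.

Definition polyline N T w : map2 R :=
  fun t => (interp N T (fun i => (w i).1) t, interp N T (fun i => (w i).2) t).

Definition dpolyline N T w : map2 R :=
  fun t => (dinterp N T (fun i => (w i).1) t, dinterp N T (fun i => (w i).2) t).

Lemma polyline_lerp N T w i t : (forall j, (j < N)%N -> T j < T j.+1) -> (i < N)%N -> T i <= t <= T i.+1 ->
  polyline N T w t = lerp ((t - T i) / (T i.+1 - T i)) (w i) (w i.+1).
Proof.
move=> Tlt iN ti; rewrite /polyline !(interp_piece _ Tlt iN ti) /lerp /slope.
have d0 : T i.+1 - T i != 0 by rewrite subr_eq0 gt_eqF // Tlt.
by congr (_, _); field.
Qed.

Lemma piece_ex_closed N T t : (0 < N)%N -> (forall j, (j < N)%N -> T j < T j.+1) -> T 0%N <= t <= T N ->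
  exists2 i, (i < N)%N & T i <= t <= T i.+1.
Proof.
move=> N0 Tlt /andP[]; rewrite le_eqVlt => /orP[/eqP <- _|t0 tN].
  by exists 0%N => //; rewrite lexx ltW // Tlt.
by have [i iN /andP[/ltW h1 h2]] := piece_ex Tlt t0 tN; exists i => //; rewrite h1.
Qed.

Lemma lerp_inj x y (a b : R * R) : a <> b -> lerp x a b = lerp y a b -> x = y.
Proof.
case: a b => [a1 a2] [b1 b2] ab [/= e1 e2]; apply: contrapT => xy; apply: ab.
have d0 : x - y != 0 by rewrite subr_eq0; apply/eqP.
have f1 : (x - y) * (b1 - a1) = 0 by move/eqP: e1; rewrite -subr_eq0 => /eqP <-; ring.
have f2 : (x - y) * (b2 - a2) = 0 by move/eqP: e2; rewrite -subr_eq0 => /eqP <-; ring.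
move/eqP: f1; rewrite mulf_eq0 (negbTE d0) /= subr_eq0 => /eqP ->.
by move/eqP: f2; rewrite mulf_eq0 (negbTE d0) /= subr_eq0 => /eqP ->.
Qed.

Section Simple.
Variables (N : nat) (T : nat -> R) (w : nat -> R * R).
Hypotheses (N0 : (0 < N)%N) (T0 : T 0%N = 0) (TN : T N = 1) (Tlt : forall i, (i < N)%N -> T i < T i.+1).
Hypothesis SP : simple_polygon N w.

(** Within one piece the edge does not degenerate; for two pieces, simplicity leaves only their
    common break time. *)
Lemma polyline_inj s t : 0 <= s <= 1 -> 0 <= t <= 1 -> polyline N T w s = polyline N T w t -> s = t.
Proof.
rewrite -T0 -TN => s01 t01 E.
have [i iN si] := piece_ex_closed N0 Tlt s01; have [j jN tj] := piece_ex_closed N0 Tlt t01.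
wlog ij : s t i j iN jN si tj {s01 t01} E / (i <= j)%N.
  move=> h; have [ij|ji] := leqP i j; first exact: h E ij.
  by apply/esym; apply: h (esym E) (ltnW ji).
have [h1 h2] := SP.
have l i' : (i' < N)%N -> 0 < T i'.+1 - T i' by move=> iN'; rewrite subr_gt0 Tlt.
have param i' t' : (i' < N)%N -> T i' <= t' <= T i'.+1 -> 0 <= (t' - T i') / (T i'.+1 - T i') <= 1.
  move=> iN' /andP[a b]; rewrite divr_ge0 ?subr_ge0 ?(ltW (Tlt iN')) //=.
  by rewrite ler_pdivrMr ?l // mul1r lerD2r.
rewrite (polyline_lerp w Tlt iN si) (polyline_lerp w Tlt jN tj) in E.
move: ij; rewrite leq_eqVlt => /orP[/eqP Eij|ij].
  rewrite -{}Eij in E tj *.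
  have d0 : (T i.+1 - T i)^-1 != 0 by rewrite invr_eq0 gt_eqF // l.
  by have /(mulIf d0)/addIr := lerp_inj (h1 i iN) E.
have [Ej x1 y0] := h2 i j _ _ ij jN (param i s iN si) (param j t jN tj) E.
have /addIr -> : s - T i = T i.+1 - T i by rewrite -[RHS]mul1r -x1 divfK // gt_eqF // l.
move/eqP: y0; rewrite mulf_eq0 invr_eq0 (gt_eqF (l j jN)) orbF subr_eq0 => /eqP ->.
by rewrite Ej.
Qed.

Lemma polyline_cont : continuous (fun t => (polyline N T w t).1) /\ continuous (fun t => (polyline N T w t).2).
Proof. by split; exact: cont_interp. Qed.

Lemma polyline_within : {within @I01 R, continuous (polyline N T w)}.
Proof.
by apply/within_pair; split; apply: continuous_subspaceT; [exact: (proj1 polyline_cont)|exact: (proj2 polyline_cont)].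
Qed.

Lemma polyline_pwaff : piecewise_affine (polyline N T w).
Proof.
exists N, T; split => // i iN.
exists ((w i).1 - slope T (fun i => (w i).1) i * T i, (w i).2 - slope T (fun i => (w i).2) i * T i),
  (slope T (fun i => (w i).1) i, slope T (fun i => (w i).2) i) => t _ t1 t2.
rewrite /polyline !(interp_piece _ Tlt iN) ?t1 //=; congr (_, _); ring.
Qed.

Lemma polyline_T01 i : (i <= N)%N -> 0 <= T i <= 1.
Proof. by move=> iN; rewrite -T0 -TN !(T_mono Tlt). Qed.

Lemma polyline_W1p p : 1 <= p -> W1p_with p (polyline N T w) (dpolyline N T w).
Proof.
move=> p1; split; first exact: polyline_within.
- exact: (W1p_interp (fun i => (w i).1) p1 Tlt polyline_T01).
- exact: (W1p_interp (fun i => (w i).2) p1 Tlt polyline_T01).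
Qed.

Lemma polyline_injI : {in @I01 R &, injective (polyline N T w)}.
Proof.
move=> s t /set_mem/I01P/andP[/ltW s0 /ltW s1] /set_mem/I01P/andP[/ltW t0 /ltW t1].
by apply: polyline_inj; rewrite ?s0 ?t0.
Qed.

Lemma dist2_gt0 (a b : R * R) : a <> b -> 0 < dist2 a b.
Proof.
move=> ab; rewrite /dist2 sqrtr_gt0 lt_neqAle addr_ge0 ?sqr_ge0 // andbT eq_sym.
apply: contra_notN ab; rewrite paddr_eq0 ?sqr_ge0 // !sqrf_eq0 !subr_eq0.
by case: a b => [? ?] [? ?] /= /andP[/eqP -> /eqP ->].
Qed.

(** The polygon is injective on the closed interval, so on the compact sets [[0, x - e]] and
    [[x + e, 1]] its distance from the image of [x] has a positive minimum. *)
Lemma polyline_homeo : homeo_onto_image (polyline N T w).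
Proof.
split; [exact: polyline_within|exact: polyline_injI|].
move=> x /I01P /andP[x0 x1] e e0; set P := polyline N T w.
have [c1 c2] := polyline_cont; rewrite -/P in c1 c2.
have cd : continuous (fun t => dist2 (P t) (P x)).
  have cs : continuous (fun t => ((P t).1 - (P x).1) ^+ 2 + ((P t).2 - (P x).2) ^+ 2).
    by apply: contD; apply: contM; apply: contB => //; exact: contC.
  exact: (cont_comp cs (@sqrt_continuous R)).
have sep a b : 0 <= a -> b <= 1 -> (forall t, a <= t <= b -> t != x) ->
    exists2 d : R, 0 < d & forall t, a <= t <= b -> d <= dist2 (P t) (P x).
  move=> a0 b1 ne; have [ab|ba] := leP a b; last first.
    by exists 1 => // t /andP[h1 h2]; have := lt_le_trans ba (le_trans h1 h2); rewrite ltxx.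
  have [c cab Hc] := EVT_min ab (continuous_subspaceT cd).
  rewrite in_itv /= in cab; exists (dist2 (P c) (P x)); last by move=> t tab; apply: Hc; rewrite in_itv.
  apply: dist2_gt0 => E; have /eqP := ne c cab; apply.
  apply: polyline_inj E; last by rewrite !ltW.
  by case/andP: cab => h1 h2; rewrite (le_trans a0 h1) (le_trans h2 b1).
have [|||d1 d10 D1] := sep 0 (x - e); [exact: lexx|lra|by move=> t /andP[_ h]; rewrite lt_eqF //; lra|].
have [|||d2 d20 D2] := sep (x + e) 1; [lra|exact: lexx|by move=> t /andP[h _]; rewrite gt_eqF //; lra|].
exists (Num.min d1 d2); first by rewrite lt_min d10.
move=> y /I01P /andP[y0 y1]; rewrite lt_min => /andP[h1 h2].
rewrite ltNge; apply/negP => h.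
have [yx|xy] := leP y x.
  move: h; rewrite ler0_norm ?subr_le0 // => h.
  by move: h1; rewrite ltNge D1 // (ltW y0) /=; lra.
move: h; rewrite gtr0_norm ?subr_gt0 // => h.
by move: h2; rewrite ltNge D2 // (ltW y1) andbT; lra.
Qed.
End Simple.
End Polyline.

Section FitsExist.
Variable R : realType.
Notation mu := (@lebesgue_measure R).
Notation TR := (measurableTypeR R).

Lemma osc_scale (F : R -> R) (c d a b eta : R) : 0 < d -> 4 * d <= eta ->
  osc (fun t => (F t - c) / d) a b 4 -> osc F a b eta.
Proof.
move=> d0 de H x y hx hy; apply: le_trans de.
have := H x y hx hy; rewrite -mulrBl opprB addrA subrK normrM normfV (gtr0_norm d0).
by rewrite ler_pdivrMr.
Qed.

Lemma slope_aff (T : nat -> R) (w : nat -> R) (c d : R) i : slope T (fun i => c + d * w i) i = d * slope T w i.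
Proof. by rewrite /slope addrAC opprD addrA subrr add0r addrC -mulrBr mulrA. Qed.

Lemma fits_scale (F : R -> R) (c d u v eta : R) N (T w : nat -> R) (K : nat -> nat) : 0 < d -> d <= 1 -> 4 * d <= eta ->
  let f := fun t => (F t - c) / d in
  [/\ (0 < N)%N, T 0%N = 0, T N = 1 & forall i, (i < N)%N -> T i < T i.+1] ->
  (forall i, (i < N)%N -> K i = 0%N -> `|slope T w i - slope T (f \o T) i| <= eta) ->
  (forall i, (i < N)%N -> (0 < K i)%N -> `|slope T w i| <= eta) ->
  (forall i, (i < N)%N -> (K i < 2)%N -> osc f (T i) (T i.+1) 4) ->
  (forall i, (i < N)%N -> (1 < K i)%N -> forall t, T i <= t <= T i.+1 -> u <= t <= v ->
     osc f u t 4 \/ osc f t v 4) ->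
  \sum_(i < N | K i == 1%N) (T i.+1 - T i) <= eta ->
  fits F u v eta N T (fun i => c + d * w i) K.
Proof.
move=> d0 d1 de f HT Hl Hs Ho He Hm.
have eta0 : 0 <= eta by lra.
have le_d (x : R) : `|x| <= eta -> `|d * x| <= eta.
  move=> h; rewrite normrM (gtr0_norm d0); apply: le_trans h.
  by rewrite ler_piMl.
split => //.
- move=> i iN K0; rewrite slope_aff.
  have -> : slope T (F \o T) i = d * slope T (f \o T) i.
    rewrite -(slope_aff T (f \o T) c d); congr slope; apply/funext => j; rewrite /f /=.
    by field; rewrite gt_eqF.
  by rewrite -mulrBr; apply: le_d; exact: Hl.
- by move=> i iN K0; rewrite slope_aff; apply: le_d; exact: Hs.
- by move=> i iN K2; apply: osc_scale de _ => //; exact: Ho.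
- split => // i iN K1 t ti tuv.
  by case: (He i iN K1 t ti tuv) => H; [left|right]; exact: osc_scale de H.
Qed.

Lemma cont_norm_prim (G : R -> R) (a c d : R) : L1 setT G -> continuous (fun t => (a + prim G t - c) / d).
Proof.
move=> IG; have cp := cont_prim IG.
by apply: contM; [apply: contB; [apply: contD => //; exact: contC|exact: contC]|exact: contC].
Qed.

(** The mesh is set by [d = eta / 4], so that oscillation 4 in grid units becomes [eta]. The
    constants [a1], [a2] are there because [prim] recovers a curve only up to translation. *)
Lemma fits_exist (G1 G2 : R -> R) (a1 a2 : nat -> R) (H1 H2 : nat -> R -> R) (eta : R) :
  L1 setT G1 -> L1 setT G2 -> (forall k, L1 setT (H1 k)) -> (forall k, L1 setT (H2 k)) ->
  (forall k s t, 0 < s < 1 -> 0 < t < 1 -> prim (H1 k) s = prim (H1 k) t -> prim (H2 k) s = prim (H2 k) t -> s = t) ->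
  (forall e : R, 0 < e -> exists k, forall t, 0 < t < 1 ->
     `|a1 k + prim (H1 k) t - prim G1 t| <= e /\ `|a2 k + prim (H2 k) t - prim G2 t| <= e) ->
  0 < eta -> eta <= 1 -> exists N T (w : nat -> R * R) K, [/\ simple_polygon N w,
     fits (prim G1) (eta / 4) (1 - eta / 4) eta N T (fun i => (w i).1) K &
     fits (prim G2) (eta / 4) (1 - eta / 4) eta N T (fun i => (w i).2) K].
Proof.
move=> IG1 IG2 IH1 IH2 inj cv eta0 eta1.
set u := eta / 4; set v := 1 - eta / 4; pose d := eta / 4.
have [[u0 uv] v1 d0 [d1 d4]] : [/\ 0 < u /\ u < v, v < 1, 0 < d & d <= 1 /\ 4 * d <= eta].
  by rewrite /u /v /d; split; [split; lra|lra|lra|split; lra].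
have uv01 t : u <= t <= v -> 0 < t < 1.
  by move=> /andP[h1 h2]; rewrite (lt_le_trans u0 h1) (le_lt_trans h2 v1).
have off (G : R -> R) (a : nat -> R) (H : nat -> R -> R) : L1 setT G -> (forall k, L1 setT (H k)) -> exists c,
    finite_set [set t | u <= t <= v /\ odd_line ((prim G t - c) / d)] /\
    forall k, finite_set [set t | u <= t <= v /\ odd_line ((a k + prim (H k) t - c) / d)].
  move=> IG IH.
  (* Index 0 is the limit curve and the others are the approximants, so that one offset suits
     all. *)
  pose f k := if k is k'.+1 then (fun t => a k' + prim (H k') t) else prim G.
  pose g k := if k is k'.+1 then prim (fun t => `|H k' t|) else prim (fun t => `|G t|).
  have [|c Hc] := @generic_offset R f g u v d uv d0.
    move=> [|k] x y _ xy _ /=; first exact: prim_abs_le.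
    by rewrite opprD addrACA subrr add0r; exact: prim_abs_le.
  by exists c; split; [exact: (Hc 0%N)|move=> k; exact: (Hc k.+1)].
have [c1 [fc1 fk1]] := off G1 a1 H1 IG1 IH1; have [c2 [fc2 fk2]] := off G2 a2 H2 IG2 IH2.
have setU_hit (f1 f2 : R -> R) : finite_set [set t | u <= t <= v /\ odd_line (f1 t)] ->
    finite_set [set t | u <= t <= v /\ odd_line (f2 t)] -> finite_set [set t | u <= t <= v /\ hit f1 f2 t].
  move=> h1 h2; apply: (@sub_finite_set _ _ ([set t | u <= t <= v /\ odd_line (f1 t)] `|` [set t | u <= t <= v /\ odd_line (f2 t)])).
    by move=> t /= [tuv [h|h]]; [left|right].
  by rewrite finite_setU.
have cG (G : R -> R) (c : R) : L1 setT G -> continuous (fun t => (prim G t - c) / d).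
  by move=> IG; apply: contM; [apply: contB; [exact: cont_prim|exact: contC]|exact: contC].
have [|N [T [w [K [[N0 [T0 TN]] Tlt SP Hosc [Hl Hs He Hm]]]]]] :=
  @straighten R (fun t => (prim G1 t - c1) / d) (fun t => (prim G2 t - c2) / d) u v (cG G1 c1 IG1) (cG G2 c2 IG2) u0 (ltW uv) v1
  (setU_hit _ _ fc1 fc2) _ eta eta0.
  move=> e e0; have [k Hk] := cv (e * d) (mulr_gt0 e0 d0).
  exists (fun t => (a1 k + prim (H1 k) t - c1) / d), (fun t => (a2 k + prim (H2 k) t - c2) / d); split.
  - exact: cont_norm_prim.
  - exact: cont_norm_prim.
  - have dn : d^-1 != 0 by rewrite invr_eq0 gt_eqF.
    move=> s t suv tuv /(mulIf dn)/addIr/addrI e1 /(mulIf dn)/addIr/addrI e2.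
    by apply: inj e1 e2; exact: uv01.
  - by apply: setU_hit; [exact: fk1|exact: fk2].
  - move=> t tuv; have [h1 h2] := Hk t (uv01 t tuv).
    have red (A B c x : R) : `|A - B| <= x * d -> `|(A - c) / d - (B - c) / d| <= x.
      by rewrite -mulrBl opprB addrA subrK normrM normfV (gtr0_norm d0) ler_pdivrMr.
    by split; exact: red.
exists N, T, (fun i => aff c1 c2 d (w i)), K; split.
- by apply: simple_polygon_aff => //; rewrite gt_eqF.
- apply: (@fits_scale (prim G1) c1 d u v eta N T (fun i => (w i).1) K d0 d1 d4) => //.
  + by move=> i iN K0; have [] := Hl i iN K0.
  + by move=> i iN K0; have [] := Hs i iN K0.
  + by move=> i iN K0; have [] := Hosc i iN K0.
  + by move=> i iN K0 t ti tuv; case: (He i iN K0 t ti tuv) => -[]; [left|right].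
- apply: (@fits_scale (prim G2) c2 d u v eta N T (fun i => (w i).2) K d0 d1 d4) => //.
  + by move=> i iN K0; have [] := Hl i iN K0.
  + by move=> i iN K0; have [] := Hs i iN K0.
  + by move=> i iN K0; have [] := Hosc i iN K0.
  + by move=> i iN K0 t ti tuv; case: (He i iN K0 t ti tuv) => -[]; [left|right].
Qed.

End FitsExist.

Section Approx.
Variable R : realType.
Notation mu := (@lebesgue_measure R).
Notation TR := (measurableTypeR R).
Implicit Types (f g : R -> R) (p : R).

Lemma half01 : 0 < (2^-1 : R) < 1.
Proof. by rewrite invr_gt0 ltr0n /= invf_lt1 ?ltr0n // ltr1n. Qed.

Lemma AC_prim p f g : 1 <= p -> AC p f g ->
  [/\ L1 setT (g \_ (@I01 R)), isLp p (g \_ (@I01 R)) &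
      exists c, forall x, 0 < x < 1 -> f x = c + prim (g \_ (@I01 R)) x].
Proof.
move=> p1 [cf W]; have [_ lg _] := W; have /andP[h0 h1] := half01.
split; [exact: L1_patchT (@measurable_I01 R) (isLp_L1 p1 lg)|exact: isLp_patch|].
exists (f 2^-1 - prim (g \_ (@I01 R)) 2^-1) => x /andP[x0 x1].
have [xh|hx] := leP x 2^-1.
  by have := weak_AC p1 cf W x0 xh h1; move: (prim _ _) (prim _ _) => a b; lra.
by have := weak_AC p1 cf W h0 (ltW hx) x1; move: (prim _ _) (prim _ _) => a b; lra.
Qed.

(** A Poincare inequality: from the zero [x0], [|f|] is at most the integral of [|g|], which
    [L1_le_lp] bounds by twice the norm of [g]. *)
Lemma lp_fun_le p f g x0 : 1 <= p -> AC p f g -> 0 < x0 < 1 -> f x0 = 0 -> lp p f <= 2 `^ p * lp p g.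
Proof.
move=> p1 A /andP[h0 h1] fx0; have [_ [lf lg _]] := A.
have p0 : 0 <= p by lra.
have Ig := isLp_L1 p1 lg.
have bd x : @I01 R x -> `|f x| <= 2 * lp p g `^ p^-1.
  move=> /I01P /andP[x1 x2]; apply: le_trans (L1_le_lp p1 lg).
  have -> : f x = f x - f x0 by rewrite fx0 subr0.
  have [xh|hx] := leP x x0.
    by rewrite distrC; apply: (le_trans (AC_diff p1 A x1 xh h1)); exact: int_sub_I01.
  by apply: (le_trans (AC_diff p1 A h0 (ltW hx) x2)); exact: int_sub_I01.
have -> : 2 `^ p * lp p g = (2 * lp p g `^ p^-1) `^ p.
  by rewrite powRM ?powR_ge0 // powR_invK // lp_ge0.
set M := 2 * _ in bd *; have M0 : 0 <= M by rewrite mulr_ge0 // powR_ge0.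
have -> : M `^ p = \int[mu]_(t in @I01 R) (M `^ p) by rewrite Rintegral_cst // [X in fine X]mu_I01 mulr1.
apply: le_Rintegral; [exact: measurable_I01|exact: isLp_powR|exact: L1_cst01|].
by move=> t /bd h; apply: ge0_ler_powR => //; rewrite nnegrE.
Qed.

Lemma interp_aff N T (w : nat -> R) (c : R) t : interp N T (fun i => c + 1 * w i) t = c + interp N T w t.
Proof.
by rewrite /interp mul1r -addrA; congr (_ + (_ + _)); apply: eq_bigr => i _; rewrite slope_aff mul1r.
Qed.

Lemma dinterp_aff N T (w : nat -> R) (c : R) : dinterp N T (fun i => c + 1 * w i) = dinterp N T w.
Proof. by apply/funext => t; apply: eq_bigr => i _; rewrite slope_aff mul1r. Qed.

Lemma lp_patch_sub p f g : lp p (fun t => f t - (g \_ (@I01 R)) t) = lp p (fun t => f t - g t).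
Proof. by apply: eq_Rintegral => t It; rewrite patchE It. Qed.

Lemma dist2_comp (a b : R * R) : `|a.1 - b.1| <= dist2 a b /\ `|a.2 - b.2| <= dist2 a b.
Proof.
by rewrite /dist2 -!sqrtr_sqr; split; apply: ler_wsqrtr; rewrite ?lerDl ?lerDr sqr_ge0.
Qed.

Lemma approx p (phi dphi : map2 R) (phik : nat -> map2 R) : 1 <= p -> W1p_with p phi dphi ->
  (forall k, in_Fp p (phik k)) -> unif_conv phik phi ->
  exists N T (w : nat -> nat -> R * R), (forall n, [/\ (0 < N n)%N, T n 0%N = 0, T n (N n) = 1,
       (forall i, (i < N n)%N -> T n i < T n i.+1) & simple_polygon (N n) (w n)]) /\
    forall e : R, 0 < e -> exists M, forall n, (M <= n)%N ->
      lp p (fun t => dinterp (N n) (T n) (fun i => (w n i).1) t - comp1 dphi t) <= e /\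
      lp p (fun t => dinterp (N n) (T n) (fun i => (w n i).2) t - comp2 dphi t) <= e.
Proof.
move=> p1 W HF U.
have /choice[dk Hdk] : forall k, exists dk, W1p_with p (phik k) dk by move=> k; case: (HF k).
have [A1 A2] := W1p_with_AC W.
have [IG1 lG1 [b1 Hb1]] := AC_prim p1 A1; have [IG2 lG2 [b2 Hb2]] := AC_prim p1 A2.
have /choice[c1 Hc1] k : exists c, forall x, 0 < x < 1 -> comp1 (phik k) x = c + prim (comp1 (dk k) \_ (@I01 R)) x.
  by have [B1 _] := W1p_with_AC (Hdk k); have [] := AC_prim p1 B1.
have /choice[c2 Hc2] k : exists c, forall x, 0 < x < 1 -> comp2 (phik k) x = c + prim (comp2 (dk k) \_ (@I01 R)) x.
  by have [_ B2] := W1p_with_AC (Hdk k); have [] := AC_prim p1 B2.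
have FE eta : 0 < eta -> eta <= 1 -> exists N T (w : nat -> R * R) K, [/\ simple_polygon N w,
     fits (prim (comp1 dphi \_ (@I01 R))) (eta / 4) (1 - eta / 4) eta N T (fun i => (w i).1) K &
     fits (prim (comp2 dphi \_ (@I01 R))) (eta / 4) (1 - eta / 4) eta N T (fun i => (w i).2) K].
  apply: (@fits_exist R _ _ (fun k => c1 k - b1) (fun k => c2 k - b2) (fun k => comp1 (dk k) \_ (@I01 R)) (fun k => comp2 (dk k) \_ (@I01 R))) => //.
  - by move=> k; have [B1 _] := W1p_with_AC (Hdk k); have [] := AC_prim p1 B1.
  - by move=> k; have [_ B2] := W1p_with_AC (Hdk k); have [] := AC_prim p1 B2.
  - move=> k s t s01 t01 e1 e2; have [_ _ inj] := HF k.
    apply: inj; try by apply/mem_set/I01P.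
    rewrite [LHS]surjective_pairing [RHS]surjective_pairing; congr (_, _).
      by rewrite -/(comp1 (phik k) s) -/(comp1 (phik k) t) !Hc1 // e1.
    by rewrite -/(comp2 (phik k) s) -/(comp2 (phik k) t) !Hc2 // e2.
  - move=> e e0; have [k Hk] := U e e0; exists k => t t01.
    have /ltW h := Hk k (leqnn k) t (proj2 (I01P t) t01).
    have [h1 h2] := dist2_comp (phik k t) (phi t).
    have {}h1 := le_trans h1 h; have {}h2 := le_trans h2 h.
    rewrite -/(comp1 (phik k) t) -/(comp1 phi t) Hc1 // Hb1 // in h1.
    rewrite -/(comp2 (phik k) t) -/(comp2 phi t) Hc2 // Hb2 // in h2.
    have E (c b P Q : R) : c - b + P - Q = c + P - (b + Q) by ring.
    by rewrite !E.
pose Q n (s : nat * ((nat -> R) * ((nat -> R * R) * (nat -> nat)))) :=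
  [/\ simple_polygon s.1 s.2.2.1,
     fits (prim (comp1 dphi \_ (@I01 R))) (hpow R n / 4) (1 - hpow R n / 4) (hpow R n) s.1 s.2.1 (fun i => (s.2.2.1 i).1) s.2.2.2 &
     fits (prim (comp2 dphi \_ (@I01 R))) (hpow R n / 4) (1 - hpow R n / 4) (hpow R n) s.1 s.2.1 (fun i => (s.2.2.1 i).2) s.2.2.2].
have [s Hs] : {s & forall n, Q n (s n)}.
  apply: (@choice nat _ Q) => n.
  have [N [T [w [K H]]]] := FE _ (hpow_gt0 R n) (hpow_le1 R n).
  by exists (N, (T, (w, K))).
exists (fun n => (s n).1), (fun n => (s n).2.1), (fun n => (s n).2.2.1); split.
  by move=> n; have [SP [[? ? ? ?] _ _ _ _] _] := Hs n; split.
have Huv n : hpow R n / 4 <= hpow R n /\ 1 - hpow R n <= 1 - hpow R n / 4.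
  by have := hpow_gt0 R n; split; lra.
move=> e e0.
have [|M1 H1] := fits_cvg (N := fun n => (s n).1) (T := fun n => (s n).2.1) (w := fun n i => ((s n).2.2.1 i).1)
  (K := fun n => (s n).2.2.2) p1 IG1 lG1 _ Huv e0; first by move=> n; have [] := Hs n.
have [|M2 H2] := fits_cvg (N := fun n => (s n).1) (T := fun n => (s n).2.1) (w := fun n i => ((s n).2.2.1 i).2)
  (K := fun n => (s n).2.2.2) p1 IG2 lG2 _ Huv e0; first by move=> n; have [] := Hs n.
exists (maxn M1 M2) => n; rewrite geq_max => /andP[n1 n2].
by split; rewrite -lp_patch_sub; [exact: H1|exact: H2].
Qed.

(** [approx] controls derivatives only. Each polygon is translated so as to agree with [phi] at 1/2,
    which keeps it simple, and then [lp_fun_le] controls the values as well. *)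
Lemma unif_strong p (phi : map2 R) (phik : nat -> map2 R) : 1 <= p -> inW1p p phi ->
  (forall k, in_Fp p (phik k)) -> unif_conv phik phi ->
  exists psi, (forall n, [/\ in_Fp p (psi n), homeo_onto_image (psi n) & piecewise_affine (psi n)]) /\ W1p_strong p psi phi.
Proof.
move=> p1 [dphi W] HF U.
have [N [T [w [Hw cv]]]] := approx p1 W HF U.
pose s1 n := (phi 2^-1).1 - interp (N n) (T n) (fun i => (w n i).1) 2^-1.
pose s2 n := (phi 2^-1).2 - interp (N n) (T n) (fun i => (w n i).2) 2^-1.
pose w' n i := aff (s1 n) (s2 n) 1 (w n i).
pose psi n := polyline (N n) (T n) (w' n); pose dpsi n := dpolyline (N n) (T n) (w' n).
have HW n : W1p_with p (psi n) (dpsi n).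
  by have [N0 T0 TN Tlt SP] := Hw n; exact: polyline_W1p.
have SP' n : simple_polygon (N n) (w' n).
  by have [N0 T0 TN Tlt SP] := Hw n; apply: simple_polygon_aff => //; exact: oner_neq0.
exists psi; split.
  move=> n; have [N0 T0 TN Tlt _] := Hw n; have SP := SP' n.
  split; [|exact: polyline_homeo|exact: polyline_pwaff].
  by split; [exists (dpsi n); exact: HW|exact: polyline_within|exact: polyline_injI].
exists dpsi, dphi; split => //.
(* Two components, each with its derivative and, at the price of the factor [2^p], its values. *)
pose C : R := 2 * (1 + 2 `^ p).
have C0 : 0 < C by rewrite mulr_gt0 // ltr_wpDr ?powR_ge0.
have D1 n : comp1 (dpsi n) = dinterp (N n) (T n) (fun i => (w n i).1) by exact: dinterp_aff.
have D2 n : comp2 (dpsi n) = dinterp (N n) (T n) (fun i => (w n i).2) by exact: dinterp_aff.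
have P1 n : comp1 (psi n) 2^-1 = comp1 phi 2^-1.
  by rewrite /comp1 /psi /polyline /w' /aff /= interp_aff /s1 subrK.
have P2 n : comp2 (psi n) 2^-1 = comp2 phi 2^-1.
  by rewrite /comp2 /psi /polyline /w' /aff /= interp_aff /s2 subrK.
apply/cvgrPdist_le => e e0.
have ep : 0 < e `^ p / C by rewrite divr_gt0 // powR_gt0.
have [M HM] := cv _ ep.
exists M => // n /= /HM [h1 h2]; rewrite sub0r normrN ger0_norm; last exact: powR_ge0.
have Ws := W1p_with_sub p1 (HW n) W.
rewrite (W1p_normE p1 Ws); apply: powR_inv_le => //; [exact: lp2_ge0|exact: ltW|].
have [B1 B2] := W1p_with_AC Ws.
have k1 : lp p (comp1 (subm (psi n) phi)) <= 2 `^ p * lp p (comp1 (subm (dpsi n) dphi)).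
  by apply: (lp_fun_le p1 B1 half01); change (comp1 (psi n) 2^-1 - comp1 phi 2^-1 = 0); rewrite P1 subrr.
have k2 : lp p (comp2 (subm (psi n) phi)) <= 2 `^ p * lp p (comp2 (subm (dpsi n) dphi)).
  by apply: (lp_fun_le p1 B2 half01); change (comp2 (psi n) 2^-1 - comp2 phi 2^-1 = 0); rewrite P2 subrr.
have l1 : lp p (comp1 (subm (dpsi n) dphi)) <= e `^ p / C.
  by apply: le_trans h1; rewrite -D1.
have l2 : lp p (comp2 (subm (dpsi n) dphi)) <= e `^ p / C.
  by apply: le_trans h2; rewrite -D2.
have E : e `^ p = 2 `^ p * (e `^ p / C) + 2 `^ p * (e `^ p / C) + e `^ p / C + e `^ p / C.
  have c0 : (1 + 2 `^ p : R) != 0 by rewrite gt_eqF // ltr_wpDr ?powR_ge0.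
  by rewrite /C; field.
have q0 : 0 <= 2 `^ p :> R := powR_ge0 _ _.
rewrite E; exact: (lerD (lerD (lerD (le_trans k1 (ler_wpM2l q0 l1)) (le_trans k2 (ler_wpM2l q0 l2))) l1) l2).
Qed.

End Approx.

(** * Equicontinuity and the cycle of implications *)

Section Equicont.
Variable R : realType.

Lemma within_dist2 (f : map2 R) (x e : R) : {within @I01 R, continuous f} -> I01 x -> 0 < e ->
  exists2 d : R, 0 < d & forall y, `|y - x| < d -> I01 y ->
    `|comp1 f y - comp1 f x| <= e /\ `|comp2 f y - comp2 f x| <= e.
Proof.
move=> /within_pair[c1 c2] Ix e0.
have [d1 d10 D1] := within_eps c1 Ix e0; have [d2 d20 D2] := within_eps c2 Ix e0.
exists (Num.min d1 d2); first by rewrite lt_min d10.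
by move=> y; rewrite lt_min => /andP[/ltW h1 /ltW h2] Iy; split; [exact: D1|exact: D2].
Qed.

Lemma dist3 (a b c d e : R) : `|a - b| <= e / 8 -> `|c - b| <= e / 8 -> `|d - c| <= e / 8 -> `|d - a| <= 3 * (e / 8).
Proof. by rewrite !ler_norml => /andP[? ?] /andP[? ?] /andP[? ?]; apply/andP; split; lra. Qed.

(** The late members inherit the modulus of continuity of [phi] at [x], and the finitely many others
    are handled by their own continuity. *)
Lemma unif_equicont (phik : nat -> map2 R) (phi : map2 R) : (forall k, {within @I01 R, continuous (phik k)}) ->
  {within @I01 R, continuous phi} -> unif_conv phik phi -> equicont phik.
Proof.
move=> ck cphi U x Ix e e0; have e8 : 0 < e / 8 by rewrite divr_gt0.
have fin (y z : R * R) : `|y.1 - z.1| <= 3 * (e / 8) -> `|y.2 - z.2| <= 3 * (e / 8) -> dist2 y z < e.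
  by move=> h1 h2; apply: (le_lt_trans (dist2_le _ _)); lra.
have [N HN] := U _ e8.
have [d0 d00 D0] := within_dist2 cphi Ix e8.
have [d1 d10 D1] : exists2 d : R, 0 < d & forall k, (k < N)%N -> forall y, `|y - x| < d -> I01 y ->
    `|comp1 (phik k) y - comp1 (phik k) x| <= e / 8 /\ `|comp2 (phik k) y - comp2 (phik k) x| <= e / 8.
  elim: (N) => [|n [d d_0 D]]; first by exists 1.
  have [d' d'0 D'] := within_dist2 (ck n) Ix e8.
  exists (Num.min d d'); first by rewrite lt_min d_0.
  move=> k; rewrite ltnS leq_eqVlt => /orP[/eqP -> y|kn y]; rewrite lt_min => /andP[h1 h2] Iy.
    exact: D'.
  exact: D.
exists (Num.min d0 d1); first by rewrite lt_min d00.
move=> k y Iy; rewrite lt_min => /andP[h0 h1].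
have [kN|Nk] := ltnP k N.
  by have [h2 h3] := D1 k kN y h1 Iy; apply: fin; rewrite -/(comp1 _ _) -/(comp2 _ _); lra.
have [g1 g2] := D0 y h0 Iy.
have [x1 x2] := dist2_comp (phik k x) (phi x); have [y1 y2] := dist2_comp (phik k y) (phi y).
have /ltW ex := HN k Nk x Ix; have /ltW ey := HN k Nk y Iy.
apply: fin; first exact: dist3 (le_trans x1 ex) g1 (le_trans y1 ey).
exact: dist3 (le_trans x2 ex) g2 (le_trans y2 ey).
Qed.
End Equicont.

Theorem mainTheorem3 (R : realType) (p : R) (hp : 1 <= p) (phi : map2 R)
    (hphi : inW1p p phi) :
  let S1 := exists phik, (forall k, in_Fp p (phik k)) /\ W1p_strong p phik phi in
  let S1pa := exists phik, (forall k, in_Fp p (phik k) /\ piecewise_affine (phik k))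
                  /\ W1p_strong p phik phi in
  let S2 := exists phik, (forall k, in_Fp p (phik k)) /\ W1p_weak p phik phi in
  let S3 := exists phik, [/\ forall k, in_Fp p (phik k), equicont phik &
                             unif_conv phik phi] in
  let Ha := non_interpenetrative p phi in
  let Hb := exists yk, [/\ forall k, inW1p p (yk k) /\ homeo_onto_image (yk k),
                           W1p_bounded p yk & W1p_weak p yk phi] in
  let Hc := exists yk, [/\ forall k, inW1p p (yk k) /\ homeo_onto_image (yk k),
                           W1p_bounded p yk & W1p_strong p yk phi] in
  let Hcpa := exists yk, [/\ forall k, [/\ inW1p p (yk k), homeo_onto_image (yk k)
                                         & piecewise_affine (yk k)],
                           W1p_bounded p yk & W1p_strong p yk phi] in
  [/\ S1 <-> S2, S2 <-> S3, S1 <-> S1pa &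
      (1 < p -> [/\ Ha <-> Hb, Hb <-> Hc & Hc <-> Hcpa])].
Proof.
move=> S1 S1pa S2 S3 Ha Hb Hc Hcpa.
have cphi : {within @I01 R, continuous phi} by case: hphi => d [].
have pa1 : S1pa -> S1 by move=> [f [Hf C]]; exists f; split => // k; case: (Hf k).
have s12 : S1 -> S2 by move=> [f [Hf C]]; exists f; split => //; exact: strong_weak.
have s23 : S2 -> S3.
  move=> [f [Hf C]]; exists f; have U := weak_unif hp C; split => //.
  by apply: unif_equicont U => // k; case: (Hf k).
have s3pa : S3 -> S1pa.
  move=> [f [Hf _ U]]; have [g [Hg C]] := unif_strong hp hphi Hf U.
  by exists g; split => // k; case: (Hg k).
(* Homeomorphisms in the Sobolev space belong to the class [in_Fp], so the same polygons serve; they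
   are homeomorphisms, and strong convergence bounds their norms. *)
have acpa : Ha -> Hcpa.
  move=> [y [Hy _ U]].
  have Fy k : in_Fp p (y k) by have [? [? ? _]] := Hy k; split.
  have U' : unif_conv y phi.
    move=> e e0; have [N HN] := U e e0; exists N => k Nk x Ix.
    by have [M Me HM] := HN k Nk; exact: le_lt_trans (HM x Ix) Me.
  have [g [Hg C]] := unif_strong hp hphi Fy U'.
  exists g; split => //; last exact: strong_bounded C.
  by move=> k; have [[? _ _] ? ?] := Hg k; split.
have cpac : Hcpa -> Hc by move=> [y [Hy B C]]; exists y; split => // k; case: (Hy k).
have cb : Hc -> Hb by move=> [y [Hy B C]]; exists y; split => //; exact: strong_weak.
have ba : Hb -> Ha.
  move=> [y [Hy B C]]; exists y; split => // e e0.
  have e2 : 0 < e / 2 by rewrite divr_gt0.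
  have [N HN] := weak_unif hp C e2; exists N => k Nk.
  (* A supremum below [e] is expressed by a bound [M < e], hence the margin. *)
  exists (e / 2); first by rewrite ltr_pdivrMr // ltr_pMr // ltr1n.
  by move=> x Ix; apply: ltW; exact: HN.
split; [tauto|tauto|tauto|move=> _; split; tauto].
Qed.
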